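(* Let $P$ be the poset of simplices of a (possibly infinite) abstract simplicial complex, and let $\sigma\in P$ with $n=\dim(\sigma)$. Then the geometric realization of the link $\left|\overline{P_{\ge\sigma}}-P_{\ge\sigma}\right|$ is the $n$th unreduced suspension of the geometric realization of the small link $|P_{>\sigma}|$. Consequently, $$S^{n+1}|P_{>\sigma}|\simeq S^1S^n|P_{>\sigma}|\xrightarrow{\sim}S^1\left(\left|\overline{P_{\ge\sigma}}-P_{\ge\sigma}\right|\right)\xrightarrow{\sim}\mathbb{L}_P^{\mathcal{S}}(\sigma).$$
   Context: The poset of simplices of an abstract simplicial complex is the set of its nonempty simplices ordered by inclusion; $\dim(\sigma)$ is the dimension of the simplex $\sigma$ (number of vertices minus one). $P_{\ge\sigma}=\{\tau\in P:\tau\ge\sigma\}$, $P_{>\sigma}=\{\tau\in P:\tau>\sigma\}$, and for a subposet $Q\subset P$, $\overline{Q}$ is the smallest downward closed subset of $P$ containing $Q$. The link of $\sigma$ is the subposet $\overline{P_{\ge\sigma}}-P_{\ge\sigma}$; the small link of $\sigma$ is $P_{>\sigma}$. $|Q|$ denotes the geometric realization (homotopy type of the nerve) of a poset $Q$. Unreduced suspension: for a space $X$ and $n\geq 0$, $S^n(X)$ is the (homotopy) colimit of the functor from the poset of proper subsets of $\{0,\dots,n\}$ (ordered by inclusion) to spaces sending $\emptyset\mapsto X$ and every nonempty proper subset to a point; so $S^0(X)=X$, $S^1(X)$ is the pushout of $\ast\leftarrow X\to\ast$, and $S^n(X)$ is the $n$-fold iterate of $S^1(-)$. In particular $S^n(\emptyset)$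 is the $(n-1)$-sphere. $\mathbb{L}_P^{\mathcal S}(\sigma)=|P|/|P-P_{\ge\sigma}|$ denotes the cofiber, i.e. the homotopy pushout of $\ast\leftarrow|P-P_{\ge\sigma}|\to|P|$. *)

(* Defs.v *)
From HB Require Import structures.
From Stdlib Require Import Relation_Operators.
From mathcomp Require Import all_boot all_order all_algebra.
From mathcomp Require Import finmap generic_quotient.
From mathcomp Require Import boolp classical_sets functions reals.
From mathcomp Require Import topology normedtype.

Set Implicit Arguments.
Unset Strict Implicit.
Unset Printing Implicit Defensive.

Import Order.TTheory GRing.Theory Num.Theory numFieldNormedType.Exports.
Local Open Scope classical_set_scope.
Local Open Scope ring_scope.
Local Open Scope quotient_scope.

(** * Homotopies *)

Section homotopy.
Variable R : realType.

Definition homotopic (X Y : topologicalType) (f g : X -> Y) : Prop :=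
  exists H : X * R -> Y,
    [/\ {within [set: X] `*` `[0, 1], continuous H},
        forall x, H (x, 0) = f x & forall x, H (x, 1) = g x].

Definition homotopy_equivalence (X Y : topologicalType) (f : X -> Y) : Prop :=
  continuous f /\
  exists g : Y -> X,
    [/\ continuous g, homotopic (g \o f) idfun & homotopic (f \o g) idfun].

Definition homotopy_equivalent (X Y : topologicalType) : Prop :=
  exists f : X -> Y, homotopy_equivalence f.

End homotopy.

(** * Geometric realization of (the nerve of) a subposet [Q] of [P]

A [k]-simplex of the nerve of [Q] is a monotone map [c : 'I_k.+1 -> P] with
values in [Q].  Sending a point [t] of the standard [k]-simplex to its
push-forward [x |-> \sum_(i | c i = x) t_i] identifies the points of the
realization [(\coprod_k N_k(Q) * Delta^k)/~] with the barycentric coordinates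
[P -> R] arising in this way, because two pairs [(c, t)] get identified exactly
when they have the same push-forward.  The topology is the colimit topology: a
set is open when its preimage under the characteristic map of every simplex of
the nerve is open.  *)

Section realization.
Variables (R : realType) (d : Order.disp_t) (P : porderType d).

Definition std_simplex (k : nat) : set 'rV[R]_k.+1 :=
  [set t | (forall i, 0 <= t 0 i) /\ \sum_i t 0 i = 1].
Arguments std_simplex : clear implicits.

Record nerve (Q : set P) (k : nat) := Nerve {
  nerve_fun :> 'I_k.+1 -> P;
  nerve_mono : {homo nerve_fun : i j / (i <= j)%N >-> (i <= j)%O};
  nerve_in : forall i, Q (nerve_fun i) }.

Definition pushforward (k : nat) (c : 'I_k.+1 -> P) (t : 'rV[R]_k.+1) : P -> R :=
  fun x => \sum_(i | c i == x) t 0 i.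

Record realization (Q : set P) := Realization {
  bary :> P -> R;
  baryP : exists k (c : nerve Q k) (t : std_simplex k),
    bary = pushforward c (\val t) }.

HB.instance Definition _ (Q : set P) := gen_eqMixin (realization Q).
HB.instance Definition _ (Q : set P) := gen_choiceMixin (realization Q).

Section topology.
Variable Q : set P.

Definition char_map (k : nat) (c : nerve Q k) (t : std_simplex k) :
    realization Q :=
  Realization (ex_intro _ k (ex_intro _ c (ex_intro _ t erefl))).

Definition realization_open (U : set (realization Q)) : Prop :=
  forall k (c : nerve Q k), open (char_map c @^-1` U).

Fact realization_openT : realization_open setT.
Proof. by move=> k c; rewrite preimage_setT; exact: openT. Qed.

Fact realization_openI : setI_closed realization_open.
Proof. by move=> U U' oU oU' k c; rewrite preimage_setI; exact: openI. Qed.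

Fact realization_open_bigU (I : Type) (U : I -> set (realization Q)) :
  (forall i, realization_open (U i)) -> realization_open (\bigcup_i U i).
Proof.
by move=> oU k c; rewrite preimage_bigcup; apply: bigcup_open => i _; exact: oU.
Qed.

HB.instance Definition _ := isOpenTopological.Build (realization Q)
  realization_openT realization_openI realization_open_bigU.

Lemma realization_openE : @open (realization Q) = realization_open.
Proof. by []. Qed.

End topology.

Lemma realization_eq (Q : set P) (p q : realization Q) :
  bary p = bary q -> p = q.
Proof.
case: p q => [f fP] [g gP] /= fg; rewrite -fg in gP *.
by congr Realization; exact: Prop_irrelevance.
Qed.

Definition nerve_incl (Q Q' : set P) (QQ' : Q `<=` Q') k (c : nerve Q k) :
    nerve Q' k :=
  Nerve (nerve_mono c) (fun i => QQ' _ (nerve_in c i)).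

Lemma realization_incl_subproof (Q Q' : set P) (QQ' : Q `<=` Q')
  (p : realization Q) : exists k (c : nerve Q' k) (t : std_simplex k),
    bary p = pushforward c (\val t).
Proof.
by case: (baryP p) => k [c [t pE]]; exists k, (nerve_incl QQ' c), t.
Qed.

Definition realization_incl (Q Q' : set P) (QQ' : Q `<=` Q')
    (p : realization Q) : realization Q' :=
  Realization (realization_incl_subproof QQ' p).

Lemma realization_incl_continuous (Q Q' : set P) (QQ' : Q `<=` Q') :
  continuous (realization_incl QQ').
Proof.
apply/continuousP => U; rewrite !realization_openE => oU k c.
have -> : char_map c @^-1` (realization_incl QQ' @^-1` U) =
          char_map (nerve_incl QQ' c) @^-1` U.
  apply/seteqP; split=> t /=;
  by rewrite (_ : realization_incl _ _ = char_map (nerve_incl QQ' c) t) //;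
    apply: realization_eq.
exact: oU.
Qed.

End realization.

Arguments std_simplex R k : clear implicits.
Arguments realization R {d P} Q.
Arguments realization_incl R {d P Q Q'} QQ' p.
Arguments realization_incl_continuous R {d P Q Q'} QQ'.

Section upsets.
Variables (d : Order.disp_t) (P : porderType d).

Definition upset (x : P) : set P := [set y | (x <= y)%O].
Definition strict_upset (x : P) : set P := [set y | (x < y)%O].

Lemma upset_sub (x y : P) : (x <= y)%O -> upset y `<=` upset x.
Proof. by move=> xy z; exact: le_trans. Qed.

Definition down_closed (Q : set P) : Prop :=
  forall x y, Q x -> (y <= x)%O -> Q y.

Definition down_closure (Q : set P) : set P := smallest down_closed Q.

End upsets.

(** * Homotopy colimits of diagrams of spaces over a finite poset *)

Record diagram (d : Order.disp_t) (J : finPOrderType d) := Diagram {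
  diag_space :> J -> topologicalType;
  diag_map : forall i j : J, (i <= j)%O -> diag_space i -> diag_space j;
  diag_continuous : forall i j (ij : (i <= j)%O), continuous (diag_map ij);
  diag_id : forall i (ii : (i <= i)%O), diag_map ii =1 id;
  diag_comp : forall i j k (ij : (i <= j)%O) (jk : (j <= k)%O) (ik : (i <= k)%O),
    diag_map ik =1 diag_map jk \o diag_map ij }.

(** The Bousfield-Kan model: the coend of [F j * |J_{>= j}|] over [j].  As [J]
    is finite, the [|J_{>= j}|] are compact Hausdorff, so that the plain product
    topology is the right one. *)

Section hocolim.
Variables (R : realType) (d : Order.disp_t) (J : finPOrderType d).

Definition hocolim_pre (F : diagram J) : Type :=
  {j : J & (F j * realization R (upset j))%type}.

HB.instance Definition _ (F : diagram J) := Topological.on (hocolim_pre F).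

Section quotient.
Variable F : diagram J.

Inductive hocolim_glue : hocolim_pre F -> hocolim_pre F -> Prop :=
| HocolimGlue (i j : J) (ij : (i <= j)%O) (x : F i)
    (t : realization R (upset j)) :
    hocolim_glue (existT _ i (x, realization_incl R (upset_sub ij) t))
                 (existT _ j (diag_map ij x, t)).

Definition hocolim_rel (p q : hocolim_pre F) : bool :=
  `[< clos_refl_sym_trans _ hocolim_glue p q >].

Fact hocolim_rel_refl : reflexive hocolim_rel.
Proof. by move=> p; apply/asboolP; exact: rst_refl. Qed.

Fact hocolim_rel_sym : symmetric hocolim_rel.
Proof. by move=> p q; apply: asbool_equiv_eq; split; exact: rst_sym. Qed.

Fact hocolim_rel_trans : transitive hocolim_rel.
Proof.
by move=> q p r /asboolP pq /asboolP qr; apply/asboolP; exact: rst_trans pq qr.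
Qed.

Definition hocolim_equiv :=
  EquivRel hocolim_rel hocolim_rel_refl hocolim_rel_sym hocolim_rel_trans.

Definition hocolim : topologicalType :=
  quotient_topology {eq_quot hocolim_equiv}.

Definition hocolim_pi (p : hocolim_pre F) : hocolim :=
  \pi_(quotient_topology {eq_quot hocolim_equiv}) p.

Definition hocolim_repr (p : hocolim) : hocolim_pre F :=
  repr (p : quotient_topology {eq_quot hocolim_equiv}).

Lemma hocolim_reprK (p : hocolim) : hocolim_pi (hocolim_repr p) = p.
Proof. exact: reprK. Qed.

Lemma hocolim_piP (p q : hocolim_pre F) :
  hocolim_pi p = hocolim_pi q <-> clos_refl_sym_trans _ hocolim_glue p q.
Proof.
split=> pq; first exact/asboolP/(introT (@eqmodP _ hocolim_equiv p q)).
by apply: (elimT (@eqmodP _ hocolim_equiv p q)); apply/asboolP.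
Qed.

End quotient.

(** The map induced by a natural transformation [a].  It is defined through
    representatives; [hocolim_mapE] shows that these do not matter. *)

Section map.
Variables (F G : diagram J) (a : forall j, F j -> G j).

Definition hocolim_pre_map (p : hocolim_pre F) : hocolim_pre G :=
  existT _ (projT1 p) (a (projT2 p).1, (projT2 p).2).

Definition hocolim_map (p : hocolim F) : hocolim G :=
  hocolim_pi (hocolim_pre_map (hocolim_repr p)).

Lemma hocolim_mapE :
  (forall i j (ij : (i <= j)%O) (x : F i),
     a (diag_map ij x) = diag_map ij (a x)) ->
  forall p, hocolim_map (hocolim_pi p) = hocolim_pi (hocolim_pre_map p).
Proof.
move=> a_nat p; apply/hocolim_piP.
have: clos_refl_sym_trans _ (@hocolim_glue F) (hocolim_repr (hocolim_pi p)) p.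
  by apply/hocolim_piP; rewrite hocolim_reprK.
move: (hocolim_repr _) => q.
elim=> {p q} [_ _ [i j ij x t]|p|p q _|p q r _ pq _ qr].
- by apply: rst_step; rewrite /hocolim_pre_map /= a_nat; exact: HocolimGlue.
- exact: rst_refl.
- exact: rst_sym.
- exact: rst_trans pq qr.
Qed.

End map.

End hocolim.

Definition point_space : topologicalType := discrete_topology unit.

Definition to_point (X : Type) : X -> point_space := fun=> tt.

Lemma to_point_continuous (X : topologicalType) : continuous (@to_point X).
Proof. exact: cst_continuous. Qed.

(** * The unreduced suspension [S^n]

The homotopy colimit, over the proper subsets of [{0, ..., n}], of the diagram
with value [X] at the empty set and a point elsewhere.  The values of the
diagram and its maps depend only on which sets are empty, whence the use of
booleans. *)

Definition properset (n : nat) : Type :=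
  {A : {set 'I_n.+1} | A \proper [set: 'I_n.+1]%SET}.

Section properset.
Variable n : nat.

HB.instance Definition _ := Finite.on (properset n).

Definition properset_le (A B : properset n) : bool := \val A \subset \val B.

Fact properset_le_refl : reflexive properset_le.
Proof. by move=> A; exact: fintype.subxx. Qed.

Fact properset_le_anti : antisymmetric properset_le.
Proof. by move=> A B AB; apply/val_inj/eqP; rewrite finset.eqEsubset. Qed.

Fact properset_le_trans : transitive properset_le.
Proof. by move=> B A C; exact: fintype.subset_trans. Qed.

Fact properset_display : Order.disp_t. Proof. exact: Order.Disp tt tt. Qed.

HB.instance Definition _ := Order.Le_isPOrder.Build properset_display
  (properset n) properset_le_refl properset_le_anti properset_le_trans.

Definition is_empty (A : properset n) : bool := \val A == finset.set0.

Lemma is_empty_le (A B : properset n) :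
  (A <= B)%O -> is_empty B ==> is_empty A.
Proof.
move=> AB; apply/implyP => /eqP B0; rewrite /is_empty -finset.subset0 -B0.
exact: AB.
Qed.

End properset.

Section suspension.
Variable X : topologicalType.

Definition susp_cell (b : bool) : topologicalType :=
  if b then X else point_space.

Definition susp_cell_map (b b' : bool) :
    b' ==> b -> susp_cell b -> susp_cell b' :=
  match b, b' with
  | true, true => fun _ x => x
  | false, true => fun h _ => False_rect _ (notF h)
  | _, false => fun _ _ => tt
  end.

Lemma susp_cell_map_continuous b b' (h : b' ==> b) :
  continuous (susp_cell_map h).
Proof.
case: b b' h => [] [] h; try exact: cst_continuous.
by move=> x; exact: cvg_id.
Qed.

Lemma susp_cell_map_id b (h : b ==> b) : susp_cell_map h =1 id.
Proof. by case: b h => h // -[]. Qed.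

Lemma susp_cell_map_comp a b c (ab : b ==> a) (bc : c ==> b) (ac : c ==> a) :
  susp_cell_map ac =1 susp_cell_map bc \o susp_cell_map ab.
Proof. by case: a b c ab bc ac => [] [] [] ab bc ac x //=; case: (notF _). Qed.

Definition susp_diagram (n : nat) : diagram (properset n) :=
  @Diagram _ (properset n) (fun A => susp_cell (is_empty A))
    (fun A B AB => susp_cell_map (is_empty_le AB))
    (fun A B AB => @susp_cell_map_continuous _ _ (is_empty_le AB))
    (fun A AA => @susp_cell_map_id _ (is_empty_le AA))
    (fun A B C AB BC AC =>
       @susp_cell_map_comp _ _ _ (is_empty_le AB) (is_empty_le BC)
         (is_empty_le AC)).

End suspension.

Definition susp (R : realType) (n : nat) (X : topologicalType) :
    topologicalType :=
  hocolim R (susp_diagram X n).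

Definition susp_cell_fun (X Y : topologicalType) (f : X -> Y) (b : bool) :
    susp_cell X b -> susp_cell Y b :=
  if b as b0 return (susp_cell X b0 -> susp_cell Y b0) then f else id.

Definition susp_map (R : realType) (n : nat) (X Y : topologicalType)
    (f : X -> Y) : susp R n X -> susp R n Y :=
  hocolim_map (F := susp_diagram X n) (G := susp_diagram Y n)
    (fun A => @susp_cell_fun X Y f (is_empty A)).

Lemma susp_cell_fun_natural (n : nat) (X Y : topologicalType) (f : X -> Y)
    (A B : properset n) (AB : (A <= B)%O) (x : susp_diagram X n A) :
  susp_cell_fun f (@diag_map _ _ (susp_diagram X n) A B AB x) =
  @diag_map _ _ (susp_diagram Y n) A B AB (susp_cell_fun f x).
Proof.
rewrite /=; move: (is_empty_le AB) x => /=.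
by case: (is_empty A) => [] /=; case: (is_empty B) => //= h; case: (notF h).
Qed.

(** * Homotopy pushouts and cofibers

The index poset of [B <- A -> C]: [None] (for [A]) lies below [Some true]
(for [B]) and [Some false] (for [C]). *)

Definition span_shape : Type := option bool.

HB.instance Definition _ := Finite.on span_shape.

Definition span_le (x y : span_shape) : bool := (x == None) || (x == y).

Lemma span_le_refl : reflexive span_le.
Proof. by move=> x; rewrite /span_le eqxx orbT. Qed.

Lemma span_le_anti : antisymmetric span_le.
Proof. by case=> [[]|] [[]|]. Qed.

Lemma span_le_trans : transitive span_le.
Proof. by case=> [[]|] [[]|] [[]|]. Qed.

Fact span_display : Order.disp_t. Proof. exact: Order.Disp tt tt. Qed.

HB.instance Definition _ := Order.Le_isPOrder.Build span_display
  span_shape span_le_refl span_le_anti span_le_trans.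

Section pushout.
Variables (A B C : topologicalType) (f : A -> B) (g : A -> C).
Hypotheses (cf : continuous f) (cg : continuous g).

Definition span_space (x : span_shape) : topologicalType :=
  match x with None => A | Some true => B | Some false => C end.

Definition span_map (x y : span_shape) :
    span_le x y -> span_space x -> span_space y :=
  match x, y with
  | None, None => fun _ a => a
  | None, Some true => fun _ => f
  | None, Some false => fun _ => g
  | Some true, Some true => fun _ b => b
  | Some false, Some false => fun _ c => c
  | _, _ => fun h _ => False_rect _ (notF h)
  end.

Lemma span_map_continuous x y (h : span_le x y) : continuous (span_map h).
Proof.
by case: x y h => [[]|] [[]|] h //; try (by case: (notF h));
  move=> z; exact: cvg_id.
Qed.

Lemma span_map_id x (h : span_le x x) : span_map h =1 id.
Proof. by case: x h => [[]|]. Qed.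

Lemma span_map_comp x y z (xy : span_le x y) (yz : span_le y z)
    (xz : span_le x z) :
  span_map xz =1 span_map yz \o span_map xy.
Proof.
case: x y z xy yz xz => [[]|] [[]|] [[]|] xy yz xz a //=;
by [case: (notF xy)|case: (notF yz)|case: (notF xz)].
Qed.

Definition span_diagram : diagram span_shape :=
  @Diagram _ span_shape span_space span_map span_map_continuous span_map_id
    span_map_comp.

End pushout.

Definition homotopy_pushout (R : realType) (A B C : topologicalType)
    (f : A -> B) (g : A -> C) (cf : continuous f) (cg : continuous g) :
    topologicalType :=
  hocolim R (span_diagram cf cg).

Definition cofiber (R : realType) (A X : topologicalType) (f : A -> X)
    (cf : continuous f) : topologicalType :=
  homotopy_pushout R (@to_point_continuous A) cf.

(** * The poset of simplices of an abstract simplicial complex *)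

Record simplicial_complex (V : choiceType) := SimplicialComplex {
  faces :> set {fset V};
  faces_nonempty : forall s, faces s -> s != fset0;
  faces_down : forall s t,
    faces s -> (t `<=` s)%fset -> t != fset0 -> faces t }.

Record simplex (V : choiceType) (K : simplicial_complex V) := Simplex {
  vertices :> {fset V};
  verticesP : vertices \in (faces K) }.

Section simplices.
Variables (V : choiceType) (K : simplicial_complex V).

HB.instance Definition _ := [isSub for @vertices V K].
HB.instance Definition _ := [Choice of simplex K by <:].

Definition face_of (s t : simplex K) : bool :=
  (vertices s `<=` vertices t)%fset.

Fact face_of_refl : reflexive face_of.
Proof. by move=> s; exact: fsubset_refl. Qed.

Fact face_of_anti : antisymmetric face_of.
Proof. by move=> s t st; apply/val_inj/eqP; rewrite eqEfsubset. Qed.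

Fact face_of_trans : transitive face_of.
Proof. by move=> t s u; exact: fsubset_trans. Qed.

Fact simplex_display : Order.disp_t. Proof. exact: Order.Disp tt tt. Qed.

HB.instance Definition _ := Order.Le_isPOrder.Build simplex_display
  (simplex K) face_of_refl face_of_anti face_of_trans.

Definition simplex_dim (s : simplex K) : nat := #|` vertices s|.-1.

Definition link (s : simplex K) : set (simplex K) :=
  down_closure (upset s) `\` upset s.

Definition small_link (s : simplex K) : set (simplex K) := strict_upset s.

(** The cofiber of [|P - P_{>= s}| -> |P|], [P] being the poset of all
    simplices. *)
Definition stratified_link (R : realType) (s : simplex K) : topologicalType :=
  cofiber R
    (realization_incl_continuous R (@subsetT _ ([set: simplex K] `\` upset s))).

End simplices.

(* Main.v *)
(** All the spaces involved turn out to be realizations of posets. Write [A +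
    B] for the ordinal sum, with [A] below [B], and [J_n] for the poset of
    nonempty proper subsets of [{0, ..., n}]. Then [S^n |Q|] is homeomorphic
    to [|Q + J_n|], and the cofiber of [|P - P_{>= sigma}| -> |P|] to [|P u
    {*}|], where [*] lies above [P - P_{>= sigma}] only.

    Posets are compared by two moves: comparable monotone maps are homotopic,
    and an element [x] can be removed from [X] when [X_{< x}] is conical, that
    is, when [y <= f y >= c] for a monotone [f] and a fixed [c]. Both come
    from one explicit homotopy: the weights of a point subdivide the unit
    interval along the chain supporting it, and cutting this interval splits
    the point into a lower part, which stays, and an upper part, which is
    moved.

    - Put [J_n] on top of the link, [A] in [J_n] lying above the simplices
      that meet [sigma] inside [A].  Sending a simplex that meets [sigma] to
      its trace on [sigma] retracts the result to [P_{> sigma} + J_n];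
      removing the elements of [J_n] from the bottom up leaves the link.
    - Add to [Q + J_{n+1}] an element above [Q] and above all the subsets
      but the facet [{0, ..., n}].  It can be removed, and the result
      retracts to [Q + J_n + J_1].
    - Add to [P u {*}] an element above the star of [sigma].  It can be
      removed, and the result retracts to the sum of the link and [J_1]. *)

Require Import Defs.
From HB Require Import structures.
From Stdlib Require Import Relation_Operators.
From mathcomp Require Import all_boot all_order all_algebra.
From mathcomp Require Import finmap.
From mathcomp Require Import boolp classical_sets functions fsbigop.
From mathcomp Require Import reals topology normedtype.
From mathcomp Require Import ring lra.

Set Implicit Arguments.
Unset Strict Implicit.
Unset Printing Implicit Defensive.

Import Order.TTheory GRing.Theory Num.Theory numFieldNormedType.Exports.
Local Open Scope classical_set_scope.
Local Open Scope ring_scope.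

(** The complex may be infinite, so its realization is in general neither metrizable nor locally
    compact, and a map into it need not be continuous just because its coordinates are. Coordinates
    are therefore used over one closed simplex at a time: there the image stays in a subcomplex
    spanned by finitely many elements, which is compact Hausdorff and so carries the topology of its
    coordinates. Crossing with the line keeps this reduction, the line being locally compact. The
    homotopies are accordingly written in terms of masses of sets of elements, whose continuity is
    immediate. In the removal of a conical element [x], contracting all that lies below [x] would
    move points that have to stay fixed. What is pushed is therefore bounded by the weight of [x]:
    points without weight at [x] do not move, and the weight of [x] can afterwards be put on the
    image of the pushed part. *)

(** * Continuity of pointwise operations *)

Lemma continuous_pair (X Y Z : topologicalType) (f : X -> Y) (g : X -> Z) :
  continuous f -> continuous g -> continuous (fun x => (f x, g x)).
Proof. by move=> cf cg x; apply: cvg_pair; [exact: cf|exact: cg]. Qed.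

Lemma continuous_fst (X Y : topologicalType) : continuous (@fst X Y).
Proof. by move=> x; exact: cvg_fst. Qed.

Lemma continuous_snd (X Y : topologicalType) : continuous (@snd X Y).
Proof. by move=> x; exact: cvg_snd. Qed.

Lemma continuous_compT (X Y Z : topologicalType) (f : X -> Y) (g : Y -> Z) :
  continuous f -> continuous g -> continuous (g \o f).
Proof. by move=> cf cg x; apply: continuous_comp; [exact: cf|exact: cg]. Qed.

Lemma continuousDT (X : topologicalType) (R : realType) (f g : X -> R) :
  continuous f -> continuous g -> continuous (fun x => f x + g x).
Proof. by move=> cf cg x; apply: cvgD; [exact: cf|exact: cg]. Qed.

Lemma continuousBT (X : topologicalType) (R : realType) (f g : X -> R) :
  continuous f -> continuous g -> continuous (fun x => f x - g x).
Proof. by move=> cf cg x; apply: cvgB; [exact: cf|exact: cg]. Qed.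

Lemma continuousMT (X : topologicalType) (R : realType) (f g : X -> R) :
  continuous f -> continuous g -> continuous (fun x => f x * g x).
Proof. by move=> cf cg x; apply: cvgM; [exact: cf|exact: cg]. Qed.

Lemma continuous_cst (X Y : topologicalType) (y : Y) :
  continuous (fun _ : X => y).
Proof. exact: cst_continuous. Qed.

Lemma continuous_minT (X : topologicalType) (R : realType) (f g : X -> R) :
  continuous f -> continuous g -> continuous (fun x => Num.min (f x) (g x)).
Proof.
move=> cf cg x; apply: (@continuous_min R X f g x); [exact: cf|exact: cg].
Qed.

Lemma continuous_maxT (X : topologicalType) (R : realType) (f g : X -> R) :
  continuous f -> continuous g -> continuous (fun x => Num.max (f x) (g x)).
Proof.
move=> cf cg x; apply: (@continuous_max R X f g x); [exact: cf|exact: cg].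
Qed.

Lemma continuous_sum (X : topologicalType) (R : realType) (I : Type)
    (r : seq I) (P : pred I) (f : I -> X -> R) :
  (forall i, P i -> continuous (f i)) ->
  continuous (fun x => \sum_(i <- r | P i) f i x).
Proof.
move=> cf; apply: continuous_big => // p.
by apply: cvgD; [exact: cvg_fst|exact: cvg_snd].
Qed.

(** * Final topologies and homotopies *)

Section final.
Variables (I : Type) (X : I -> topologicalType) (Y : topologicalType).
Variable q : forall i, X i -> Y.

Definition final_family : Prop :=
  (forall y, exists i (x : X i), q x = y) /\
  (forall U : set Y, (forall i, open (@q i @^-1` U)) -> open U).

Lemma final_continuous (Z : topologicalType) (G : Y -> Z) :
  final_family -> (forall i, continuous (G \o @q i)) -> continuous G.
Proof.
move=> [_ qo] cG; apply/continuousP => U oU; apply: qo => i.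
by rewrite -comp_preimage; move/continuousP: (cG i); exact.
Qed.

(** Local compactness in the form that the tube lemma uses: the compact neighbourhood has to fit
    inside a prescribed one. *)
Definition compact_basis (T : topologicalType) : Prop :=
  forall (t : T) N, nbhs t N -> exists2 J, nbhs t J & compact J /\ J `<=` N.

(** Whitehead's lemma; the tube lemma makes the set [U] below open. *)
Lemma final_prod_continuous (T Z : topologicalType) (G : Y * T -> Z) :
  final_family -> compact_basis T ->
  (forall i, continuous (fun p : X i * T => G (q p.1, p.2))) -> continuous G.
Proof.
move=> [qs qo] cT cG [y0 t0] O; rewrite nbhsE => -[O' [oO' O'G] sub].
have [i [x0 qx0]] := qs y0; rewrite -qx0 in O'G *.
have : nbhs (x0, t0) ((fun p : X i * T => G (q p.1, p.2)) @^-1` O').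
  by apply: (cG i (x0, t0)); exact: open_nbhs_nbhs.
case=> -[A N] [/= nA nN] AN.
have [J nJ [cJ JN]] := cT _ _ nN.
pose U := [set y | forall t, J t -> O' (G (y, t))].
have oU : open U.
  apply: qo => j; rewrite openE => x1 /= Ux1.
  have /compact_near_coveringP cJ' := cJ.
  apply: (cJ' _ (nbhs x1) (fun x t => O' (G (q x, t)))) => t Jt.
  have : nbhs (x1, t) ((fun p : X j * T => G (q p.1, p.2)) @^-1` O').
    apply: (cG j (x1, t)); apply: open_nbhs_nbhs; split=> //; exact: Ux1.
  case=> -[B M] [/= nB nM] BM; exists (M, B) => // -[t' x'] [/= Mt Bx].
  exact: (BM (x', t')).
exists (U, J).
  split=> //=; apply: open_nbhs_nbhs; split=> // t Jt.
  by apply: (AN (x0, t)); split; [exact: nbhs_singleton|exact: JN].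
by move=> [y t] [/= Uy Jt]; apply: sub; exact: Uy.
Qed.

End final.

Lemma compact_basis_real (R : realType) : compact_basis R.
Proof.
move=> t N /nbhs_ballP [e /= e0 eN]; exists `[t - e / 2, t + e / 2]%classic.
  apply/nbhs_ballP; exists (e / 2) => /=; first by rewrite divr_gt0.
  by move=> x; rewrite /ball /= ltr_norml in_itv /= => /andP[? ?];
    apply/andP; split; lra.
split; first exact: segment_compact.
move=> x; rewrite /= in_itv /= => /andP[? ?]; apply: eN.
by rewrite /ball /= ltr_norml; apply/andP; split; lra.
Qed.

Lemma compact_basis_hausdorff (T : topologicalType) :
  hausdorff_space T -> compact [set: T] -> compact_basis T.
Proof.
move=> hT cT t N nN.
have [//|B nB BN] := @compact_regular T t setT hT cT _ N nN.
  exact: filterT.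
exists (closure B); first by apply: filterS nB; exact: subset_closure.
split=> //; apply: (subclosed_compact _ cT) => //; exact: closed_closure.
Qed.

(** * The calculus of homotopies and homotopy equivalences *)

Section homotopy_theory.
Variable R : realType.

Definition clamp (t : R) : R := Num.max 0 (Num.min 1 t).

Lemma clamp_ge0 t : 0 <= clamp t.
Proof. by rewrite /clamp le_max lexx. Qed.

Lemma clamp_le1 t : clamp t <= 1.
Proof. by rewrite /clamp ge_max ler01 ge_min lexx. Qed.

Lemma clamp0 : clamp 0 = 0.
Proof. by rewrite /clamp min_r ?ler01 // maxxx. Qed.

Lemma clamp1 : clamp 1 = 1.
Proof. by rewrite /clamp minxx max_r ?ler01. Qed.

Lemma clamp_continuous : continuous clamp.
Proof.
apply: continuous_maxT; first exact: continuous_cst.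
by apply: continuous_minT; [exact: continuous_cst|move=> x; exact: cvg_id].
Qed.

(** Precomposing with the retraction [clamp] of the line onto the unit interval extends a homotopy
    to all of [X * R], which frees its continuity from the subspace topology. *)
Lemma homotopicP (X Y : topologicalType) (f g : X -> Y) :
  homotopic R f g <-> exists H : X * R -> Y,
    [/\ continuous H, forall x, H (x, 0) = f x & forall x, H (x, 1) = g x].
Proof.
split=> -[H [cH H0 H1]]; last first.
  by exists H; split=> //; apply: continuous_subspaceT.
pose K (p : X * R) := (p.1, clamp p.2).
exists (H \o K); split=> [|x|x] /=; last first.
- by rewrite /K /= clamp1.
- by rewrite /K /= clamp0.
have cK : continuous K.
  apply: continuous_pair; first exact: continuous_fst.
  exact: continuous_compT (@continuous_snd _ _) clamp_continuous.
have KA p : ([set: X] `*` `[0, 1]) (K p).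
  by split=> //=; rewrite in_itv /= clamp_ge0 clamp_le1.
move=> p; move/subspace_continuousP: cH => /(_ _ (KA p)) cH.
apply: cvg_trans cH => U nU.
suff : nbhs p ((H \o K) @^-1` U) by [].
have := cK p _ nU; apply: (@filterS _ (nbhs p)) => r /= Ur.
by apply: Ur; exact: KA.
Qed.

Lemma homotopic_refl (X Y : topologicalType) (f : X -> Y) :
  continuous f -> homotopic R f f.
Proof.
move=> cf; apply/homotopicP; exists (f \o fst); split=> //.
exact: continuous_compT (@continuous_fst _ _) cf.
Qed.

Lemma homotopic_sym (X Y : topologicalType) (f g : X -> Y) :
  homotopic R f g -> homotopic R g f.
Proof.
move=> /homotopicP [H [cH H0 H1]]; apply/homotopicP.
exists (fun p => H (p.1, 1 - p.2)); split=> [|x|x] /=; rewrite ?subr0 ?subrr //.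
apply: (continuous_compT (g := H)) cH; apply: continuous_pair.
  exact: continuous_fst.
apply: continuousBT; first exact: continuous_cst.
exact: continuous_snd.
Qed.

Lemma homotopic_trans (X Y : topologicalType) (f g h : X -> Y) :
  homotopic R f g -> homotopic R g h -> homotopic R f h.
Proof.
move=> /homotopicP [H [cH H0 H1]] /homotopicP [K [cK K0 K1]].
apply/homotopicP.
pose L (p : X * R) := if p.2 <= 2^-1 then H (p.1, clamp (2 * p.2))
                 else K (p.1, clamp (2 * p.2 - 1)).
pose A := [set p : X * R | p.2 <= 2^-1].
pose B := [set p : X * R | 2^-1 <= p.2].
have cA : closed A.
  have -> : A = snd @^-1` [set x | x <= 2^-1] by [].
  by apply: closed_comp => [p _|]; [exact: continuous_snd|exact: closed_le].
have cB : closed B.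
  have -> : B = snd @^-1` [set x | 2^-1 <= x] by [].
  by apply: closed_comp => [p _|]; [exact: continuous_snd|exact: closed_ge].
have AB : A `|` B = setT.
  apply/seteqP; split=> // p _; rewrite /A /B /=.
  by case: (lerP p.2 2^-1) => [?|/ltW ?]; [left|right].
have cL : {within A `|` B, continuous L}.
  apply: withinU_continuous => //.
    pose HL (p : X * R) := H (p.1, clamp (2 * p.2)).
    suff : {within A, continuous HL}.
      by apply: subspace_eq_continuous => p /set_mem Ap;
        rewrite /from_subspace /L ifT.
    apply: continuous_subspaceT; apply: (continuous_compT (g := H)) cH.
    apply: continuous_pair; first exact: continuous_fst.
    apply: (continuous_compT (g := clamp)) clamp_continuous.
    by apply: continuousMT; [exact: continuous_cst|exact: continuous_snd].
  pose KL (p : X * R) := K (p.1, clamp (2 * p.2 - 1)).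
  suff : {within B, continuous KL}.
    apply: subspace_eq_continuous => p /set_mem Bp; rewrite /from_subspace /L.
    case: ifP => // Ap; have p2 : p.2 = 2^-1 by apply/eqP; rewrite eq_le Ap Bp.
    by rewrite /KL p2 mulfV ?pnatr_eq0 // subrr clamp0 clamp1 H1 K0.
  apply: continuous_subspaceT; apply: (continuous_compT (g := K)) cK.
  apply: continuous_pair; first exact: continuous_fst.
  apply: (continuous_compT (g := clamp)) clamp_continuous.
  apply: continuousBT; last exact: continuous_cst.
  by apply: continuousMT; [exact: continuous_cst|exact: continuous_snd].
exists L; split=> [|x|x].
- by move: cL; rewrite AB -continuous_subspace_setT.
- by rewrite /L /= invr_ge0 ler0n mulr0 clamp0 H0.
- rewrite /L /= ifF; first by rewrite mulr1 addrK clamp1 K1.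
  by apply/negbTE; rewrite -ltNge; lra.
Qed.

Lemma homotopic_compl (X Y Z : topologicalType) (f g : X -> Y) (h : Y -> Z) :
  continuous h -> homotopic R f g -> homotopic R (h \o f) (h \o g).
Proof.
move=> ch /homotopicP [H [cH H0 H1]]; apply/homotopicP.
exists (h \o H); split=> [|x|x] /=; rewrite ?H0 ?H1 //.
exact: continuous_compT cH ch.
Qed.

Lemma homotopic_compr (X Y Z : topologicalType) (f g : Y -> Z) (h : X -> Y) :
  continuous h -> homotopic R f g -> homotopic R (f \o h) (g \o h).
Proof.
move=> ch /homotopicP [H [cH H0 H1]]; apply/homotopicP.
exists (fun p => H (h p.1, p.2)); split=> [|x|x] /=; rewrite ?H0 ?H1 //.
apply: (continuous_compT (g := H)) cH; apply: continuous_pair.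
  exact: continuous_compT (@continuous_fst _ _) ch.
exact: continuous_snd.
Qed.

Lemma homotopy_equivalent_sym (X Y : topologicalType) :
  homotopy_equivalent R X Y -> homotopy_equivalent R Y X.
Proof.
by move=> [f [cf [g [cg gf fg]]]]; exists g; split=> //; exists f; split.
Qed.

Lemma homotopy_equivalent_trans (X Y Z : topologicalType) :
  homotopy_equivalent R X Y -> homotopy_equivalent R Y Z ->
  homotopy_equivalent R X Z.
Proof.
move=> [f [cf [g [cg gf fg]]]] [f' [cf' [g' [cg' gf' fg']]]].
exists (f' \o f); split; first exact: continuous_compT.
exists (g \o g'); split; first exact: continuous_compT.
- apply: homotopic_trans gf.
  have -> : (g \o g') \o (f' \o f) = g \o ((g' \o f') \o f) by [].
  have -> : g \o f = g \o (idfun \o f) by [].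
  by apply: homotopic_compl => //; exact: homotopic_compr.
- apply: homotopic_trans fg'.
  have -> : (f' \o f) \o (g \o g') = f' \o ((f \o g) \o g') by [].
  have -> : f' \o g' = f' \o (idfun \o g') by [].
  by apply: homotopic_compl => //; exact: homotopic_compr.
Qed.

Lemma homotopy_equivalent_homeo (X Y : topologicalType) (f : X -> Y)
    (g : Y -> X) :
  continuous f -> continuous g -> cancel f g -> cancel g f ->
  homotopy_equivalent R X Y.
Proof.
move=> cf cg fK gK; exists f; split=> //; exists g; split=> //.
- have -> : g \o f = idfun by apply/funext => x /=; rewrite fK.
  by apply: homotopic_refl => x; exact: cvg_id.
- have -> : f \o g = idfun by apply/funext => x /=; rewrite gK.
  by apply: homotopic_refl => x; exact: cvg_id.
Qed.

End homotopy_theory.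

(** * The topology of a realization *)

(** The standard simplex is proved compact as a set of row vectors, but the domain of a
    characteristic map is the corresponding subtype; this passes from one to the other. *)
Lemma compact_set_type (T : topologicalType) (A : set T) :
  compact A -> compact [set: A].
Proof.
move=> cA F FF _.
have [|x [Ax clx]] := cA (set_val @ F).
  by apply: (@filterS _ F _ setT) => [y _|]; [exact: set_valP|exact: filterT].
exists (exist _ x (mem_set Ax)); split=> // B N FB [U [[W oW WU] Ux] UN].
have [||y [[b Bb <-] Wb]] := clx (set_val @` B) W.
- by apply: (@filterS _ F _ B) FB => b Bb; exists b.
- by apply: open_nbhs_nbhs; split=> //; rewrite -WU in Ux.
by exists b; split=> //; apply: UN; rewrite -WU.
Qed.

(** * Masses of finitely supported functions *)

Section mass.
Variables (R : realType) (P : choiceType).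
Implicit Types (g : P -> R) (S : set P) (D : seq P).

(** A finitely supported sum over an arbitrary set, so that the weight lying below an element or in
    a fibre can be written without naming a support. *)
Definition mass g S : R := \sum_(x \in S) g x.

Lemma mass_seq g S D : uniq D -> (forall x, x \notin D -> g x = 0) ->
  mass g S = \sum_(x <- D | x \in S) g x.
Proof.
move=> uD gD; rewrite bigfs //; last by move=> x _; exact: gD.
by rewrite /mass set_mem_set.
Qed.

Lemma big_pick1 (D : seq P) (x : P) (A : pred P) (F : P -> R) : uniq D ->
  \sum_(y <- D | A y && (x == y)) F y = if (x \in D) && A x then F x else 0.
Proof.
move=> uD; case: ifP => [/andP[xD Ax]|xDA].
  rewrite big_mkcond (bigD1_seq x) //= Ax eqxx big1 ?addr0 // => y yx.
  by rewrite (eq_sym x) (negbTE yx) andbF.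
rewrite big_seq_cond big_pred0 // => y; apply/negP => /and3P[yD Ay /eqP xy].
by rewrite xy yD Ay in xDA.
Qed.

End mass.

Section realization_theory.
Variables (R : realType) (d : Order.disp_t) (P : porderType d).
Implicit Types (Q : set P).

Lemma pushforward_out k (c : 'I_k.+1 -> P) (t : 'rV[R]_k.+1) x :
  x \notin undup (codom c) -> pushforward c t x = 0.
Proof.
rewrite mem_undup => xc; rewrite /pushforward big_pred0 // => i.
by apply/negP => /eqP ci; rewrite -ci codom_f in xc.
Qed.

(** Exchanging the sums turns the mass of any set, on one closed simplex, into a partial sum of
    simplex coordinates; the continuity of [mass] on the realization follows from this formula. *)
Lemma mass_pushforward k (c : 'I_k.+1 -> P) (t : 'rV[R]_k.+1) S :
  mass (pushforward c t) S = \sum_(i | c i \in S) t 0 i.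
Proof.
rewrite (mass_seq _ (undup_uniq (codom c))); last first.
  by move=> x; exact: pushforward_out.
rewrite /pushforward (exchange_big_dep predT) //= [RHS]big_mkcond.
apply: eq_bigr => i _; rewrite big_pick1 ?undup_uniq //.
by rewrite mem_undup codom_f.
Qed.

Section support.
Variables (Q : set P) (p : realization R Q).

Lemma bary_ge0 x : 0 <= p x.
Proof.
have [k [c [t ->]]] := baryP p; apply: sumr_ge0 => i _.
by have [] := set_mem (valP t).
Qed.

(** A finite chain takes the place of the simplex of the nerve, which may be degenerate and is not
    determined by the point. *)
Lemma bary_support : exists D : seq P,
  [/\ uniq D, (forall x y, x \in D -> y \in D -> (x >=< y)%O),
      forall x, x \in D -> Q x & forall x, x \notin D -> p x = 0].
Proof.
have [k [c [t ->]]] := baryP p; exists (undup (codom c)); split.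
- exact: undup_uniq.
- move=> x y; rewrite !mem_undup => /codomP[i ->] /codomP[j ->].
  rewrite /Order.comparable; case: (leqP i j) => [ij|/ltnW ji].
    by rewrite (nerve_mono c ij).
  by rewrite (nerve_mono c ji) orbT.
- by move=> x; rewrite mem_undup => /codomP[i ->]; exact: nerve_in.
- by move=> x; exact: pushforward_out.
Qed.

Lemma bary_in x : p x != 0 -> Q x.
Proof.
have [D [_ _ DQ pD]] := bary_support => px; apply: DQ.
by apply: contraNT px => /pD ->.
Qed.

Lemma bary_chain x y : p x != 0 -> p y != 0 -> (x >=< y)%O.
Proof.
have [D [_ Dc _ pD]] := bary_support => px py.
by apply: Dc; [apply: contraNT px => /pD ->|apply: contraNT py => /pD ->].
Qed.

Lemma massT : mass p setT = 1.
Proof.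
have [k [c [t ->]]] := baryP p; rewrite mass_pushforward.
have [_ <-] := set_mem (valP t); apply: eq_bigl => i.
by rewrite in_setT.
Qed.

End support.

(** The dimension [N] is prescribed instead of being read off from the support, so that all points
    carried by one finite set come from simplices of a single dimension; the compactness of
    [supported D] rests on this. *)
Lemma nerve_of_chain Q N (g : P -> R) (D : seq P) : uniq D ->
  (size D <= N.+1)%N -> (forall x, 0 <= g x) ->
  (forall x, x \notin D -> g x = 0) -> \sum_(x <- D) g x = 1 ->
  (forall x, g x != 0 -> Q x) ->
  (forall x y, g x != 0 -> g y != 0 -> (x >=< y)%O) ->
  exists (c : nerve Q N) (t : std_simplex R N),
    (forall i, c i \in D) /\ g = pushforward c (\val t).
Proof.
move=> uD sD g0 gD g1 gQ gc.
pose s0 := [seq x <- D | g x != 0]; pose s := sort <=%O s0.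
have memsE x : (x \in s) = (g x != 0).
  rewrite mem_sort mem_filter; case: (eqVneq (g x) 0) => //= gx.
  by apply: contraNT gx => /gD ->.
have us : uniq s by rewrite sort_uniq filter_uniq.
have ss : sorted <=%O s.
  apply: (@sort_sorted_in _ (fun x => g x != 0)).
    by move=> x y; exact: gc.
  by apply/allP => x; rewrite mem_filter => /andP[].
have sN : (size s <= N.+1)%N.
  by apply: leq_trans sD; rewrite size_sort size_filter count_size.
have s1 : \sum_(x <- s) g x = 1.
  rewrite -g1 (perm_big s0) /=; last by rewrite perm_sort.
  rewrite big_filter big_mkcond /=; apply: eq_bigr => x _.
  by case: eqVneq.
have s_gt0 : (0 < size s)%N.
  rewrite lt0n; apply/eqP => /size0nil s_nil.
  by move: s1; rewrite s_nil big_nil => /esym/eqP; rewrite oner_eq0.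
have [x0 x0s] : exists x0, x0 \in s.
  by case: (s) s_gt0 => // x ? _; exists x; rewrite mem_head.
(* A short support is padded: beyond its end the chain repeats its top element, with weight 0. *)
pose m (i : nat) := minn i (size s).-1.
have ms i : (m i < size s)%N.
  by rewrite /m gtn_min ltn_predL s_gt0 orbT.
pose c (i : 'I_N.+1) := nth x0 s (m i).
have c_mono : {homo c : i j / (i <= j)%N >-> (i <= j)%O}.
  move=> i j ij; apply: (sorted_leq_nth le_trans le_refl x0 ss);
    rewrite ?inE ?ms //.
  by rewrite /m leq_min geq_minr andbT (leq_trans (geq_minl _ _)).
have cs i : c i \in s by exact: mem_nth.
have cQ i : Q (c i) by apply: gQ; rewrite -memsE.
pose t : 'rV[R]_N.+1 := \row_i (if (i < size s)%N then g (nth x0 s i) else 0).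
have sumt (A : pred P) : \sum_(i | A (c i)) t 0 i = \sum_(x <- s | A x) g x.
  rewrite (big_nth x0) big_mkord (big_ord_widen_cond _ (fun i => A (nth x0 s i))
    (fun i => g (nth x0 s i)) sN).
  rewrite [LHS]big_mkcond [RHS]big_mkcond; apply: eq_bigr => i _; rewrite mxE.
  case: ltnP => [iS|_]; last by rewrite andbF; case: ifP.
  have -> : c i = nth x0 s i.
    by rewrite /c /m (minn_idPl _) // -ltnS prednK.
  by rewrite andbT.
have tS : t \in std_simplex R N.
  apply/mem_set; split=> [i|]; first by rewrite mxE; case: ifP.
  by rewrite -[RHS]s1 -(sumt predT).
exists (Nerve c_mono cQ), (exist _ t tS); split=> /= [i|].
  by have := cs i; rewrite mem_sort mem_filter => /andP[].
apply/funext => x; rewrite /pushforward (sumt (fun y => y == x)).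
under eq_bigl do rewrite eq_sym.
rewrite (big_pick1 x predT) // andbT memsE.
by case: eqVneq.
Qed.

Lemma mk_realization Q (g : P -> R) (D : seq P) : uniq D ->
  (forall x, 0 <= g x) ->
  (forall x, x \notin D -> g x = 0) -> \sum_(x <- D) g x = 1 ->
  (forall x, g x != 0 -> Q x) ->
  (forall x y, g x != 0 -> g y != 0 -> (x >=< y)%O) ->
  exists p : realization R Q, bary p = g.
Proof.
move=> uD g0 gD g1 gQ gc.
have [c [t [_ gE]]] :=
  @nerve_of_chain Q (size D) g D uD (leqnSn _) g0 gD g1 gQ gc.
by exists (char_map c t).
Qed.

Section realization_topology.
Variable Q : set P.

Lemma char_map_final : final_family
  (fun kc : {k : nat & nerve Q k} => @char_map R d P Q (projT1 kc) (projT2 kc)).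
Proof.
split=> [p|U oU]; last by move=> k c; exact: (oU (existT _ k c)).
have [k [c [t pE]]] := baryP p; exists (existT _ k c), t.
exact/realization_eq/esym.
Qed.

Lemma char_map_continuous k (c : nerve Q k) :
  continuous (@char_map R d P Q k c).
Proof. by apply/continuousP => U; rewrite realization_openE; exact. Qed.

Lemma coord_simplex_continuous k (i : 'I_k.+1) :
  continuous (fun t : std_simplex R k => (\val t : 'rV[R]_k.+1) 0 i).
Proof.
apply: (continuous_compT (f := \val : std_simplex R k -> 'rV[R]_k.+1)
  (g := fun t => t 0 i)).
  exact: initial_continuous.
exact: coord_continuous.
Qed.

Lemma mass_continuous (S : set P) :
  continuous (fun p : realization R Q => mass p S).
Proof.
apply: (final_continuous char_map_final) => -[k c] /=.
rewrite (_ : _ \o _ = fun t : std_simplex R k => \sum_(i | c i \in S)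
  (\val t : 'rV[R]_k.+1) 0 i); last first.
  by apply/funext => t /=; rewrite mass_pushforward.
by apply: continuous_sum => i _; exact: coord_simplex_continuous.
Qed.

Lemma bary_continuous x : continuous (fun p : realization R Q => p x).
Proof.
rewrite (_ : (fun p => _) = fun p : realization R Q => mass p [set x]).
  exact: mass_continuous.
by apply/funext => p; rewrite /mass fsbig_set1.
Qed.

Lemma realization_hausdorff : hausdorff_space (realization R Q).
Proof.
move=> p q pq; apply: realization_eq; apply/funext => x.
apply: (@norm_hausdorff R R) => U V nU nV.
have [r [Ur Vr]] := pq _ _ (bary_continuous nU) (bary_continuous nV).
by exists (r x).
Qed.

Lemma std_simplex_compact k : compact (std_simplex R k).
Proof.
apply: (@subclosed_compact _ _
  [set v : 'rV[R]_k.+1 | forall i, v ord0 i \in `[0, 1]%R]).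
- have -> : std_simplex R k = (\bigcap_i [set t : 'rV[R]_k.+1 | 0 <= t 0 i]) `&`
      [set t : 'rV[R]_k.+1 | \sum_i t 0 i = 1].
    by apply/seteqP; split=> t [t0 t1]; split=> // i; [move=> _|]; exact: t0.
  apply: closedI.
    apply: closed_bigI => i _.
    apply: (@closed_comp _ _ (fun t : 'rV[R]_k.+1 => t 0 i) [set x | 0 <= x]).
      by move=> t _; exact: coord_continuous.
    exact: closed_ge.
  apply: (@closed_comp _ _ (fun t : 'rV[R]_k.+1 => \sum_i t 0 i) [set 1]).
    by move=> t _; apply: continuous_sum => i _; exact: coord_continuous.
  exact: closed_eq.
- have cI (i : 'I_k.+1) : compact (`[0, 1]%classic : set R).
    exact: segment_compact.
  exact: (rV_compact cI).
move=> t [t0 t1] i; rewrite in_itv /= t0 /= -t1.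
by rewrite (bigD1 i) //= lerDl sumr_ge0.
Qed.

(** The finite subcomplex spanned by [D], which need not be a chain. These sets play the role of the
    finite subcomplexes of a CW complex. *)
Definition supported (D : seq P) : set (realization R Q) :=
  [set p | forall x, x \notin D -> p x = 0].

Lemma supported_closed D : closed (supported D).
Proof.
have -> : supported D = \bigcap_(x in [set x | x \notin D])
    ((fun p : realization R Q => p x) @^-1` [set 0]).
  by apply/seteqP; split=> p pD x; exact: pD.
apply: closed_bigI => x _; apply: closed_comp => [p _|].
  exact: bary_continuous.
exact: closed_eq.
Qed.

(** The set is closed and covered by the images of finitely many simplices, one at most for each way
    of choosing [N.+1] vertices in [D]. *)
Lemma supported_compact D : compact (supported D).
Proof.
have [->|/set0P[p0 p0D]] := eqVneq (supported D) set0; first exact: compact0.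
have [x0 x0D] : exists x0, x0 \in D.
  apply: contrapT => noD; have := massT p0.
  rewrite (mass_seq _ (isT : uniq [::])) ?big_nil.
    by move/esym/eqP; rewrite oner_eq0.
  by move=> x _; apply: p0D; apply/negP => xD; apply: noD; exists x.
pose N := size D.
(* [A g] is the image of the simplex with vertices at the positions [g i] of [D], and is empty if
   these do not form a simplex of the nerve. The position [N] is past the end of [D] and stands for
   [x0]. *)
pose A (g : {ffun 'I_N.+1 -> 'I_N.+1}) : set (realization R Q) :=
  \bigcup_(c in [set c : nerve Q N | forall i, c i = nth x0 D (g i)])
    (char_map c @` setT).
pose B : set (realization R Q) := \big[setU/set0]_g A g.
apply: (subclosed_compact (@supported_closed D) (_ : compact B)).
- apply: bigsetU_compact => g _.
  have [->|/set0P[_ [c cg _]]] := eqVneq (A g) set0; first exact: compact0.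
  have -> : A g = char_map c @` setT.
    apply/seteqP; split=> [p [c' c'g [t _ <-]]|p [t _ <-]]; last first.
      by exists c => //; exists t.
    exists t => //; apply: realization_eq => /=; congr pushforward.
    by apply/funext => i; rewrite cg c'g.
  apply: continuous_compact.
    exact/continuous_subspaceT/char_map_continuous.
  exact/compact_set_type/std_simplex_compact.
- move=> p pD; 
  have [c [t [cD pE]]] : exists (c : nerve Q N) (t : std_simplex R N),
      (forall i, c i \in undup D) /\ bary p = pushforward c (\val t).
    apply: nerve_of_chain.
    + exact: undup_uniq.
    + by apply: leq_trans (size_undup _) _; exact: leqnSn.
    + exact: bary_ge0.
    + by move=> x; rewrite mem_undup; exact: pD.
    + rewrite -(massT p) (mass_seq _ (undup_uniq D)).
        by apply: eq_bigl => x; rewrite in_setT.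
      by move=> x; rewrite mem_undup; exact: pD.
    + by move=> x; exact: bary_in.
    + by move=> x y; exact: bary_chain.
  pose g := [ffun i => inord (index (c i) D) : 'I_N.+1].
  rewrite /B (bigD1 g) //=; left; exists c => [i|]; last first.
    by exists t => //; exact/realization_eq/esym.
  have := cD i; rewrite mem_undup => ciD.
  by rewrite ffunE inordK ?nth_index // ltnS index_size.
Qed.

(** Since [supported D] is compact, the coordinates separate [G z0] uniformly
    from the points of [C] in it. *)
Lemma continuous_realization (Z : topologicalType) (G : Z -> realization R Q)
    (D : seq P) : (forall z, supported D (G z)) ->
  (forall x, continuous (fun z => G z x)) -> continuous G.
Proof.
move=> GD cG; apply/continuous_closedP => C cC.
rewrite -[_ @^-1` _]setCK; apply: open_closedC; rewrite openE => z0 /= Cz0.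
have cK : compact (C `&` supported D).
  apply: (subclosed_compact _ (@supported_compact D)).
    by apply: closedI => //; exact: supported_closed.
  by move=> p [].
have /compact_near_coveringP ncK := cK.
suff : \forall z \near z0, C `&` supported D `<=` [set p | p != G z].
  rewrite /interior; apply: filterS => z Kz /= Cz.
  by have /eqP := Kz _ (conj Cz (GD z)).
apply: ncK => p [Cp pD].
have [x px] : exists x, p x != G z0 x.
  apply/not_existsP => pG; apply: Cz0; rewrite /= (_ : G z0 = p) //.
  by apply: realization_eq; apply/funext => x; apply/esym/eqP/negPn/negP/pG.
pose h (qz : realization R Q * Z) := qz.1 x - G qz.2 x.
have ch : continuous h.
  apply: continuousBT.
    apply: (continuous_compT (@continuous_fst _ _)
      (g := fun q : realization R Q => q x)).
    exact: bary_continuous.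
  by apply: (continuous_compT (@continuous_snd _ _) (g := fun z => G z x)).
have : nbhs (p, z0) (h @^-1` [set r | r != 0]).
  apply: ch; apply: open_nbhs_nbhs; split; first exact: open_neq.
  by rewrite /h /= subr_eq0.
apply: filterS => -[q z] /=; apply: contraNneq => ->.
by rewrite /h /= subrr.
Qed.

End realization_topology.

Lemma continuous_on_realization Q (T Z : topologicalType)
    (G : realization R Q * T -> Z) : compact_basis T ->
  (forall k (c : nerve Q k),
     continuous (fun p : std_simplex R k * T => G (char_map c p.1, p.2))) ->
  continuous G.
Proof.
move=> cT cG; apply: (final_prod_continuous (@char_map_final Q) cT) => -[k c].
exact: cG.
Qed.

End realization_theory.

(** * Splitting the weights of a point *)

Section mass_theory.
Variables (R : realType) (P : choiceType).
Implicit Types (f g : P -> R) (S : set P) (D : seq P).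

Definition finsupp f : Prop :=
  exists2 D, uniq D & forall x, x \notin D -> f x = 0.

Lemma finsupp_dom f g : finsupp f -> (forall x, f x = 0 -> g x = 0) ->
  finsupp g.
Proof. by move=> [D uD fD] fg; exists D => // x /fD /fg. Qed.

Lemma finsupp2 f g : finsupp f -> finsupp g -> exists D,
  [/\ uniq D, forall x, x \notin D -> f x = 0
    & forall x, x \notin D -> g x = 0].
Proof.
move=> [D _ fD] [E _ gE]; exists (undup (D ++ E)); rewrite undup_uniq.
by split=> // x; rewrite mem_undup mem_cat negb_or => /andP[]; auto.
Qed.

Lemma massD f g S : finsupp f -> finsupp g ->
  mass (fun x => f x + g x) S = mass f S + mass g S.
Proof.
move=> ff fg; have [D [uD fD gD]] := finsupp2 ff fg.
rewrite !(mass_seq _ uD) ?big_split // => x xD.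
by rewrite fD ?gD ?addr0.
Qed.

Lemma massB f g S : finsupp f -> finsupp g ->
  mass (fun x => f x - g x) S = mass f S - mass g S.
Proof.
move=> ff fg; have [D [uD fD gD]] := finsupp2 ff fg.
rewrite !(mass_seq _ uD) ?sumrB // => x xD.
by rewrite fD ?gD ?subr0.
Qed.

Lemma massZ a f S : finsupp f -> mass (fun x => a * f x) S = a * mass f S.
Proof.
move=> [D uD fD]; rewrite !(mass_seq _ uD) ?mulr_sumr // => x xD.
by rewrite fD ?mulr0.
Qed.

Lemma mass_le f S S' : finsupp f -> (forall x, 0 <= f x) -> S `<=` S' ->
  mass f S <= mass f S'.
Proof.
move=> [D uD fD] f0 SS'; rewrite !(mass_seq _ uD) //.
rewrite big_mkcond [leRHS]big_mkcond; apply: ler_sum => x _.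
case: ifPn => [/set_mem/SS'/mem_set -> //|_]; by case: ifP.
Qed.

Lemma mass_ge0 f S : (forall x, 0 <= f x) -> 0 <= mass f S.
Proof. by move=> f0; apply: fsumr_ge0 => x _. Qed.

Lemma mass_set1 f x : mass f [set x] = f x.
Proof. exact: fsbig_set1. Qed.

Lemma massU f S S' : finsupp f -> S `&` S' = set0 ->
  mass f (S `|` S') = mass f S + mass f S'.
Proof.
move=> [D uD fD] SS'; rewrite !(mass_seq _ uD) //.
rewrite big_mkcond [X in _ = X + _]big_mkcond [X in _ = _ + X]big_mkcond.
rewrite -big_split; apply: eq_bigr => x _ /=; rewrite in_setU.
case: (boolP (x \in S)) => xS /=; last by rewrite add0r.
case: ifPn => [xS'|_]; last by rewrite addr0.
by have : (S `&` S') x by [split; apply: set_mem]; rewrite SS'.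
Qed.

Lemma eq_mass f g S : (forall x, S x -> f x = g x) -> mass f S = mass g S.
Proof. by move=> fg; apply: eq_fsbigr => x /set_mem; exact: fg. Qed.

Lemma mass_eq_set f S S' : (forall x, f x != 0 -> S x <-> S' x) -> finsupp f ->
  mass f S = mass f S'.
Proof.
move=> SS' [D uD fD]; rewrite !(mass_seq _ uD) //.
rewrite big_mkcond [RHS]big_mkcond; apply: eq_bigr => x _ /=.
case: (eqVneq (f x) 0) => [->|/SS' xS]; first by rewrite !if_same.
rewrite (_ : (x \in S) = (x \in S')) //.
by apply/idP/idP => /set_mem/xS/mem_set.
Qed.

Lemma mass_patch f S S' : 
  mass (fun x => if x \in S then f x else 0) S' = mass f (S `&` S').
Proof. by rewrite /mass fsbig_mkcondl. Qed.

Lemma mass_neq0 f S : mass f S != 0 -> exists2 x, S x & f x != 0.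
Proof.
by move=> fS; apply: contrapT => nS; move/eqP: fS; apply; apply: fsbig1 => x Sx;
  apply: contrapT => /eqP fx; apply: nS; exists x.
Qed.

End mass_theory.

Lemma in_fibre (P : Type) (P' : eqType) (f : P -> P') x y :
  (x \in [set x | f x = y]) = (f x == y).
Proof. by apply/idP/eqP => [/set_mem //|xy]; exact/mem_set. Qed.

(** * Moving two parts of the weights along two maps *)

Section blend.
Variables (R : realType) (d d' : Order.disp_t).
Variables (P : porderType d) (P' : porderType d').
Variables (Q : set P) (Q' : set P') (phi psi : P -> P').

Definition blend (w0 w1 : P -> R) (y : P') : R :=
  mass w0 [set x | phi x = y] + mass w1 [set x | psi x = y].

(** Only the total of the two parts is prescribed; they need not add up to [p] element by element,
    since the removal homotopy transfers weight between elements. Both parts stay within the support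
    of [p], which keeps the image of one simplex in a finite subcomplex. *)
Record blendable (p : realization R Q) (w0 w1 : P -> R) : Prop := Blendable {
  blend_ge0l : forall x, 0 <= w0 x;
  blend_ge0r : forall x, 0 <= w1 x;
  blend_0l : forall x, p x = 0 -> w0 x = 0;
  blend_0r : forall x, p x = 0 -> w1 x = 0;
  blend_total : mass w0 setT + mass w1 setT = 1;
  blend_inl : forall x, w0 x != 0 -> Q' (phi x);
  blend_inr : forall x, w1 x != 0 -> Q' (psi x);
  blend_chainl : forall x y, w0 x != 0 -> w0 y != 0 -> (phi x >=< phi y)%O;
  blend_chainr : forall x y, w1 x != 0 -> w1 y != 0 -> (psi x >=< psi y)%O;
  blend_chain : forall x y, w0 x != 0 -> w1 y != 0 -> (phi x >=< psi y)%O }.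

Lemma blend_out D w0 w1 : (forall x, x \notin D -> w0 x = 0) ->
  (forall x, x \notin D -> w1 x = 0) ->
  forall y, y \notin undup (map phi D ++ map psi D) -> blend w0 w1 y = 0.
Proof.
move=> w0D w1D y; rewrite mem_undup mem_cat negb_or => /andP[y0 y1].
have out (chi : P -> P') (w : P -> R) : (forall x, x \notin D -> w x = 0) ->
    y \notin map chi D -> mass w [set x | chi x = y] = 0.
  move=> wD yD; apply: fsbig1 => x /= xy; apply: wD.
  by apply: contraNN yD => xD; rewrite -xy map_f.
by rewrite /blend !out // addr0.
Qed.

Lemma blend_point p w0 w1 : blendable p w0 w1 ->
  exists q : realization R Q', bary q = blend w0 w1.
Proof.
case=> w0_ge0 w1_ge0 w00 w10 w_total Q0 Q1 ch0 ch1 ch01.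
have [D [uD _ _ pD]] := bary_support p.
have w0D x : x \notin D -> w0 x = 0 by move/pD/w00.
have w1D x : x \notin D -> w1 x = 0 by move/pD/w10.
apply: (@mk_realization _ _ _ _ _ (undup (map phi D ++ map psi D))).
- exact: undup_uniq.
- by move=> y; rewrite addr_ge0 ?mass_ge0.
- exact: blend_out.
- have sum1 (chi : P -> P') (w : P -> R) : (forall x, x \notin D -> w x = 0) ->
      (forall x, x \in D -> chi x \in undup (map phi D ++ map psi D)) ->
      \sum_(y <- undup (map phi D ++ map psi D)) mass w [set x | chi x = y] =
      mass w setT.
    move=> wD chiD; under eq_bigr do rewrite (mass_seq _ uD wD).
    rewrite (mass_seq _ uD wD) (exchange_big_dep predT) //=.
    rewrite [LHS]big_seq [RHS]big_seq_cond.
    apply: eq_big => [x|x xD]; first by rewrite in_setT andbT.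
    under eq_bigl => y do
      rewrite in_fibre -[_ == _]/(predT y && (chi x == y)).
    by rewrite big_pick1 ?undup_uniq // chiD.
  rewrite big_split /= !sum1 // => x xD;
  by rewrite mem_undup mem_cat map_f ?orbT.
- move=> y; case: (eqVneq (mass w0 [set x | phi x = y]) 0) => [w0y|].
    rewrite /blend w0y add0r => /mass_neq0[x /= <-]; exact: Q1.
  by move=> /mass_neq0[x /= <- /Q0].
- move=> y y'; have nz z : blend w0 w1 z != 0 ->
      (exists2 x, phi x = z & w0 x != 0) \/ (exists2 x, psi x = z & w1 x != 0).
    case: (eqVneq (mass w0 [set x | phi x = z]) 0) => [w0z|].
      by rewrite /blend w0z add0r => /mass_neq0[x /= xz w1x]; right; exists x.
    by move=> /mass_neq0[x /= xz w0x]; left; exists x.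
  move=> /nz[[x <- wx]|[x <- wx]] /nz[[x' <- wx']|[x' <- wx']].
  + exact: ch0.
  + exact: ch01.
  + by rewrite comparable_sym; exact: ch01.
  + exact: ch1.
Qed.

(** Over one simplex with vertices [D] all values are carried by the finite set of images of [D]
    under [phi] and [psi]. Continuity may thus be tested coordinate by coordinate, where it is a
    finite sum of the given continuous weights. *)
Lemma blend_map (w0 w1 : realization R Q -> R -> P -> R) :
  (forall p u, blendable p (w0 p u) (w1 p u)) ->
  (forall x, continuous (fun z : realization R Q * R => w0 z.1 z.2 x)) ->
  (forall x, continuous (fun z : realization R Q * R => w1 z.1 z.2 x)) ->
  exists G : realization R Q * R -> realization R Q', continuous G /\
    forall p u, bary (G (p, u)) = blend (w0 p u) (w1 p u).
Proof.
move=> wb cw0 cw1.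
pose G (z : realization R Q * R) := projT1 (cid (blend_point (wb z.1 z.2))).
have GE p u : bary (G (p, u)) = blend (w0 p u) (w1 p u).
  by rewrite /G; case: cid.
exists G; split=> //.
apply: continuous_on_realization; first exact: compact_basis_real.
move=> k c; pose D := undup (codom c).
have uD : uniq D by exact: undup_uniq.
have w0D t u x : x \notin D -> w0 (char_map c t) u x = 0.
  by move=> xD; apply: (blend_0l (wb _ _)); exact: pushforward_out.
have w1D t u x : x \notin D -> w1 (char_map c t) u x = 0.
  by move=> xD; apply: (blend_0r (wb _ _)); exact: pushforward_out.
apply: (@continuous_realization _ _ _ _ _ _ (undup (map phi D ++ map psi D))).
  move=> [t u] y yD /=; rewrite GE (@blend_out D) //; first exact: w0D.
  exact: w1D.
move=> y; rewrite (_ : (fun z => _) = fun z : std_simplex R k * R =>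
    \sum_(x <- D | x \in [set x | phi x = y]) w0 (char_map c z.1) z.2 x +
    \sum_(x <- D | x \in [set x | psi x = y]) w1 (char_map c z.1) z.2 x).
  pose cc (z : std_simplex R k * R) := (char_map c z.1, z.2).
  have ccc : continuous cc.
    apply: continuous_pair; last exact: continuous_snd.
    apply: (continuous_compT (g := @char_map R d P Q k c)).
      exact: continuous_fst.
    exact: char_map_continuous.
  apply: continuousDT; apply: continuous_sum => x _.
    exact: (continuous_compT (f := cc) (g := fun z => w0 z.1 z.2 x)).
  exact: (continuous_compT (f := cc) (g := fun z => w1 z.1 z.2 x)).
apply/funext => -[t u] /=; rewrite GE /blend !(mass_seq _ uD) //.
- by move=> x; exact: w1D.
- by move=> x; exact: w0D.
Qed.

End blend.

(** * Cutting the weights of a point at a height *)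

Section split.
Variables (R : realType) (d : Order.disp_t) (P : porderType d) (Q : set P).
Implicit Types (p : realization R Q) (th : R).

Lemma bary_finsupp p : finsupp p.
Proof. by have [D [uD _ _ pD]] := bary_support p; exists D. Qed.

Definition below p x : R := mass p [set y | (y <= x)%O].
Definition sbelow p x : R := mass p [set y | (y < x)%O].

(** The points of the support of [p] form a chain; cutting the unit interval
    subdivided by their weights at [th] splits every weight into a lower and an
    upper part. *)
Definition lower p th x : R := Num.min (below p x) th - Num.min (sbelow p x) th.
Definition upper p th x : R := p x - lower p th x.

Lemma belowE p x : below p x = sbelow p x + p x.
Proof.
rewrite /below /sbelow -(mass_set1 p x) -massU; last 2 first.
- exact: bary_finsupp.
- by apply/seteqP; split=> y //= -[+ yx]; rewrite yx ltxx.
congr mass; apply/seteqP; split=> y /=.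
  by rewrite le_eqVlt => /orP[/eqP ->|]; [right|left].
by case=> [/ltW //|->].
Qed.

Lemma sbelow_ge0 p x : 0 <= sbelow p x.
Proof. by apply: mass_ge0 => y; exact: bary_ge0. Qed.

Lemma lower_ge0 p th x : 0 <= lower p th x.
Proof.
rewrite subr_ge0 belowE le_min ge_min ge_min lexx orbT andbT.
by rewrite lerDl bary_ge0.
Qed.

Lemma lower_le p th x : lower p th x <= p x.
Proof.
rewrite /lower belowE; have := bary_ge0 p x; set a := sbelow p x; set b := p x.
by move=> b0; rewrite !minElt; do 2 case: ltP => ?; lra.
Qed.

Lemma upper_ge0 p th x : 0 <= upper p th x.
Proof. by rewrite subr_ge0 lower_le. Qed.

Lemma lower0 p th x : p x = 0 -> lower p th x = 0.
Proof.
by move=> px; apply: le_anti; rewrite lower_ge0 andbT -px lower_le.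
Qed.

Lemma upper0 p th x : p x = 0 -> upper p th x = 0.
Proof. by move=> px; rewrite /upper lower0 // px subrr. Qed.

Lemma lower_all p th x : below p x <= th -> lower p th x = p x.
Proof.
move=> xth; have sth : sbelow p x <= th.
  by apply: le_trans xth; rewrite belowE lerDl bary_ge0.
by rewrite /lower !min_l // belowE addrC addKr.
Qed.

Lemma lower_none p th x : th <= sbelow p x -> lower p th x = 0.
Proof.
move=> xth; have bth : th <= below p x.
  by apply: le_trans xth _; rewrite belowE lerDl bary_ge0.
by rewrite /lower !min_r // subrr.
Qed.

(** An element with some lower weight starts below the cut, so everything strictly smaller ends
    below the cut and has no upper part. At most one element is in fact cut through. *)
Lemma lower_upper_le p th x y : lower p th x != 0 -> upper p th y != 0 ->
  (x <= y)%O.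
Proof.
move=> lx uy.
have px : p x != 0 by apply: contraNneq lx => /(lower0 th) ->.
have py : p y != 0 by apply: contraNneq uy => /(upper0 th) ->.
have [//|yx] := comparable_leP (bary_chain px py).
suff : upper p th y = 0 by move/eqP; rewrite (negbTE uy).
rewrite /upper lower_all ?subrr //.
have [xth|/ltW xth] := leP th (sbelow p x).
  by move: lx; rewrite lower_none // eqxx.
apply: le_trans xth; apply: mass_le; first exact: bary_finsupp.
  exact: bary_ge0.
by move=> z /= zy; apply: le_lt_trans yx.
Qed.

Lemma lower_continuous (T : topologicalType) (w : T -> realization R Q)
    (th : T -> R) x : continuous w -> continuous th ->
  continuous (fun z => lower (w z) (th z) x).
Proof.
have cmass S : continuous w -> continuous (fun z => mass (w z) S).
  move=> cw.
  apply: (continuous_compT (g := fun p : realization R Q => mass p S) cw).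
  exact: mass_continuous.
move=> cw cth; apply: continuousBT; apply: continuous_minT => //; exact: cmass.
Qed.

Lemma upper_continuous (T : topologicalType) (w : T -> realization R Q)
    (th : T -> R) x : continuous w -> continuous th ->
  continuous (fun z => upper (w z) (th z) x).
Proof.
move=> cw cth; apply: continuousBT; last exact: lower_continuous.
apply: (continuous_compT (g := fun p : realization R Q => p x) cw).
exact: bary_continuous.
Qed.

(** Within the support [S] is an initial segment of the chain, so its weights fill the interval from
    0 to [mass p S], of which the cut keeps the part up to [th]. The differences of minima telescope
    along the chain; the induction peels off the largest element. *)
Lemma mass_lower p th (S : set P) :
  (forall x y, p x != 0 -> p y != 0 -> S y -> (x <= y)%O -> S x) ->
  0 <= th -> mass (lower p th) S = Num.min (mass p S) th.
Proof.
move=> + th0; have [D [uD Dc _ pD]] := bary_support p.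
have lD x : x \notin D -> lower p th x = 0 by move=> /pD /lower0.
pose E (S : set P) := [seq x <- D | (x \in S) && (p x != 0)].
have [n] := ubnP (size (E S)); elim: n S => // n IH S sn Slow.
have [E0|[x xE]] : E S = [::] \/ exists x, x \in E S.
  by case: (E S) => [|x s]; [left|right; exists x; rewrite mem_head].
  have pS x : S x -> p x = 0.
    move=> Sx; apply/eqP; apply: contraT => px.
    have : x \in E S.
      rewrite mem_filter px mem_set //=.
      by apply: contraNT px => /pD ->.
    by rewrite E0.
  rewrite [LHS]fsbig1; last by move=> x /pS /lower0.
  by rewrite [X in Num.min X _]fsbig1 // min_l.
have [y yE ymax] : exists2 y, y \in E S & forall z, z \in E S -> (z <= y)%O.
  have Ec : {in E S &, forall a b, (a >=< b)%O}.
    by move=> a b; rewrite !mem_filter => /andP[_ aD] /andP[_ bD]; exact: Dc.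
  elim: (E S) (x) (xE) Ec => // a s IHs b _ Ec.
  case: s IHs Ec => [|e s] IHs Ec.
    by exists a; rewrite ?mem_head // => z; rewrite inE => /eqP ->.
  have [||y ys ymax] := IHs e; first exact: mem_head.
    by move=> i j si sj; apply: Ec; rewrite inE ?si ?sj orbT.
  have ay : (a >=< y)%O by apply: Ec; rewrite ?mem_head // inE ys orbT.
  have [{}ay|ya] := comparable_leP ay.
  - exists y; first by rewrite inE ys orbT.
    by move=> z; rewrite inE => /orP[/eqP -> //|/ymax].
  - exists a; first exact: mem_head.
    move=> z; rewrite inE => /orP[/eqP -> //|/ymax zy].
    exact: le_trans zy (ltW ya).
have [Sy py yD] : [/\ S y, p y != 0 & y \in D].
  by move: yE; rewrite mem_filter => /andP[/andP[/set_mem ? ?] ?].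
pose S' := S `&` [set z | (z < y)%O].
have inE' z : p z != 0 -> S z -> z \in E S.
  move=> pz Sz; rewrite mem_filter pz mem_set //=.
  by apply: contraNT pz => /pD ->.
have split_mass (g : P -> R) : (forall z, p z = 0 -> g z = 0) ->
    mass g S = mass g S' + g y.
  move=> g0; have gf : finsupp g by apply: (finsupp_dom (bary_finsupp p)).
  rewrite -(mass_set1 g y) -massU //; last first.
    by apply/seteqP; split=> z //= -[[_ /= +] zy]; rewrite zy ltxx.
  apply: mass_eq_set => // z gz.
  have pz : p z != 0 by apply: contraNneq gz => /g0 ->.
  split=> [Sz|[[]//|-> //]].
  have := ymax _ (inE' _ pz Sz); rewrite le_eqVlt => /orP[/eqP ->|zy].
    by right.
  by left.
(* As [S] is closed downwards in the support, what is left of it without [y] is everything strictly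
   below [y]; this is what makes the sum telescope. *)
have mS' : mass p S' = sbelow p y.
  apply: mass_eq_set; last exact: bary_finsupp.
  move=> z pz; split=> [[]//|/= zy]; split=> //.
  exact: (Slow z y pz py Sy (ltW zy)).
rewrite (split_mass _ (@lower0 p th)) (split_mass p) // mS' -belowE IH ?mS'.
- by rewrite /lower addrC subrK.
- rewrite -ltnS; apply: leq_trans sn; rewrite ltnS.
  rewrite -(count_predC (pred1 y) (E S)) -addn1 addnC leq_add //.
    by rewrite -has_count; apply/hasP; exists y => /=.
  rewrite count_filter size_filter; apply: sub_count => z /=.
  by move=> /andP[/set_mem [Sz zy] pz]; rewrite mem_set // pz (lt_eqF zy).
- move=> a b pa pb [Sb ba] ab; split; first exact: (Slow a b).
  exact: le_lt_trans ba.
Qed.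

End split.

(** * Homotopies from comparable maps and from conical elements *)

Section poset_maps.
Variable R : realType.

Definition monotone_on (d d' : Order.disp_t) (P : porderType d)
    (P' : porderType d') (Q : set P) (Q' : set P') (phi : P -> P') : Prop :=
  (forall x, Q x -> Q' (phi x)) /\
  (forall x y, Q x -> Q y -> (x <= y)%O -> (phi x <= phi y)%O).

(** The induced map is specified by its coordinates, so that the ends of any homotopy can be
    recognized as induced maps by a computation. *)
Definition realizes (d d' : Order.disp_t) (P : porderType d)
    (P' : porderType d') (Q : set P) (Q' : set P') (phi : P -> P')
    (F : realization R Q -> realization R Q') : Prop :=
  forall p y, F p y = mass p [set x | phi x = y].

Section two.
Variables (d d' : Order.disp_t) (P : porderType d) (P' : porderType d').
Variables (Q : set P) (Q' : set P').

Lemma monotone_comparable (phi : P -> P') x y : monotone_on Q Q' phi ->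
  Q x -> Q y -> (x >=< y)%O -> (phi x >=< phi y)%O.
Proof.
move=> [_ phi_mono] Qx Qy /orP[xy|yx]; rewrite /Order.comparable.
  by rewrite phi_mono.
by rewrite (phi_mono y x) ?orbT.
Qed.

Lemma mass_cst0 (S : set P) : mass (fun _ => 0 : R) S = 0.
Proof. exact: fsbig1. Qed.

(** Cutting at [1 - u] and moving the lower part by [phi] and the upper part by
    [psi] keeps the image on a chain, as [phi x <= phi y <= psi y]. *)
Lemma compare_homotopy (phi psi : P -> P') : monotone_on Q Q' phi ->
  monotone_on Q Q' psi -> (forall x, Q x -> (phi x <= psi x)%O) ->
  exists G : realization R Q * R -> realization R Q', continuous G /\
    forall p u, bary (G (p, u)) =
      blend phi psi (lower p (1 - clamp u)) (upper p (1 - clamp u)).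
Proof.
move=> mphi mpsi phipsi.
have pQ (p : realization R Q) x : p x != 0 -> Q x by exact: bary_in.
have cth : continuous (fun z : realization R Q * R => 1 - clamp z.2).
  apply: continuousBT; first exact: continuous_cst.
  exact: continuous_compT (@continuous_snd _ _) (@clamp_continuous _).
apply: blend_map => [p u|x|x].
- have lp x : lower p (1 - clamp u) x != 0 -> p x != 0.
    by apply: contraNneq => /lower0 ->.
  have up x : upper p (1 - clamp u) x != 0 -> p x != 0.
    by apply: contraNneq => /upper0 ->.
  split.
  + exact: lower_ge0.
  + exact: upper_ge0.
  + by move=> x /lower0.
  + by move=> x /upper0.
  + have lf : finsupp (lower p (1 - clamp u)).
      by apply: finsupp_dom (bary_finsupp p) _ => x /lower0.
    have uf : finsupp (upper p (1 - clamp u)).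
      by apply: finsupp_dom (bary_finsupp p) _ => x /upper0.
    rewrite -massD // -(massT p); apply: eq_mass => x _.
    by rewrite addrC subrK.
  + by move=> x /lp/pQ; apply: mphi.1.
  + by move=> x /up/pQ; apply: mpsi.1.
  + move=> x y /lp px /lp py.
    apply: (monotone_comparable mphi); [exact: pQ px|exact: pQ py|].
    exact: (bary_chain px py).
  + move=> x y /up px /up py.
    apply: (monotone_comparable mpsi); [exact: pQ px|exact: pQ py|].
    exact: (bary_chain px py).
  + move=> x y lx uy; have xy := lower_upper_le lx uy.
    have Qx : Q x by exact/pQ/lp/lx.
    have Qy : Q y by exact/pQ/up/uy.
    rewrite /Order.comparable (le_trans _ (phipsi y Qy)) //.
    by case: mphi => _ mono; exact: mono.
- by apply: lower_continuous cth; exact: continuous_fst.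
- by apply: upper_continuous cth; exact: continuous_fst.
Qed.

Lemma below_le1 (p : realization R Q) x : below p x <= 1.
Proof.
by rewrite -(massT p); apply: mass_le => //;
  [exact: bary_finsupp|exact: bary_ge0].
Qed.

Lemma blend_lower1 (p : realization R Q) (phi psi : P -> P') y :
  blend phi psi (lower p 1) (upper p 1) y = mass p [set x | phi x = y].
Proof.
have l1 x : lower p 1 x = p x by rewrite lower_all // below_le1.
rewrite /blend; under eq_mass do rewrite l1.
rewrite [X in _ + X]fsbig1 ?addr0 // => x _.
by rewrite /upper l1 subrr.
Qed.

Lemma blend_lower0 (p : realization R Q) (phi psi : P -> P') y :
  blend phi psi (lower p 0) (upper p 0) y = mass p [set x | psi x = y].
Proof.
have l0 x : lower p 0 x = 0 by rewrite lower_none // sbelow_ge0.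
rewrite /blend [X in X + _]fsbig1 // add0r.
by apply: eq_mass => x _; rewrite /upper l0 subr0.
Qed.

(** The induced map is the start of the homotopy from [phi] to itself, which spares a separate proof
    of continuity. *)
Lemma realizes_exists (phi : P -> P') : monotone_on Q Q' phi ->
  exists F : realization R Q -> realization R Q', continuous F /\
    realizes phi F.
Proof.
move=> mphi; have [//|G [cG GE]] := @compare_homotopy phi phi mphi mphi.
exists (fun p => G (p, 0)); split; last first.
  by move=> p y; rewrite GE clamp0 subr0 blend_lower1.
apply: (continuous_compT (f := fun p => (p, 0)) (g := G)) cG.
apply: continuous_pair; first by move=> x; exact: cvg_id.
exact: continuous_cst.
Qed.

Lemma realizes_le_homotopic (phi psi : P -> P')
    (F F' : realization R Q -> realization R Q') :
  monotone_on Q Q' phi -> monotone_on Q Q' psi ->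
  (forall x, Q x -> (phi x <= psi x)%O) ->
  realizes phi F -> realizes psi F' -> homotopic R F F'.
Proof.
move=> mphi mpsi phipsi FE F'E.
have [G [cG GE]] := compare_homotopy mphi mpsi phipsi.
apply/homotopicP; exists G; split=> // p;
  apply: realization_eq; apply/funext => y.
  by rewrite GE clamp0 subr0 blend_lower1 FE.
by rewrite GE clamp1 subrr blend_lower0 F'E.
Qed.

End two.

Lemma realizes_comp (d d' d'' : Order.disp_t) (P : porderType d)
    (P' : porderType d') (P'' : porderType d'') (Q : set P) (Q' : set P')
    (Q'' : set P'') (phi : P -> P') (psi : P' -> P'')
    (F : realization R Q -> realization R Q')
    (G : realization R Q' -> realization R Q'') :
  realizes phi F -> realizes psi G -> realizes (psi \o phi) (G \o F).
Proof.
move=> FE GE p z; rewrite /= GE.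
have [D [uD _ _ pD]] := bary_support p.
have pF : bary (F p) = blend phi phi p (fun=> 0).
  by apply/funext => y; rewrite FE /blend mass_cst0 addr0.
have FD y : y \notin undup (map phi D) -> F p y = 0.
  move=> yD; rewrite pF (@blend_out _ _ _ _ _ _ _ D) //.
  by rewrite mem_undup mem_cat orbb -mem_undup.
rewrite (mass_seq _ (undup_uniq _) FD) (mass_seq _ uD pD).
under eq_bigr do rewrite FE (mass_seq _ uD pD).
rewrite (exchange_big_dep predT) //= [LHS]big_seq [RHS]big_seq_cond.
rewrite [RHS]big_mkcondr /=; apply: eq_bigr => x xD.
under eq_bigl => y do rewrite (in_fibre phi).
by rewrite big_pick1 ?undup_uniq // mem_undup map_f.
Qed.

Lemma realizes_id (d : Order.disp_t) (P : porderType d) (Q : set P) :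
  realizes id (@idfun (realization R Q)).
Proof.
by move=> p y; rewrite -[LHS](mass_set1 p).
Qed.

Lemma monotone_comp (d d' d'' : Order.disp_t) (P : porderType d)
    (P' : porderType d') (P'' : porderType d'') (Q : set P) (Q' : set P')
    (Q'' : set P'') (phi : P -> P') (psi : P' -> P'') :
  monotone_on Q Q' phi -> monotone_on Q' Q'' psi ->
  monotone_on Q Q'' (psi \o phi).
Proof.
move=> [Qphi mphi] [Qpsi mpsi]; split=> [x Qx|x y Qx Qy xy] /=.
  exact/Qpsi/Qphi.
by apply: mpsi; [exact: Qphi|exact: Qphi|exact: mphi].
Qed.

(** Each composite is joined to the identity by a single comparison. In the uses below one composite
    is the identity on its subposet and the other one is increasing, as for a closure operator. *)
Lemma poset_equivalence (d d' : Order.disp_t) (P : porderType d)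
    (P' : porderType d') (Q : set P) (Q' : set P') (phi : P -> P')
    (psi : P' -> P) :
  monotone_on Q Q' phi -> monotone_on Q' Q psi ->
  (forall x, Q x -> (x <= psi (phi x))%O) ->
  (forall y, Q' y -> (y <= phi (psi y))%O) ->
  homotopy_equivalent R (realization R Q) (realization R Q').
Proof.
move=> mphi mpsi Qle Q'le.
have [F [cF FE]] := realizes_exists mphi.
have [G [cG GE]] := realizes_exists mpsi.
exists F; split=> //; exists G; split=> //; apply: homotopic_sym.
  apply: (realizes_le_homotopic (phi := id) (psi := psi \o phi)) => //.
  - exact: monotone_comp mphi mpsi.
  - exact: realizes_id.
  - exact: realizes_comp FE GE.
apply: (realizes_le_homotopic (phi := id) (psi := phi \o psi)) => //.
- exact: monotone_comp mpsi mphi.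
- exact: realizes_id.
- exact: realizes_comp GE FE.
Qed.

End poset_maps.

Lemma in_set1_eq (T : eqType) (x y : T) : (x \in [set y]) = (x == y).
Proof. by apply/idP/eqP => [/set_mem //|->]; exact/mem_set. Qed.

(** * Removal of a conical element *)

Section removal.
Variables (R : realType) (d : Order.disp_t) (P : porderType d) (X : set P).
Variables (x0 : P) (f : P -> P) (c : P).
Hypothesis f_below : forall y, X y -> (y < x0)%O -> X (f y) /\ (f y < x0)%O.
Hypothesis f_mono : forall y z, X y -> X z -> (z < x0)%O -> (y <= z)%O ->
  (f y <= f z)%O.
Hypothesis f_ge : forall y, X y -> (y < x0)%O -> (y <= f y)%O.
Hypothesis f_c : forall y, X y -> (y < x0)%O -> (c <= f y)%O.
Hypotheses (Xc : X c) (c_below : (c < x0)%O).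

Implicit Types (p : realization R X) (a b : R).

(** The cut that leaves an upper part of mass [Num.min (sbelow p x0) (a * p x0)] below [x0]. If [x0]
    has no weight, nothing is above the cut and the point stays where it is. *)
Let cut p a : R := sbelow p x0 - Num.min (sbelow p x0) (a * p x0).

(** At [a = b = 0] these weights give back [p].  Increasing [a] to [1] pushes an
    upper part of [p] below [x0], of mass at most [p x0], along [f]; increasing
    [b] to [1] then moves the weight of [x0] onto the image of this part, and
    onto the cone point [c] once the whole of [p] below [x0] has been pushed. *)
Let w0 p a b z : R :=
  if (z < x0)%O then lower p (cut p a) z
  else if z == x0 then (1 - b) * p x0 else p z.

Let w1 p a b z : R :=
  if (z < x0)%O then (1 + b) * upper p (cut p a) z
  else if z == x0 then b * Num.max 0 (p x0 - sbelow p x0) else 0.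

Let f' z := if (z < x0)%O then f z else if z == x0 then c else z.

(** The hypothesis [b = 0 \/ a = 1] puts the two stages one after the other: once [a = 1], the
    weight taken from [x0] matches the weight added to the moved part. The alternative for [Y] lets
    one verification serve both for the homotopy inside [X] and for its end, which avoids [x0]. *)
Lemma removal_blendable p a b (Y : set P) : 0 <= a <= 1 -> 0 <= b <= 1 ->
  b = 0 \/ a = 1 -> (Y = X) \/ (b = 1 /\ Y = X `\ x0) ->
  blendable Y id f' p (w0 p a b) (w1 p a b).
Proof.
move=> /andP[a0 a1] /andP[b0 b1] ab YX.
have p0 := bary_ge0 p; have s0 := p0 x0.
have m0 := sbelow_ge0 p x0.
have h0 : 0 <= Num.min (sbelow p x0) (a * p x0).
  by rewrite le_min m0 mulr_ge0.
have cut0 : 0 <= cut p a by rewrite subr_ge0 ge_min lexx.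
have cutm : cut p a <= sbelow p x0 by rewrite gerBl.
have pX z : p z != 0 -> X z by exact: bary_in.
have w0P z : w0 p a b z != 0 ->
    [\/ (z < x0)%O /\ lower p (cut p a) z != 0, z = x0 /\ b != 1 |
      [/\ ~~ (z < x0)%O, z != x0 & p z != 0]].
  rewrite /w0; case: ifPn => [zx0 lz|nzx0]; first by constructor 1.
  case: (eqVneq z x0) => [->|zx0 pz]; last by constructor 3.
  by move=> bs; constructor 2; split=> //; apply: contraNneq bs => ->;
    rewrite subrr mul0r.
have w1P z : w1 p a b z != 0 ->
    ((z < x0)%O /\ upper p (cut p a) z != 0) \/
    [/\ z = x0, b != 0 & sbelow p x0 < p x0].
  rewrite /w1; case: ifPn => [zx0 uz|nzx0].
    by left; split=> //; apply: contraNneq uz => ->; rewrite mulr0.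
  case: (eqVneq z x0) => [->|_]; last by rewrite eqxx.
  move=> bs; right; split=> //.
    by apply: contraNneq bs => ->; rewrite mul0r.
  rewrite ltNge; apply: contra bs => sm.
  by rewrite max_l ?mulr0 // subr_le0.
have upx0 z : (z < x0)%O -> upper p (cut p a) z != 0 -> p x0 != 0.
  move=> zx0; apply: contraNneq => px0.
  rewrite /upper lower_all ?subrr //.
  rewrite /cut px0 mulr0 min_r // subr0; apply: mass_le => //.
    exact: bary_finsupp.
  by move=> y /= yz; exact: le_lt_trans zx0.
have w0p z : p z = 0 -> w0 p a b z = 0.
  move=> pz; rewrite /w0; case: ifP => _; first exact: lower0.
  by case: eqP => // zx0; rewrite -zx0 pz mulr0.
have w1p z : p z = 0 -> w1 p a b z = 0.
  move=> pz; apply/eqP; apply: contraT => /w1P[[_ /eqP[]]|[zx0 _]].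
    exact: upper0.
  by rewrite -zx0 pz ltNge zx0 m0.
have w0N z : w0 p a b z != 0 -> p z != 0 by apply: contraNneq => /w0p ->.
have w1N z : w1 p a b z != 0 -> p z != 0 by apply: contraNneq => /w1p ->.
have w1x z : w1 p a b z != 0 -> p x0 != 0.
  move=> /w1P[[zx0]|[_ _ ms]]; first exact: upx0.
  by rewrite gt_eqF // (le_lt_trans m0).
have f'X z : w1 p a b z != 0 -> X (f' z) /\ (f' z < x0)%O.
  move=> w1z; rewrite /f'; case: (w1P _ w1z) => [[zx0 _]|[-> _ _]].
    by rewrite zx0; apply: f_below => //; exact/pX/w1N.
  by rewrite ltxx eqxx.
have Yf' z : X z -> (z < x0)%O -> Y z.
  by case: YX => [-> //|[_ ->]] Xz zx0; split=> //= e; rewrite e ltxx in zx0.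
split.
- move=> z; rewrite /w0; case: ifP => _; first exact: lower_ge0.
  by case: eqP => // _; rewrite mulr_ge0 // subr_ge0.
- move=> z; rewrite /w1; case: ifP => _.
    by rewrite mulr_ge0 ?upper_ge0 // addr_ge0.
  by case: eqP => // _; rewrite mulr_ge0 // le_max lexx.
- exact: w0p.
- exact: w1p.
- have fp := bary_finsupp p.
  have fl : finsupp (lower p (cut p a)) by apply: finsupp_dom fp _ => z /lower0.
  have fu : finsupp (upper p (cut p a)) by apply: finsupp_dom fp _ => z /upper0.
  rewrite -massD; try exact: finsupp_dom fp _.
  pose A := [set z | (z < x0)%O].
  (* Compared with [p], the sum [w0 + w1] gains [b * upper] below [x0] and changes by [e <= 0] at
     [x0]; the two changes have to cancel. *)
  pose e := b * (Num.max 0 (p x0 - sbelow p x0) - p x0).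
  rewrite (_ : (fun z => _) = fun z => p z +
    ((if z \in A then b * upper p (cut p a) z else 0) +
     (if z \in [set x0] then e else 0))); last first.
    apply/funext => z; rewrite /w0 /w1.
    have -> : (z \in A) = (z < x0)%O by apply/idP/idP => [/set_mem|/mem_set].
    rewrite in_set1_eq; case: (boolP (z < x0)%O) => [zx0|_].
      by rewrite (lt_eqF zx0) /upper; ring.
    by case: (eqVneq z x0) => [->|_]; rewrite /e; ring.
  have f1 : finsupp (fun z => if z \in A then b * upper p (cut p a) z else 0).
    by apply: finsupp_dom fu _ => z ->; rewrite mulr0 if_same.
  have f2 : finsupp (fun z => if z \in [set x0] then e else 0).
    by exists [:: x0] => // z; rewrite in_set1_eq inE => /negbTE ->.
  have f3 : finsupp (fun z => (if z \in A then b * upper p (cut p a) z else 0) +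
     (if z \in [set x0] then e else 0)).
    have [D [uD D1 D2]] := finsupp2 f1 f2; exists D => // z zD.
    by rewrite D1 // D2 // addr0.
  rewrite massD // massT massD // !mass_patch !setIT massZ // mass_set1.
  rewrite /upper massB // mass_lower //; last first.
    by move=> y z _ _ /= zx0 yz; exact: le_lt_trans zx0.
  rewrite -/(sbelow p x0) min_r // /cut.
  case: ab => [b_eq0|a_eq1].
    by rewrite /e b_eq0 !mul0r !addr0.
  rewrite /e a_eq1 mul1r minElt maxElt.
  by case: ltP => ?; case: ltP => ?; try (ring || lra); nra.
- move=> z w0z /=; have Xz := pX z (w0N z w0z).
  case: YX => [-> //|[be ->]]; split=> //= zx0.
  by move: w0z; rewrite zx0 /w0 ltxx eqxx be subrr mul0r eqxx.
- by move=> z /f'X[? ?]; exact: Yf'.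
- by move=> y z /w0N py /w0N pz; exact: (bary_chain py pz).
- move=> y z w1y w1z; wlog yz : y z w1y w1z / (y <= z)%O.
    move=> wl; have /orP[] := bary_chain (w1N y w1y) (w1N z w1z).
      exact: wl.
    by rewrite comparable_sym; exact: wl.
  rewrite /f'; case: (w1P _ w1z) => [[zx0 _]|[zx0 _ _]].
    rewrite zx0 (le_lt_trans yz zx0) /Order.comparable f_mono //.
      exact/pX/w1N.
    exact/pX/w1N.
  rewrite zx0 ltxx eqxx; case: (w1P _ w1y) => [[yx0 _]|[-> _ _]].
    by rewrite yx0 /Order.comparable f_c ?orbT //; exact/pX/w1N.
  by rewrite ltxx eqxx comparablexx.
- move=> y z w0y w1z; rewrite /=.
  have [Xfz fzx0] := f'X z w1z.
  case: (w0P y w0y) => [[yx0 ly]|[-> _]|[nyx0 yx0 py]].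
  + case: (w1P z w1z) => [[zx0 uz]|[_ bn0 ms]].
      have yz := lower_upper_le ly uz.
      rewrite /Order.comparable /f' zx0 (le_trans yz) // f_ge //.
      exact/pX/w1N.
    (* Weight goes to [c] only if [b != 0] and [sbelow p x0 < p x0]. Then [a = 1] and the cut is at
       0, so below [x0] there is no lower part left that would have to be comparable with [c]. *)
    case: ab => [be|ae]; first by rewrite be eqxx in bn0.
    case/eqP: ly; apply: lower_none.
    by rewrite /cut ae mul1r min_l ?subrr ?sbelow_ge0 // ltW.
  + by rewrite /Order.comparable (ltW fzx0) orbT.
  (* Something is moved only if [x0] carries weight, so [y] is comparable with [x0], hence above it
     and above the image of the moved part. *)
  + have x0y : (x0 <= y)%O.
      case/orP: (bary_chain (w1x z w1z) py) => // yltx0.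
      by rewrite lt_neqAle yltx0 yx0 in nyx0.
    by rewrite /Order.comparable (le_trans (ltW fzx0) x0y) orbT.
Qed.

(** The end of the homotopy avoids [x0] and is the identity on the points that avoid [x0] already,
    because nothing is pushed when [x0] has weight 0. It is therefore a homotopy inverse of the
    inclusion. *)
Lemma removal_homotopy : homotopy_equivalent R (realization R X)
  (realization R (X `\ x0)).
Proof.
have cx0 : continuous (fun z : realization R X * R => z.1 x0).
  exact: continuous_compT (@continuous_fst _ _) (@bary_continuous _ _ _ _ x0).
have cmass S : continuous (fun z : realization R X * R => mass z.1 S).
  exact: continuous_compT (@continuous_fst _ _) (@mass_continuous _ _ _ _ S).
have cp x : continuous (fun z : realization R X * R => z.1 x).
  exact: continuous_compT (@continuous_fst _ _) (@bary_continuous _ _ _ _ x).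
have ccut (al : R -> R) : continuous al ->
    continuous (fun z : realization R X * R => cut z.1 (al z.2)).
  move=> cal; rewrite /cut; apply: continuousBT; first exact: cmass.
  apply: continuous_minT; first exact: cmass.
  apply: continuousMT => //.
  exact: continuous_compT (@continuous_snd _ _) cal.
have clow (al : R -> R) x : continuous al ->
    continuous (fun z : realization R X * R => lower z.1 (cut z.1 (al z.2)) x).
  by move=> cal; apply: lower_continuous; [exact: continuous_fst|exact: ccut].
have cup (al : R -> R) x : continuous al ->
    continuous (fun z : realization R X * R => upper z.1 (cut z.1 (al z.2)) x).
  by move=> cal; apply: upper_continuous; [exact: continuous_fst|exact: ccut].
have cw0 (al be : R -> R) x : continuous al -> continuous be ->
    continuous (fun z : realization R X * R => w0 z.1 (al z.2) (be z.2) x).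
  move=> cal cbe; rewrite /w0; case: (x < x0)%O; first exact: clow.
  case: (x == x0); last exact: cp.
  apply: continuousMT => //; apply: continuousBT; first exact: continuous_cst.
  exact: continuous_compT (@continuous_snd _ _) cbe.
have cw1 (al be : R -> R) x : continuous al -> continuous be ->
    continuous (fun z : realization R X * R => w1 z.1 (al z.2) (be z.2) x).
  move=> cal cbe.
  have cb : continuous (fun z : realization R X * R => be z.2).
    exact: continuous_compT (@continuous_snd _ _) cbe.
  rewrite /w1; case: (x < x0)%O.
    apply: continuousMT.
      by apply: continuousDT => //; exact: continuous_cst.
    exact: cup.
  case: (x == x0); last exact: continuous_cst.
  apply: continuousMT => //.
  apply: continuous_maxT; first exact: continuous_cst.
  by apply: continuousBT; [exact: cp|exact: cmass].
have w000 p : w0 p 0 0 = p.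
  apply/funext => z; rewrite /w0 subr0 mul1r; case: ifP => [zx0|_].
    rewrite lower_all // /cut mul0r min_r ?subr0 ?sbelow_ge0 //.
    apply: mass_le; [exact: bary_finsupp|exact: bary_ge0|].
    by move=> y /= yz; exact: le_lt_trans zx0.
  by case: eqP => // ->.
have w100 p z : w1 p 0 0 z = 0.
  rewrite /w1 mul0r; case: ifP => [zx0|_]; last by rewrite if_same.
  rewrite /upper; have := congr1 (fun g => g z) (w000 p).
  by rewrite /w0 zx0 => ->; rewrite subrr mulr0.
have [K [cK KE]] : exists G : realization R X * R -> realization R (X `\ x0),
    continuous G /\
    forall p u, bary (G (p, u)) = blend id f' (w0 p 1 1) (w1 p 1 1).
  apply: (@blend_map _ _ _ _ _ _ _ id f' (fun p _ => w0 p 1 1)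
    (fun p _ => w1 p 1 1)).
  - by move=> p _; apply: removal_blendable; rewrite ?lexx ?ler01; auto.
  - by move=> x; apply: (cw0 (fun=> 1) (fun=> 1)); exact: continuous_cst.
  - by move=> x; apply: (cw1 (fun=> 1) (fun=> 1)); exact: continuous_cst.
pose k p := K (p, 0).
have ck : continuous k.
  apply: (continuous_compT (f := fun p => (p, 0)) (g := K)) cK.
  apply: continuous_pair; first by move=> x; exact: cvg_id.
  exact: continuous_cst.
(* [al] runs over the first half of the unit interval and [be] over the second. *)
pose al (u : R) := clamp (2 * u); pose be (u : R) := clamp (2 * u - 1).
have cal : continuous al.
  apply: (continuous_compT (g := @clamp R)) (@clamp_continuous R).
  apply: continuousMT; first exact: continuous_cst.
  by move=> x; exact: cvg_id.
have cbe : continuous be.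
  apply: (continuous_compT (g := @clamp R)) (@clamp_continuous R).
  apply: continuousBT; last exact: continuous_cst.
  apply: continuousMT; first exact: continuous_cst.
  by move=> x; exact: cvg_id.
have albe u : be u = 0 \/ al u = 1.
  rewrite /al /be /clamp; case: (lerP u 2^-1) => ?.
    by left; rewrite min_r ?max_l; lra.
  by right; rewrite min_l ?max_r; lra.
have [H [cH HE]] : exists G : realization R X * R -> realization R X,
    continuous G /\ forall p u,
    bary (G (p, u)) = blend id f' (w0 p (al u) (be u)) (w1 p (al u) (be u)).
  apply: (@blend_map _ _ _ _ _ _ _ id f' (fun p u => w0 p (al u) (be u))
    (fun p u => w1 p (al u) (be u))).
  - move=> p u; apply: removal_blendable; rewrite ?clamp_ge0 ?clamp_le1 //.
    by left.
  - by move=> x; exact: cw0.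
  - by move=> x; exact: cw1.
have blend00 p : blend id f' (w0 p 0 0) (w1 p 0 0) = p.
  apply/funext => y; rewrite /blend w000 [X in _ + X]fsbig1 // addr0.
  by rewrite -[RHS](mass_set1 p).
have XX : X `\ x0 `<=` X by move=> x [].
have ci := realization_incl_continuous R XX.
exists k; split=> //; exists (realization_incl R XX); split=> //.
- apply: homotopic_sym; apply/homotopicP; exists H; split=> // p;
    apply: realization_eq.
    by rewrite HE /al /be mulr0 sub0r clamp0 /clamp max_l ?ge_min ?lerN10 ?orbT.
  rewrite HE /al /be mulr1 (_ : 2 - 1 = 1); last by ring.
  rewrite clamp1 (_ : clamp 2 = 1) ?KE //.
  by rewrite /clamp min_l ?max_r ?ler01 // ler1n.
- rewrite (_ : k \o _ = idfun).
    by apply: homotopic_refl => x; exact: cvg_id.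
  apply/funext => p; apply: realization_eq.
  rewrite /= KE -[RHS]/(bary (realization_incl R XX p)).
  set q := realization_incl R XX p.
  have qx0 : q x0 = 0.
    by apply/eqP; apply: contraT => /(@bary_in _ _ _ _ p)[_ /=].
  rewrite -[RHS]blend00; congr blend; apply/funext => z;
    rewrite /w0 /w1 /cut qx0.
    by rewrite !mulr0.
  rewrite !mulr0 mul0r !min_r ?sbelow_ge0 // subr0.
  rewrite max_l ?mulr0; last by rewrite sub0r oppr_le0 sbelow_ge0.
  case: ifP => // zx0; rewrite /upper lower_all ?subrr ?mulr0 //.
  apply: mass_le; [exact: bary_finsupp|exact: bary_ge0|].
  by move=> y /= yz; exact: le_lt_trans zx0.
Qed.

End removal.

(** The image of a characteristic map lies in a single [supported D], so closedness need only be
    tested there, and compact subsets of the Hausdorff realization are closed. *)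
Lemma closed_realization (R : realType) (d' : Order.disp_t)
    (P : porderType d') (Q : set P)
    (C : set (realization R Q)) :
  (forall D, compact (C `&` supported D)) -> closed C.
Proof.
move=> cC; rewrite -[C]setCK; apply: open_closedC.
rewrite realization_openE => k c.
suff : closed (char_map c @^-1` C).
  by rewrite preimage_setC; exact: closed_openC.
have -> : char_map c @^-1` C =
    char_map c @^-1` (C `&` supported (undup (codom c))).
  apply/seteqP; split=> [t Ct|t []//]; split=> // x.
  exact: pushforward_out.
apply: closed_comp => [t _|]; first exact: char_map_continuous.
by apply: compact_closed; [exact: realization_hausdorff|exact: cC].
Qed.

(** * Homotopy colimits *)

Section hocolim_theory.
Variables (R : realType) (d : Order.disp_t) (J : finPOrderType d).
Implicit Types F G : diagram J.

Definition hocolim_cell F (j : J) (z : F j * realization R (upset j)) :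
    hocolim R F :=
  hocolim_pi (existT (fun j : J => (F j * realization R (upset j))%type) j z).

Lemma hocolim_pi_continuous F : continuous (@hocolim_pi R d J F).
Proof. exact: pi_continuous. Qed.

Lemma hocolim_cell_continuous F j : continuous (@hocolim_cell F j).
Proof.
apply: (continuous_compT (g := @hocolim_pi R d J F)).
  exact: existT_continuous.
exact: hocolim_pi_continuous.
Qed.

Lemma hocolim_cell_glue F i j (ij : (i <= j)%O) (x : F i)
    (t : realization R (upset j)) :
  hocolim_cell (x, realization_incl R (upset_sub ij) t) =
  hocolim_cell (diag_map ij x, t).
Proof. by apply/hocolim_piP/rst_step; exact: HocolimGlue. Qed.

Lemma hocolim_final F : final_family (@hocolim_cell F).
Proof.
split=> [p|U oU].
  rewrite -(hocolim_reprK p); case: (hocolim_repr p) => j z.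
  by exists j, z.
by apply/sigT_openP => j; exact: oU.
Qed.

(** The real parameter makes this a statement about homotopies: for fixed [u] the family [a] is a
    natural transformation, and Whitehead's lemma permits crossing the quotient with the line. *)
Lemma hocolim_map_continuous F G (a : forall j, F j * R -> G j) :
  (forall j, continuous (a j)) ->
  (forall u i j (ij : (i <= j)%O) (x : F i),
     a j (diag_map ij x, u) = diag_map ij (a i (x, u))) ->
  continuous (fun z : hocolim R F * R =>
    hocolim_map (fun j x => a j (x, z.2)) z.1).
Proof.
move=> ca a_nat.
apply: (final_prod_continuous (@hocolim_final F) (@compact_basis_real R)) => j.
rewrite (_ : (fun _ => _) =
  fun z : (F j * realization R (upset j)) * R =>
    hocolim_cell (a j (z.1.1, z.2), z.1.2)); last first.
  apply/funext => -[[x t] u] /=.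
  by rewrite /hocolim_cell hocolim_mapE //; exact: a_nat.
apply: (continuous_compT (g := @hocolim_cell G j)); last first.
  exact: hocolim_cell_continuous.
have c11 : continuous (fun z : (F j * realization R (upset j)) * R => z.1.1).
  exact: continuous_compT (@continuous_fst _ _) (@continuous_fst _ _).
have c12 : continuous (fun z : (F j * realization R (upset j)) * R => z.1.2).
  exact: continuous_compT (@continuous_fst _ _) (@continuous_snd _ _).
apply: continuous_pair; last exact: c12.
apply: (continuous_compT (f := fun z => (z.1.1, z.2)) (g := a j));
  last exact: ca.
by apply: continuous_pair; [exact: c11|exact: continuous_snd].
Qed.

(** A continuous bijection onto a realization is a homeomorphism as soon as the
    points supported in a finite set all come from a compact set: it is then a
    closed map. *)
Lemma hocolim_realization F (d' : Order.disp_t) (P : porderType d') (Y : set P)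
    (G : forall j, F j * realization R (upset j) -> realization R Y) :
  (forall j, continuous (G j)) ->
  (forall i j (ij : (i <= j)%O) (x : F i) t,
     G i (x, realization_incl R (upset_sub ij) t) = G j (diag_map ij x, t)) ->
  (forall i j p q, G i p = G j q -> hocolim_cell p = hocolim_cell q) ->
  (forall D : seq P, exists Z : forall j, set (F j * realization R (upset j)),
     (forall j, compact (Z j)) /\
     (forall w, supported D w -> exists j z, Z j z /\ G j z = w)) ->
  homotopy_equivalent R (hocolim R F) (realization R Y).
Proof.
move=> cG Gglue Ginj Gsurj.
pose Th (p : hocolim R F) : realization R Y :=
  G (projT1 (hocolim_repr p)) (projT2 (hocolim_repr p)).
have ThE j z : Th (@hocolim_cell F j z) = G j z.
  rewrite /Th.
  have : clos_refl_sym_trans _ (@hocolim_glue R d J F)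
      (hocolim_repr (@hocolim_cell F j z)) (existT _ j z).
    by apply/hocolim_piP; rewrite hocolim_reprK.
  rewrite -[RHS]/((fun s : hocolim_pre R F => G (projT1 s) (projT2 s))
    (existT _ j z)).
  move: (hocolim_repr _) (existT _ _ _) => p q.
  elim=> {p q} [_ _ [i k ik x t]|//|p q _ ->|p q r _ -> _ ->] //=.
have cTh : continuous Th.
  apply: (final_continuous (@hocolim_final F)) => j.
  have -> : Th \o @hocolim_cell F j = G j by apply/funext => z; exact: ThE.
  exact: cG.
have surj w : exists p, Th p = w.
  have [D [_ _ _ wD]] := bary_support w.
  have [Z [_ ZG]] := Gsurj D; have [j [z [_ Gz]]] := ZG w wD.
  by exists (hocolim_cell z); rewrite ThE.
pose Xi w := projT1 (cid (surj w)).
have XiK : cancel Xi Th by move=> w; rewrite /Xi; case: cid.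
have Th_inj : injective Th.
  move=> p q; have [[i [x <-]] [j [y <-]]] := ((@hocolim_final F).1 p,
    (@hocolim_final F).1 q).
  by rewrite !ThE; exact: Ginj.
have ThK : cancel Th Xi by move=> p; apply: Th_inj; rewrite XiK.
suff cXi : continuous Xi.
  exact: (homotopy_equivalent_homeo R cTh cXi ThK XiK).
apply/continuous_closedP => E cE; apply: closed_realization => D.
have [Z [cZ ZG]] := Gsurj D.
have -> : (Xi @^-1` E) `&` supported D = \big[setU/set0]_(j : J)
    (G j @` (Z j `&` (@hocolim_cell F j @^-1` E `&` (G j @^-1` supported D)))).
  rewrite -bigcup_seq_cond; apply/seteqP; split=> w.
    move=> [/= wE wD]; have [j [z [Zz Gz]]] := ZG w wD.
    exists j; first by rewrite /= mem_index_enum.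
    exists z => //; split=> //; split; last by rewrite /= Gz.
    by rewrite /= (_ : hocolim_cell z = Xi w) // -[LHS]ThK ThE Gz.
  move=> [j _ [z [Zz [Ez Dz]] <-]]; split=> //=.
  by rewrite -ThE ThK.
apply: bigsetU_compact => j _; apply: continuous_compact.
  exact/continuous_subspaceT/cG.
apply: compact_closedI; first exact: cZ.
apply: closedI.
  by apply: closed_comp => // z _; exact: hocolim_cell_continuous.
apply: closed_comp => [z _|]; first exact: cG.
exact: supported_closed.
Qed.

Lemma realization_fin_compact_basis (Q : set J) :
  compact_basis (realization R Q).
Proof.
apply: compact_basis_hausdorff; first exact: realization_hausdorff.
rewrite (_ : setT = supported (enum J)); first exact: supported_compact.
by apply/seteqP; split=> // p _ x; rewrite mem_enum.
Qed.

Lemma realization_fin_compact (Q : set J) : compact [set: realization R Q].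
Proof.
rewrite (_ : setT = supported (enum J)); first exact: supported_compact.
by apply/seteqP; split=> // p _ x; rewrite mem_enum.
Qed.

End hocolim_theory.

(** * Functoriality and homotopy invariance of the suspension *)

Section suspension_functor.
Variables (R : realType) (n : nat).

Lemma susp_cell_fun_continuous (X Y : topologicalType) (H : X * R -> Y) b :
  continuous H -> continuous (fun z : susp_cell X b * R =>
    susp_cell_fun (fun x => H (x, z.2)) z.1).
Proof.
case: b => cH /=; last exact: continuous_fst.
by rewrite (_ : (fun _ => _) = H) //; apply/funext => -[].
Qed.

Lemma susp_map_homotopic (X Y : topologicalType) (f g : X -> Y) :
  homotopic R f g -> homotopic R (@susp_map R n X Y f) (@susp_map R n X Y g).
Proof.
move=> /homotopicP [H [cH H0 H1]]; apply/homotopicP.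
exists (fun z => @susp_map R n X Y (fun x => H (x, z.2)) z.1); split.
- apply: (@hocolim_map_continuous R _ _ (susp_diagram X n) (susp_diagram Y n)
    (fun A (z : susp_cell X (is_empty A) * R) =>
       susp_cell_fun (fun x => H (x, z.2)) z.1)) => [A|u A B AB x].
    exact: susp_cell_fun_continuous.
  exact: susp_cell_fun_natural.
- by move=> p /=; congr (susp_map _ p); apply/funext.
- by move=> p /=; congr (susp_map _ p); apply/funext.
Qed.

Lemma susp_map_id (X : topologicalType) :
  @susp_map R n X X idfun = idfun.
Proof.
apply/funext => p; rewrite -[RHS](hocolim_reprK p).
rewrite /susp_map /hocolim_map; case: (hocolim_repr p) => A [x t] /=.
congr (hocolim_pi (existT _ A (_, t))).
by move: x; rewrite /susp_diagram /=; case: (is_empty A).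
Qed.

Lemma susp_map_comp (X Y Z : topologicalType) (f : X -> Y) (g : Y -> Z) :
  @susp_map R n Y Z g \o @susp_map R n X Y f = @susp_map R n X Z (g \o f).
Proof.
apply/funext => p; rewrite -(hocolim_reprK p) /=.
rewrite /susp_map !hocolim_mapE; try exact: susp_cell_fun_natural.
case: (hocolim_repr p) => A [x t] /=.
congr (hocolim_pi (existT _ A (_, t))) => /=.
by move: x; rewrite /susp_diagram /=; case: (is_empty A).
Qed.

(** The suspension of the constant homotopy is continuous, and its restriction to the parameter 0 is
    the map in question. *)
Lemma susp_map_continuous (X Y : topologicalType) (f : X -> Y) :
  continuous f -> continuous (@susp_map R n X Y f).
Proof.
move=> /homotopic_refl - /(_ R) /susp_map_homotopic /homotopicP [H [cH H0 _]].
rewrite (_ : susp_map f = fun p => H (p, 0)); last first.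
  by apply/funext => p; rewrite H0.
apply: (continuous_compT (f := fun p => (p, 0)) (g := H)) cH.
apply: continuous_pair; last exact: continuous_cst.
by move=> x; exact: cvg_id.
Qed.

Lemma susp_map_equivalence (X Y : topologicalType) (f : X -> Y) :
  homotopy_equivalence R f -> homotopy_equivalence R (@susp_map R n X Y f).
Proof.
move=> [cf [g [cg gf fg]]]; split; first exact: susp_map_continuous.
exists (@susp_map R n Y X g); split; first exact: susp_map_continuous.
- by rewrite susp_map_comp -susp_map_id; exact: susp_map_homotopic.
- by rewrite susp_map_comp -susp_map_id; exact: susp_map_homotopic.
Qed.

Lemma susp_equivalent (X Y : topologicalType) :
  homotopy_equivalent R X Y ->
  homotopy_equivalent R (susp R n X) (susp R n Y).
Proof.
by move=> [f hf]; exists (@susp_map R n X Y f); exact: susp_map_equivalence.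
Qed.

End suspension_functor.

(** * Gluing two posets *)

Section collage.
Variables (d d' : Order.disp_t) (A : porderType d) (B : porderType d').

(** In [collage r], every element of [B] is above or incomparable to every
    element of [A], [r] telling which. *)
Record lower_rel := LowerRel {
  lrel :> A -> B -> bool;
  lrelP : forall a a' b b', (a' <= a)%O -> lrel a b -> (b <= b')%O ->
    lrel a' b' }.

Definition join_rel : lower_rel :=
  @LowerRel (fun _ _ => true) (fun _ _ _ _ _ _ _ => isT).

(** The type carries [r] so that an order depending on [r] can be attached to it. *)
Definition collage (r : lower_rel) : Type := (A + B)%type.

Section order.
Variable r : lower_rel.

HB.instance Definition _ := Choice.copy (collage r) (A + B)%type.

Definition collage_le (x y : collage r) : bool :=
  match x, y with
  | inl a, inl a' => (a <= a')%O
  | inr b, inr b' => (b <= b')%O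
  | inl a, inr b => r a b
  | inr _, inl _ => false
  end.

Fact collage_le_refl : reflexive collage_le.
Proof. by case=> ? /=. Qed.

Fact collage_le_anti : antisymmetric collage_le.
Proof.
move=> [a|b] [a'|b'] //= le; last by rewrite (le_anti le).
  by rewrite (le_anti le).
by rewrite andbF in le.
Qed.

Fact collage_le_trans : transitive collage_le.
Proof.
move=> [] y [] x [] z //=; [exact: le_trans| | |exact: le_trans].
- by move=> xy yz; exact: lrelP xy yz (lexx _).
- by move=> xy yz; exact: lrelP (lexx _) xy yz.
Qed.

Fact collage_display : Order.disp_t. Proof. exact: Order.Disp tt tt. Qed.

HB.instance Definition _ := Order.Le_isPOrder.Build collage_display
  (collage r) collage_le_refl collage_le_anti collage_le_trans.

Lemma collage_leE (x y : collage r) : (x <= y)%O = collage_le x y.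
Proof. by []. Qed.

Definition cinl (a : A) : collage r := inl a.
Definition cinr (b : B) : collage r := inr b.

Lemma cinl_inj : injective cinl. Proof. by move=> ? ? []. Qed.
Lemma cinr_inj : injective cinr. Proof. by move=> ? ? []. Qed.

End order.
End collage.

Arguments lrel : simpl never.

Lemma realization_sub (R : realType) (d : Order.disp_t) (P : porderType d)
    (Q Q' : set P) (p : realization R Q) :
  (forall x, p x != 0 -> Q' x) ->
  exists q : realization R Q', bary q = p.
Proof.
move=> pQ'; have [D [uD _ _ pD]] := bary_support p.
apply: (mk_realization uD) => //; first exact: bary_ge0.
  rewrite -(massT p) (mass_seq _ uD pD); apply: eq_bigl => x.
  by rewrite in_setT.
by move=> x y; exact: bary_chain.
Qed.

(** The least element of the support of a point of [|J|] tells from which [|J_{>= j}|] the point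
    comes; this selects a canonical cell of a homotopy colimit. *)
Lemma bary_min (R : realType) (d : Order.disp_t) (P : porderType d)
    (Q : set P) (p : realization R Q) :
  exists2 x, p x != 0 & forall y, p y != 0 -> (x <= y)%O.
Proof.
have [D [uD Dc _ pD]] := bary_support p.
pose E := [seq x <- D | p x != 0].
have inE y : p y != 0 -> y \in E.
  by move=> py; rewrite mem_filter py; apply: contraNT py => /pD ->.
have [x [xE xmin]] : exists x, x \in E /\ forall y, y \in E -> (x <= y)%O.
  have E0 : E != [::].
    apply/eqP => E0; have := massT p; rewrite (mass_seq _ (isT : uniq [::])).
      by rewrite big_nil => /esym/eqP; rewrite oner_eq0.
    by move=> x _; apply/eqP; apply: contraT => /inE; rewrite E0.
  have Ec : {in E &, forall a b, (a >=< b)%O}.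
    by move=> a b; rewrite !mem_filter => /andP[_ aD] /andP[_ bD]; exact: Dc.
  elim: E E0 Ec {inE} => // a s IHs _ Ec.
  case: s IHs Ec => [|e s] IHs Ec.
    by exists a; split=> [|z]; rewrite ?mem_head // inE => /eqP ->.
  have [//||y [ys ymin]] := IHs.
    by move=> i j si sj; apply: Ec; rewrite inE ?si ?sj orbT.
  have ay : (a >=< y)%O by apply: Ec; rewrite ?mem_head // inE ys orbT.
  have [{}ay|ya] := comparable_leP ay.
    exists a; split; first exact: mem_head.
    by move=> z; rewrite inE => /orP[/eqP -> //|/ymin]; exact: le_trans.
  exists y; split; first by rewrite inE ys orbT.
  by move=> z; rewrite inE => /orP[/eqP ->|/ymin //]; exact: ltW.
exists x; first by move: xE; rewrite mem_filter => /andP[].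
by move=> y /inE; exact: xmin.
Qed.

Lemma bary_sum_fin (R : realType) (d : Order.disp_t) (J : finPOrderType d)
    (Q : set J) (p : realization R Q) : \sum_j p j = 1.
Proof.
rewrite -(massT p) (mass_seq _ (enum_uniq J)); last first.
  by move=> x; rewrite mem_enum.
by rewrite big_enum_cond; apply: eq_bigl => j; rewrite in_setT.
Qed.

(** * Points of a collage in join coordinates *)

Section collage_realization.
Variables (R : realType) (d d' : Order.disp_t).
Variables (A : porderType d) (B : finPOrderType d') (r : lower_rel A B).
Variables (Y : set (collage r)).

Let inlD (D : seq A) : seq (collage r) :=
  map (@cinl _ _ _ _ r) D ++ map (@cinr _ _ _ _ r) (enum B).

Let inlD_uniq D : uniq D -> uniq (inlD D).
Proof.
move=> uD; rewrite cat_uniq; apply/and3P; split.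
- by rewrite map_inj_uniq //; exact: cinl_inj.
- apply/hasPn => _ /mapP[b _ ->].
  by apply/negP => /mapP[].
- by rewrite map_inj_uniq ?enum_uniq //; exact: cinr_inj.
Qed.

Let inlD_inl D q : (cinl r q \in inlD D) = (q \in D).
Proof.
rewrite mem_cat mem_map; last exact: cinl_inj.
by case: (q \in D) => //=; apply/negP => /mapP[].
Qed.

Let inlD_inr D b : cinr r b \in inlD D.
Proof. by rewrite mem_cat map_f ?orbT // mem_enum. Qed.

Let inlD_sum D (g : collage r -> R) :
  \sum_(y <- inlD D) g y = \sum_(q <- D) g (cinl r q) + \sum_b g (cinr r b).
Proof. by rewrite big_cat !big_map -enumT big_enum. Qed.

Lemma collage_total (w : realization R Y) D : uniq D ->
  (forall q, q \notin D -> w (cinl r q) = 0) ->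
  \sum_(q <- D) w (cinl r q) + \sum_b w (cinr r b) = 1.
Proof.
move=> uD wD; rewrite -(massT w) (mass_seq _ (inlD_uniq uD)).
  by rewrite -inlD_sum; apply: eq_bigl => y; rewrite in_setT.
by case=> [q|b]; [rewrite inlD_inl; exact: wD|rewrite inlD_inr].
Qed.

Lemma mk_collage (D : seq A) (g : collage r -> R) : uniq D ->
  (forall y, 0 <= g y) -> (forall q, q \notin D -> g (cinl r q) = 0) ->
  \sum_(q <- D) g (cinl r q) + \sum_b g (cinr r b) = 1 ->
  (forall y, g y != 0 -> Y y) ->
  (forall q q', g (cinl r q) != 0 -> g (cinl r q') != 0 -> (q >=< q')%O) ->
  (forall b b', g (cinr r b) != 0 -> g (cinr r b') != 0 -> (b >=< b')%O) ->
  (forall q b, g (cinl r q) != 0 -> g (cinr r b) != 0 -> r q b) ->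
  exists p : realization R Y, bary p = g.
Proof.
move=> uD g0 gD g1 gY gA gB gAB.
apply: (mk_realization (inlD_uniq uD)) => //.
- by case=> [q|b]; [rewrite inlD_inl; exact: gD|rewrite inlD_inr].
- by rewrite inlD_sum.
- case=> [q|b] [q'|b'] gx gy.
  + exact: gA.
  + by rewrite /Order.comparable [X in X || _](gAB _ _ gx gy).
  + by rewrite /Order.comparable [X in _ || X](gAB _ _ gy gx) orbT.
  + exact: gB.
Qed.

(** The pair [(x, t)] goes to the join [lam t * x + be t]. Membership and comparability are demanded
    only where the weights concerned are nonzero, so that one statement covers the cone cell of a
    suspension as well as the cylinder and the base of a cofiber. *)
Lemma join_map (Q : set A) (T : topologicalType) (lam : T -> R)
    (be : T -> B -> R) : compact_basis T ->
  continuous lam -> (forall b, continuous (be^~ b)) ->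
  (forall t, 0 <= lam t) -> (forall t b, 0 <= be t b) ->
  (forall t, lam t + \sum_b be t b = 1) ->
  (forall t q, lam t != 0 -> Q q -> Y (cinl r q)) ->
  (forall t b, be t b != 0 -> Y (cinr r b)) ->
  (forall t b b', be t b != 0 -> be t b' != 0 -> (b >=< b')%O) ->
  (forall t q b, lam t != 0 -> be t b != 0 -> Q q -> r q b) ->
  exists G : realization R Q * T -> realization R Y,
    [/\ continuous G, forall z q, G z (cinl r q) = lam z.2 * z.1 q
      & forall z b, G z (cinr r b) = be z.2 b].
Proof.
move=> cT clam cbe lam0 be0 tot YQ YB chB rQB.
pose g (z : realization R Q * T) (y : collage r) : R :=
  match y with inl q => lam z.2 * z.1 q | inr b => be z.2 b end.
have gP z : exists p : realization R Y, bary p = g z.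
  have [D [uD _ _ zD]] := bary_support z.1.
  apply: (mk_collage uD).
  - by case=> [q|b] //=; rewrite mulr_ge0 // bary_ge0.
  - by move=> q /zD /= ->; rewrite mulr0.
  - rewrite -[RHS](tot z.2) /=; congr (_ + _); rewrite -mulr_sumr.
    rewrite (_ : \sum_(q <- D) _ = 1) ?mulr1 // -(massT z.1) (mass_seq _ uD zD).
    by apply: eq_bigl => q; rewrite in_setT.
  - case=> [q|b] /=; last exact: YB.
    by rewrite mulf_eq0 negb_or => /andP[l0 /bary_in]; exact: YQ l0.
  - move=> q q' /=; rewrite !mulf_eq0 !negb_or => /andP[_ zq] /andP[_].
    exact: bary_chain.
  - by move=> b b'; exact: chB.
  - move=> q b /=; rewrite mulf_eq0 negb_or => /andP[l0 /bary_in Qq] bb.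
    exact: rQB l0 bb Qq.
pose G z := projT1 (cid (gP z)).
have GE z : bary (G z) = g z by rewrite /G; case: cid.
exists G; split=> [|z q|z b]; rewrite ?GE //.
apply: continuous_on_realization => // k c.
apply: (@continuous_realization _ _ _ _ _ _ (inlD (undup (codom c)))).
  move=> [s t] [q|b]; last by rewrite inlD_inr.
  rewrite (inlD_inl _ q) => qD; rewrite GE /=.
  by rewrite pushforward_out // mulr0.
case=> [q|b].
  rewrite (_ : (fun _ => _) = fun z : std_simplex R k * T =>
    lam z.2 * char_map c z.1 q); last by apply/funext => z; rewrite GE.
  apply: continuousMT; first exact: continuous_compT (@continuous_snd _ _) clam.
  apply: (continuous_compT (f := fst) (g := fun s => char_map c s q)).
    exact: continuous_fst.
  apply: (continuous_compT (g := fun p : realization R Q => p q)).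
    exact: char_map_continuous.
  exact: bary_continuous.
rewrite (_ : (fun _ => _) = fun z : std_simplex R k * T => be z.2 b).
  exact: (continuous_compT (f := snd) (g := be^~ b) (@continuous_snd _ _)).
by apply/funext => z; rewrite GE.
Qed.

(** The case without weight on [A], for cells over a point: their domain offers no point of a
    realization from which a join could be formed. *)
Lemma apex_map (T : topologicalType) (be : T -> B -> R) :
  (forall b, continuous (be^~ b)) -> (forall t b, 0 <= be t b) ->
  (forall t, \sum_b be t b = 1) ->
  (forall t b, be t b != 0 -> Y (cinr r b)) ->
  (forall t b b', be t b != 0 -> be t b' != 0 -> (b >=< b')%O) ->
  exists G : T -> realization R Y,
    [/\ continuous G, forall t q, G t (cinl r q) = 0
      & forall t b, G t (cinr r b) = be t b].
Proof.
move=> cbe be0 tot YB chB.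
pose g (t : T) (y : collage r) : R :=
  match y with inl q => 0 | inr b => be t b end.
have gP t : exists p : realization R Y, bary p = g t.
  apply: (@mk_collage [::]) => //=.
  - by case=> [q|b] /=; [exact: lexx|exact: be0].
  - by rewrite big_nil add0r tot.
  - by case=> [q|b] /=; [rewrite eqxx|exact: YB].
  - by move=> q q'; rewrite eqxx.
  - by move=> b b'; exact: chB.
  - by move=> q b; rewrite eqxx.
pose G t := projT1 (cid (gP t)).
have GE t : bary (G t) = g t by rewrite /G; case: cid.
exists G; split=> [|t q|t b]; rewrite ?GE //.
apply: (@continuous_realization _ _ _ _ _ _ (inlD [::])).
  by move=> t [q|b] //; [rewrite GE|rewrite inlD_inr].
case=> [q|b].
  rewrite (_ : (fun _ => _) = fun=> 0); first exact: continuous_cst.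
  by apply/funext => t; rewrite GE.
rewrite (_ : (fun _ => _) = be^~ b); first exact: cbe.
by apply/funext => t; rewrite GE.
Qed.

Definition inl_seq (D : seq (collage r)) : seq A :=
  pmap (fun y : collage r => if y is inl q then Some q else None) D.

Lemma mem_inl_seq D q : (q \in inl_seq D) = (cinl r q \in D).
Proof.
rewrite mem_pmap; apply/mapP/idP => [[[q'|b] yD //= [->]] //|qD].
by exists (cinl r q).
Qed.

Lemma collage_inr_le1 (w : realization R Y) : \sum_b w (cinr r b) <= 1.
Proof.
have [D [uD _ _ wD]] := bary_support w.
pose E := undup (inl_seq D).
rewrite -[leRHS](@collage_total w E) ?undup_uniq //.
  by rewrite lerDr sumr_ge0 // => q _; exact: bary_ge0.
by move=> q; rewrite mem_undup mem_inl_seq; exact: wD.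
Qed.

Lemma collage_inl0 (w : realization R Y) q : \sum_b w (cinr r b) = 1 ->
  w (cinl r q) = 0.
Proof.
have [D [uD _ _ wD]] := bary_support w.
pose E := undup (q :: inl_seq D).
move=> w1; have := @collage_total w E (undup_uniq _) _; rewrite w1 => /(_ _).
have wE q' : q' \notin E -> w (cinl r q') = 0.
  by rewrite mem_undup inE negb_or mem_inl_seq => /andP[_]; exact: wD.
move=> /(_ wE) /eqP; rewrite -subr_eq0 addrK => /eqP sumE.
apply: le_anti; rewrite bary_ge0 andbT -sumE (bigD1_seq q) ?undup_uniq //=.
  by rewrite lerDl sumr_ge0 // => q' _; exact: bary_ge0.
by rewrite mem_undup mem_head.
Qed.

(** The converse of [join_map]: a point not supported in [B] is a join. *)
Lemma unjoin (Q : set A) (w : realization R Y) (D : seq (collage r)) :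
  supported D w -> (forall q, w (cinl r q) != 0 -> Q q) ->
  \sum_b w (cinr r b) != 1 ->
  exists2 x : realization R Q, supported (inl_seq D) x &
    forall q, w (cinl r q) = (1 - \sum_b w (cinr r b)) * x q.
Proof.
move=> wD YQ w1.
have wE q : q \notin undup (inl_seq D) -> w (cinl r q) = 0.
  by rewrite mem_undup mem_inl_seq; exact: wD.
have tot := collage_total (undup_uniq _) wE.
have lamE :
    1 - \sum_b w (cinr r b) = \sum_(q <- undup (inl_seq D)) w (cinl r q).
  by rewrite -tot addrK.
set lam := 1 - _ in lamE *.
have lam0 : lam != 0 by rewrite subr_eq0 eq_sym.
have lam_ge0 : 0 <= lam by rewrite lamE sumr_ge0 // => q _; exact: bary_ge0.
have [||||||x xE] := @mk_realization R _ A Q (fun q => w (cinl r q) / lam)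
    (undup (inl_seq D)).
- exact: undup_uniq.
- by move=> q; rewrite divr_ge0 // bary_ge0.
- by move=> q /wE ->; rewrite mul0r.
- by rewrite -mulr_suml -lamE mulfV.
- by move=> q; rewrite mulf_eq0 negb_or => /andP[/YQ].
- move=> q q'; rewrite !mulf_eq0 !negb_or => /andP[wq _] /andP[wq' _].
  exact: (bary_chain wq wq').
exists x => [q|q]; rewrite xE.
  by rewrite -mem_undup => /wE ->; rewrite mul0r.
by rewrite mulrC divfK.
Qed.

End collage_realization.

(** * Suspensions and cofibers as realizations *)

Section suspension_realization.
Variables (R : realType) (n : nat).


Fact empty_proper : finset.set0 \proper [set: 'I_n.+1]%SET.
Proof.
by rewrite finset.proper0; apply/finset.set0Pn; exists ord0; rewrite finset.inE.
Qed.

Definition empty_set : properset n := exist _ finset.set0 empty_proper.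

Lemma is_emptyE (A : properset n) : is_empty A = (A == empty_set).
Proof. by []. Qed.

Lemma empty_set_le (A : properset n) : (empty_set <= A)%O.
Proof. exact: finset.sub0set. Qed.

Lemma le_empty_set (A : properset n) : (A <= empty_set)%O = is_empty A.
Proof. exact: finset.subset0. Qed.

Variables (d : Order.disp_t) (P : porderType d) (Q : set P).

Definition join_boundary : set (collage (join_rel P (properset n))) :=
  fun y => match y with inl q => Q q | inr A => ~~ is_empty A end.

Let X := realization R Q.
Let Y := join_boundary.
Let r := join_rel P (properset n).

(** Over a nonempty set the cell is a point; giving it weight 0 lets one formula describe all
    cells. *)
Let cell_weight b : susp_cell X b -> P -> R :=
  if b as b0 return susp_cell X b0 -> P -> R then fun x q => x q
  else fun _ _ => 0.

Let cell_weight_map b b' (h : b' ==> b) x q :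
  cell_weight (susp_cell_map h x) q = if b' then cell_weight x q else 0.
Proof. by case: b b' h x => [] [] //=; case. Qed.

Let be (A : properset n) (t : realization R (upset A)) (B : properset n) : R :=
  if is_empty B then 0 else t B.

Let be_sum A (t : realization R (upset A)) :
  t empty_set + \sum_B be t B = 1.
Proof.
rewrite -[RHS](bary_sum_fin t) [RHS](bigD1 empty_set) //=; congr (_ + _).
rewrite (bigD1 empty_set) //= /be is_emptyE eqxx add0r.
by apply: eq_bigr => B B0; rewrite is_emptyE (negbTE B0).
Qed.

Let be_ge0 A (t : realization R (upset A)) B : 0 <= be t B.
Proof. by rewrite /be; case: ifP => // _; exact: bary_ge0. Qed.

Let be_in A (t : realization R (upset A)) B : be t B != 0 -> Y (cinr r B).
Proof. by rewrite /be /Y /=; case: ifP => //; rewrite eqxx. Qed.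

Let be_chain A (t : realization R (upset A)) B B' :
  be t B != 0 -> be t B' != 0 -> (B >=< B')%O.
Proof.
rewrite /be; case: ifP => _; first by rewrite eqxx.
by case: ifP => _; [rewrite eqxx|exact: bary_chain].
Qed.

Let be_continuous A B : continuous (fun t : realization R (upset A) => be t B).
Proof.
rewrite /be; case: (is_empty B); first exact: continuous_cst.
exact: bary_continuous.
Qed.

Let empty_weight A (t : realization R (upset A)) :
  t empty_set != 0 -> is_empty A.
Proof. by move=> /bary_in; rewrite /upset /= le_empty_set. Qed.

Let cell_map (A : properset n) : exists G : susp_cell X (is_empty A) *
    realization R (upset A) -> realization R Y,
  [/\ continuous G,
      forall z q, G z (cinl r q) = z.2 empty_set * cell_weight z.1 q
    & forall z B, G z (cinr r B) = be z.2 B].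
Proof.
suff H b : b = is_empty A -> exists G : susp_cell X b *
    realization R (upset A) -> realization R Y,
  [/\ continuous G,
      forall z q, G z (cinl r q) = z.2 empty_set * cell_weight z.1 q
    & forall z B, G z (cinr r B) = be z.2 B] by exact: H.
case: b => A0.
  have [||||||||||G [cG G1 G2]] := @join_map R _ _ P _ r Y Q
    (realization R (upset A)) (fun t => t empty_set) (@be A).
  - exact: realization_fin_compact_basis.
  - exact: bary_continuous.
  - exact: be_continuous.
  - by move=> t; exact: bary_ge0.
  - exact: be_ge0.
  - exact: be_sum.
  - by move=> t q _ Qq.
  - exact: be_in.
  - exact: be_chain.
  - by [].
  - by exists G.
have t0 (t : realization R (upset A)) : t empty_set = 0.
  by apply/eqP; apply: contraT => /empty_weight; rewrite -A0.
have [|||||G [cG G1 G2]] := @apex_map R _ _ P _ r Y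
  (realization R (upset A)) (@be A).
- exact: be_continuous.
- exact: be_ge0.
- by move=> t; rewrite -[RHS](be_sum t) t0 add0r.
- exact: be_in.
- exact: be_chain.
exists (G \o snd); split=> [|z q|z B] /=.
- exact: continuous_compT (@continuous_snd _ _) cG.
- by rewrite G1 mulr0.
- exact: G2.
Qed.

Let cell_supported (D : seq P) b : set (susp_cell X b) :=
  if b as b0 return set (susp_cell X b0) then supported D else setT.

Let cell_supported_compact D b : compact (@cell_supported D b).
Proof.
case: b => /=; first exact: supported_compact.
rewrite (_ : setT = [set tt]); first exact: compact_set1.
by apply/seteqP; split=> // -[].
Qed.

(** [(x, t)], with [t] in the cone [|J|] on the sphere, goes to the join
    [t_0 x + t'] where [t_0] is the weight of the cone point and [t'] is the
    rest of [t]. *)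
Lemma susp_realization : homotopy_equivalent R (susp R n X) (realization R Y).
Proof.
pose G A := projT1 (cid (cell_map A)).
have cG A : continuous (G A) by rewrite /G; case: cid => ? [].
have G1 A z q : G A z (cinl r q) = z.2 empty_set * cell_weight z.1 q.
  by rewrite /G; case: cid => ? [].
have G2 A z B : G A z (cinr r B) = be z.2 B by rewrite /G; case: cid => ? [].
apply: (@hocolim_realization R _ (properset n) (susp_diagram X n) _ _ Y G cG)
  => [A B AB x t|A B [x t] [y u] GE|D].
- apply: realization_eq; apply/funext => -[q|C]; last by rewrite !G2.
  rewrite !G1 /= cell_weight_map.
  have [->|/empty_weight ->//] := eqVneq (t empty_set) 0.
  by rewrite !mul0r.
- have beE C : be t C = be u C.
    have := congr1 (fun w : realization R Y => w (cinr r C)) GE.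
    by rewrite !G2.
  have tu C : t C = u C.
    case: (boolP (is_empty C)) => [|C0].
      rewrite is_emptyE => /eqP ->.
      apply: (@addIr _ (\sum_C be t C)); rewrite be_sum -[LHS](be_sum u).
      by congr (_ + _); apply: eq_bigr => C' _; rewrite beE.
    by have := beE C; rewrite /be (negbTE C0).
  have [t0|t0] := eqVneq (t empty_set) 0; last first.
    have A0 := empty_weight t0.
    have B0 : is_empty B by apply: (@empty_weight _ u); rewrite -tu.
    have AE : A = empty_set by apply/eqP; rewrite -is_emptyE.
    have BE : B = empty_set by apply/eqP; rewrite -is_emptyE.
    subst A B.
    have -> : u = t by apply: realization_eq; apply/funext => C.
    congr (hocolim_cell (_, t)).
    have xy q : cell_weight x q = cell_weight y q.
      apply: (mulfI t0).
      have := congr1 (fun w : realization R Y => w (cinl r q)) GE.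
      by rewrite !G1 /= tu.
    move: x y xy {GE}; rewrite /susp_diagram /= /cell_weight A0 => x y xy.
    by apply: realization_eq; apply/funext.
  (* Without weight at the empty set, [t] comes from the cell of the least set [C] of its support,
     where the diagram has a point as value. Both classes can be moved there and agree. *)
  have [C tC Cmin] := bary_min t.
  have C0 : ~~ is_empty C.
    by apply: contraNN tC; rewrite is_emptyE => /eqP ->; apply/eqP.
  have [t' t'E] := @realization_sub R _ _ _ (upset C) t Cmin.
  have AC : (A <= C)%O by exact: (bary_in tC).
  have BC : (B <= C)%O by apply: (@bary_in _ _ _ _ u); rewrite -tu.
  have -> : t = realization_incl R (upset_sub AC) t'.
    exact/realization_eq/esym.
  have -> : u = realization_incl R (upset_sub BC) t'.
    by apply: realization_eq; rewrite /= t'E; apply/funext => ?; rewrite tu.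
  rewrite (hocolim_cell_glue AC) (hocolim_cell_glue BC).
  congr (hocolim_cell (_, t')).
  move: (diag_map _ _) (diag_map _ _); rewrite /susp_diagram /= (negbTE C0).
  by case=> [] [].
- pose E := inl_seq D.
  exists (fun A => @cell_supported E (is_empty A) `*` setT); split=> [A|w wD].
    apply: compact_setX; first exact: cell_supported_compact.
    exact: realization_fin_compact.
  have wY B : is_empty B -> w (cinr r B) = 0.
    by move=> B0; apply/eqP; apply: contraT => /bary_in; rewrite /Y /= B0.
  have w_chain B B' : w (cinr r B) != 0 -> w (cinr r B') != 0 -> (B >=< B')%O.
    by move=> wB wB'; exact: (bary_chain wB wB').
  (* The points of the sphere [|J_n|] come from the cell of the least set of their support. All
     others come from the cell of the empty set, which receives the total weight on [Q]. *)
  have [s1|s1] := eqVneq (\sum_B w (cinr r B)) 1.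
  + pose g B := w (cinr r B).
    have [||||||t0 t0E] := @mk_realization R _ _ (setT : set (properset n)) g
      (enum {: properset n}).
    * exact: enum_uniq.
    * by move=> B; exact: bary_ge0.
    * by move=> B; rewrite mem_enum.
    * by rewrite big_enum.
    * by [].
    * exact: w_chain.
    have [A t0A Amin] := bary_min t0.
    have A0 : ~~ is_empty A.
      by apply: contraNN t0A => /wY wA; rewrite t0E /g wA.
    have [t tE] := @realization_sub R _ _ _ (upset A) t0 Amin.
    have [x xE] : exists x : susp_cell X (is_empty A), @cell_supported E _ x.
      by rewrite (negbTE A0); exists tt.
    exists A, (x, t); split=> //; apply: realization_eq; apply/funext => -[q|B].
      have t00 : t empty_set = 0 by rewrite tE t0E /g wY // is_emptyE eqxx.
      by rewrite G1 /= t00 mul0r collage_inl0.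
    rewrite G2 /= /be tE t0E /g; case: ifP => // /wY ->//.
  + have [|x xE xw] := @unjoin R _ _ P _ r Y Q w D wD _ s1.
      by move=> q /bary_in.
    pose g B :=
      if B == empty_set then 1 - \sum_B w (cinr r B) else w (cinr r B).
    have [||||||t tE] := @mk_realization R _ _ (upset empty_set) g
      (enum {: properset n}).
    * exact: enum_uniq.
    * move=> B; rewrite /g; case: eqP => _; last exact: bary_ge0.
      by rewrite subr_ge0 collage_inr_le1.
    * by move=> B; rewrite mem_enum.
    * rewrite big_enum (bigD1 empty_set) //= {1}/g eqxx.
      rewrite [X in _ - X](bigD1 empty_set) //= wY ?is_emptyE // add0r.
      rewrite -[RHS](subrK (\sum_(B | B != empty_set) w (cinr r B))).
      by congr (_ + _); apply: eq_bigr => B /negbTE B0; rewrite /g B0.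
    * by move=> B _; exact: empty_set_le.
    * move=> B B'; rewrite /g; case: (eqVneq B empty_set) => [-> _ _|_].
        by rewrite /Order.comparable empty_set_le.
      case: (eqVneq B' empty_set) => [-> _ _|_]; last exact: w_chain.
      by rewrite /Order.comparable empty_set_le orbT.
    have [z [zE zx]] : exists z : susp_cell X (is_empty empty_set),
        @cell_supported E _ z /\ cell_weight z = x.
      by rewrite is_emptyE eqxx; exists x.
    exists empty_set, (z, t); split=> //; apply: realization_eq.
    apply/funext => -[q|B]; first by rewrite G1 /= zx tE /g eqxx xw.
    rewrite G2 /= /be tE /g is_emptyE; case: eqP => // ->.
    by rewrite wY // is_emptyE.
Qed.

End suspension_realization.

(** * The cofiber as a poset with an added apex *)

Section cofiber_realization.
Variables (R : realType) (d d' : Order.disp_t).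
Variables (P : porderType d) (B : finPOrderType d') (r : lower_rel P B).
Variables (b0 : B) (A : set P).
Hypothesis rA : forall a, r a b0 <-> A a.

(** [B] may be larger than the apex [b0], since the result is applied inside a collage that has a
    further element on top. *)
Definition cone_set : set (collage r) :=
  fun y => match y with inl _ => True | inr b => b = b0 end.

Let Y := cone_set.
Let F := span_diagram (@to_point_continuous (realization R A))
  (realization_incl_continuous R (@subsetT _ A)).
Let T (j : span_shape) := realization R (upset j).

Let sN : span_shape := None.
Let sT : span_shape := Some true.
Let sF : span_shape := Some false.

Let span_sum (Q : set span_shape) (t : realization R Q) :
  t sN + t sT + t sF = 1.
Proof.
rewrite -(massT t) (mass_seq _ (isT : uniq [:: sN; sT; sF])); last first.
  by case=> [[]|].
by rewrite !big_cons big_nil !in_setT addr0 addrA.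
Qed.

Let span_point (Q : set span_shape) (a b c : R) : 0 <= a -> 0 <= b -> 0 <= c ->
  a + b + c = 1 -> b = 0 \/ c = 0 -> (a != 0 -> Q sN) -> (b != 0 -> Q sT) ->
  (c != 0 -> Q sF) ->
  exists t : realization R Q, [/\ t sN = a, t sT = b & t sF = c].
Proof.
move=> a0 b_ge0 c0 abc bc Qa Qb Qc.
pose g (j : span_shape) : R :=
  match j with None => a | Some true => b | Some false => c end.
have [||||||t tE] := @mk_realization R _ _ Q g [:: sN; sT; sF].
- by [].
- by case=> [[]|].
- by case=> [[]|].
- by rewrite !big_cons big_nil addr0 addrA.
- by case=> [[]|].
- case=> [[]|] [[]|] //=; try by rewrite /Order.comparable /Order.le /=.
    by case: bc => ->; rewrite eqxx.
  by case: bc => ->; rewrite eqxx.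
by exists t; rewrite tE.
Qed.

Let span_excl (Q : set span_shape) (t : realization R Q) : t sT = 0 \/ t sF = 0.
Proof.
have [|tT] := eqVneq (t sT) 0; first by left.
have [|tF] := eqVneq (t sF) 0; first by right.
by have := bary_chain tT tF.
Qed.

Let legT (t : T sT) : [/\ t sN = 0, t sT = 1 & t sF = 0].
Proof.
have tN : t sN = 0 by apply/eqP; apply: contraT => /bary_in.
have tF : t sF = 0 by apply/eqP; apply: contraT => /bary_in.
by have := span_sum t; rewrite tN tF add0r addr0.
Qed.

Let legF (t : T sF) : [/\ t sN = 0, t sT = 0 & t sF = 1].
Proof.
have tN : t sN = 0 by apply/eqP; apply: contraT => /bary_in.
have tT : t sT = 0 by apply/eqP; apply: contraT => /bary_in.
by have := span_sum t; rewrite tN tT !add0r.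
Qed.

Let span_eq (Q : set span_shape) (t u : realization R Q) :
  t sN = u sN -> t sT = u sT -> t sF = u sF -> t = u.
Proof. by move=> ? ? ?; apply: realization_eq; apply/funext => -[[]|]. Qed.

(** The interval [|J_{>= None}|], whose ends are [sT] and [sF] and whose middle
    is [sN], is parametrized by the height above the end [sF]. *)
Let height (Q : set span_shape) (t : realization R Q) : R := t sT + t sN / 2.

Let height_ge0 Q (t : realization R Q) : 0 <= height t.
Proof. by rewrite addr_ge0 ?divr_ge0 ?bary_ge0. Qed.

Let height_le1 Q (t : realization R Q) : height t <= 1.
Proof.
rewrite /height; have := span_sum t; have := bary_ge0 t sN.
have := bary_ge0 t sF; lra.
Qed.

Let height_inj Q (t u : realization R Q) : height t = height u -> t = u.
Proof.
rewrite /height => h; have := span_sum t; have := span_sum u.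
have := bary_ge0 t sN; have := bary_ge0 t sF; have := bary_ge0 t sT.
have := bary_ge0 u sN; have := bary_ge0 u sF; have := bary_ge0 u sT.
by case: (span_excl t) => ?; case: (span_excl u) => ? *; apply: span_eq; lra.
Qed.

Let height_continuous Q : continuous (fun t : realization R Q => height t).
Proof.
apply: continuousDT; first exact: bary_continuous.
by apply: continuousMT; [exact: bary_continuous|exact: continuous_cst].
Qed.

Let be (s : R) (b : B) : R := if b == b0 then s else 0.

Let be_sum s : \sum_b be s b = s.
Proof.
rewrite (bigD1 b0) //= /be eqxx big1 ?addr0 // => b bb0.
by rewrite (negbTE bb0).
Qed.

Let be_in s b : be s b != 0 -> Y (cinr r b).
Proof. by rewrite /be /Y /=; case: (eqVneq b b0) => // _; rewrite eqxx. Qed.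

Let be_chain s b b' : be s b != 0 -> be s b' != 0 -> (b >=< b')%O.
Proof.
rewrite /be; case: (eqVneq b b0) => [->|_]; last by rewrite eqxx.
case: (eqVneq b' b0) => [->|_] _; last by rewrite eqxx.
by move=> _; rewrite comparablexx.
Qed.

Let cell_weight (j : span_shape) : F j -> P -> R :=
  match j return F j -> P -> R with
  | None => fun a => a
  | Some true => fun _ _ => 0
  | Some false => fun p => p
  end.

(** At height [s] the cell goes to [(1 - s) x + s b0]: height 0 is the base [|P|], height 1 is the
    point, and the cylinder over [|A|] runs between them. *)
Let cell_map (j : span_shape) : exists G : F j * T j -> realization R Y,
  [/\ continuous G,
      forall z q, G z (cinl r q) = (1 - height z.2) * cell_weight z.1 q
    & forall z b, G z (cinr r b) = be (height z.2) b].
Proof.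
have cbe b : continuous (fun t : T j => be (height t) b).
  rewrite /be; case: (b == b0); first exact: height_continuous.
  exact: continuous_cst.
have clam : continuous (fun t : T j => 1 - height t).
  by apply: continuousBT; [exact: continuous_cst|exact: height_continuous].
have be_ge0 (t : T j) b : 0 <= be (height t) b.
  by rewrite /be; case: eqP => // _; exact: height_ge0.
have tot (t : T j) : 1 - height t + \sum_b be (height t) b = 1.
  by rewrite be_sum subrK.
have lam0 (t : T j) : 0 <= 1 - height t by rewrite subr_ge0 height_le1.
case: j cbe clam be_ge0 tot lam0 => [[]|] cbe clam be_ge0 tot lam0.
- have hT (t : T sT) : height t = 1.
    by have [tN tT _] := legT t; rewrite /height tN tT mul0r addr0.
  have [|||||G [cG G1 G2]] := @apex_map R _ _ P _ r Y (T sT)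
    (fun t => be (height t)).
  + exact: cbe.
  + exact: be_ge0.
  + by move=> t; rewrite be_sum hT.
  + by move=> t b; exact: be_in.
  + by move=> t b b'; exact: be_chain.
  exists (G \o snd); split=> [|z q|z b] /=.
  + exact: continuous_compT (@continuous_snd _ _) cG.
  + by rewrite G1 mulr0.
  + exact: G2.
- have hF (t : T sF) : height t = 0.
    by have [tN tT _] := legF t; rewrite /height tN tT mul0r addr0.
  have [||||||||||G [cG G1 G2]] := @join_map R _ _ P _ r Y setT (T sF)
    (fun t => 1 - height t) (fun t => be (height t)); try by [].
  + exact: realization_fin_compact_basis.
  + by move=> t b; exact: be_in.
  + by move=> t b b'; exact: be_chain.
  + by move=> t q b _; rewrite hF /be if_same eqxx.
  by exists G.
- have [||||||||||G [cG G1 G2]] := @join_map R _ _ P _ r Y A (T sN)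
    (fun t => 1 - height t) (fun t => be (height t)); try by [].
  + exact: realization_fin_compact_basis.
  + by move=> t b; exact: be_in.
  + by move=> t b b'; exact: be_chain.
  + move=> t q b _; rewrite /be; case: (eqVneq b b0) => [-> _ /rA //|_].
    by rewrite eqxx.
  by exists G.
Qed.

Lemma cofiber_realization : homotopy_equivalent R
  (cofiber R (realization_incl_continuous R (@subsetT _ A)))
  (realization R Y).
Proof.
pose G j := projT1 (cid (cell_map j)).
have cG j : continuous (G j) by rewrite /G; case: cid => ? [].
have G1 j z q : G j z (cinl r q) = (1 - height z.2) * cell_weight z.1 q.
  by rewrite /G; case: cid => ? [].
have G2 j z b : G j z (cinr r b) = be (height z.2) b.
  by rewrite /G; case: cid => ? [].
have Gb0 j z : G j z (cinr r b0) = height z.2 by rewrite G2 /be eqxx.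
have Gglue i j (ij : (i <= j)%O) (x : F i) (t : T j) :
    G i (x, realization_incl R (upset_sub ij) t) = G j (diag_map ij x, t).
  apply: realization_eq; apply/funext => -[q|b]; last by rewrite !G2.
  rewrite !G1 /= -/(height t).
  case: i j ij x t => [[]|] [[]|] //= ij x t.
  have [tN tT _] := legT t.
  by rewrite mulr0 /height /= tN tT mul0r addr0 subrr mul0r.
pose cell j (z : F j * T j) := @hocolim_cell R _ _ F j z.
(* Every class has a normal form in the open cylinder, at the point or in the base. The height is
   the weight of [b0], hence determined by the image, so points with equal images fall under the
   same case. *)
have canon j (z : F j * T j) : exists k (z' : F k * T k),
    [/\ cell j z = cell k z', G j z = G k z' &
        [\/ [/\ k = sN, height z'.2 != 0 & height z'.2 != 1],
            k = sT /\ height z'.2 = 1 | k = sF /\ height z'.2 = 0]].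
  case: j z => [[]|] [x t].
  - exists sT, (x, t); split=> //; constructor 2; split=> //=.
    by have [tN tT _] := legT t; rewrite /height tN tT mul0r addr0.
  - exists sF, (x, t); split=> //; constructor 3; split=> //=.
    by have [tN tT _] := legF t; rewrite /height tN tT mul0r addr0.
  have [h0|h0] := eqVneq (height t) 0.
    have [||||||||t' [t'N t'T t'F]] :=
      @span_point (upset sF) 0 0 1; rewrite ?eqxx ?ler01 ?addr0 ?add0r //.
      by left.
    have ij : (sN <= sF)%O by [].
    exists sF, (@diag_map _ _ F _ _ ij x, t').
    have tE : t = realization_incl R (upset_sub ij) t'.
      by apply: height_inj; rewrite h0 /height /= t'T t'N mul0r addr0.
    rewrite {1 2}tE /cell hocolim_cell_glue Gglue; split=> //.
    by constructor 3; split=> //=; rewrite /height t'N t'T mul0r addr0.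
  have [h1|h1] := eqVneq (height t) 1.
    have [||||||||t' [t'N t'T t'F]] :=
      @span_point (upset sT) 0 1 0; rewrite ?eqxx ?ler01 ?addr0 ?add0r //.
      by right.
    have ij : (sN <= sT)%O by [].
    exists sT, (@diag_map _ _ F _ _ ij x, t').
    have tE : t = realization_incl R (upset_sub ij) t'.
      by apply: height_inj; rewrite h1 /height /= t'T t'N mul0r addr0.
    rewrite {1 2}tE /cell hocolim_cell_glue Gglue; split=> //.
    by constructor 2; split=> //=; rewrite /height t'N t'T mul0r addr0.
  by exists sN, (x, t); split=> //; constructor 1.
apply: (@hocolim_realization R _ _ F _ _ Y G cG Gglue) => [i j p q Gpq|D].
- rewrite -/(cell i p) -/(cell j q).
  have [k [p' [-> pE pk]]] := canon i p; have [l [q' [-> qE ql]]] := canon j q.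
  have {}Gpq : G k p' = G l q' by rewrite -pE -qE.
  have hE : height p'.2 = height q'.2.
    by rewrite -(Gb0 k) -(Gb0 l) Gpq.
  have inlE x : (1 - height p'.2) * cell_weight p'.1 x =
      (1 - height p'.2) * cell_weight q'.1 x.
    have := congr1 (fun w : realization R Y => w (cinl r x)) Gpq.
    by rewrite !G1 -hE.
  rewrite -hE in ql.
  case: pk => [[kE h0 h1]|[kE h]|[kE h]].
  + case: ql => [[lE _ _]|[_ h']|[_ h']].
    * subst k l.
      case: p' q' hE inlE {pE qE Gpq h0} h1 => [x t] [y u] /= hE inlE h1.
      have <- : t = u by exact: height_inj.
      congr (cell sN (_, t)); apply: realization_eq; apply/funext => a.
      by apply: (mulfI _ (inlE a)); rewrite subr_eq0 eq_sym.
    * by rewrite h' eqxx in h1.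
    * by rewrite h' eqxx in h0.
  + case: ql => [[_ _ h']|[lE _]|[_ h']].
    * by rewrite h eqxx in h'.
    * subst k l; case: p' q' hE {inlE pE qE Gpq h} => [x t] [y u] /= hE.
      by have <- : t = u; [exact: height_inj|case: x y => [] []].
    * by move/eqP: h; rewrite h' eq_sym oner_eq0.
  + case: ql => [[_ h' _]|[_ h']|[lE _]].
    * by rewrite h eqxx in h'.
    * by move/eqP: h; rewrite h' oner_eq0.
    * subst k l; case: p' q' hE inlE {pE qE Gpq} h => [x t] [y u] /= hE inlE h.
      have <- : t = u by exact: height_inj.
      congr (cell sF (_, t)); apply: realization_eq; apply/funext => a.
      by have := inlE a; rewrite h subr0 !mul1r.
- pose E := inl_seq D.
  exists (fun j : span_shape => match j return set (F j * T j) with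
    | None => supported E `*` setT
    | Some true => setT
    | Some false => supported E `*` setT end); split=> [|w wD].
    case=> [[]|].
    + rewrite -setXTT; apply: compact_setX; last exact: realization_fin_compact.
      rewrite (_ : setT = [set tt]); first exact: compact_set1.
      by apply/seteqP; split=> // -[].
    + apply: compact_setX; first exact: supported_compact.
      exact: realization_fin_compact.
    + apply: compact_setX; first exact: supported_compact.
      exact: realization_fin_compact.
  have wY b : b != b0 -> w (cinr r b) = 0.
    move=> bb0; apply/eqP; apply: contraT => /bary_in.
    by rewrite /Y /= => bE; rewrite bE eqxx in bb0.
  have sumw : \sum_b w (cinr r b) = w (cinr r b0).
    by rewrite (bigD1 b0) //= big1 ?addr0 // => b; exact: wY.
  have inr_be b : w (cinr r b) = be (w (cinr r b0)) b.
    by rewrite /be; case: (eqVneq b b0) => [->|/wY].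
  set s := w (cinr r b0) in sumw inr_be.
  have s0 : 0 <= s by exact: bary_ge0.
  have s1 : s <= 1 by rewrite -sumw collage_inr_le1.
  have [s_eq1|s_neq1] := eqVneq s 1.
    have [||||||||t [tN tT tF]] :=
      @span_point (upset sT) 0 1 0; rewrite ?eqxx ?ler01 ?addr0 ?add0r //.
      by right.
    exists sT, (tt, t); split=> //.
    apply: realization_eq; apply/funext => -[q|b].
      by rewrite G1 /= mulr0 collage_inl0 // sumw.
    by rewrite G2 inr_be s_eq1 /= /height tN tT mul0r addr0.
  have sw1 : \sum_b w (cinr r b) != 1 by rewrite sumw.
  have [s_eq0|s_neq0] := eqVneq s 0.
    have [//|x xE xw] := @unjoin R _ _ P _ r Y setT w D wD _ sw1.
    have [||||||||t [tN tT tF]] :=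
      @span_point (upset sF) 0 0 1; rewrite ?eqxx ?ler01 ?addr0 ?add0r //.
      by left.
    exists sF, (x, t); split=> //.
    apply: realization_eq; apply/funext => -[q|b].
      by rewrite G1 xw sumw s_eq0 /= /height tN tT mul0r addr0.
    by rewrite G2 inr_be s_eq0 /= /height tN tT mul0r addr0.
  have wA q : w (cinl r q) != 0 -> A q.
    move=> wq; apply/rA; have := bary_chain wq s_neq0.
    by rewrite /Order.comparable => /orP[].
  have [x xE xw] := @unjoin R _ _ P _ r Y A w D wD wA sw1.
  (* Inverting the height: up to [1 / 2] the weights lie on [sF] and [sN], beyond it on [sN] and
     [sT]. *)
  have [t tE] : exists t : T sN, height t = s.
    case: (lerP s (1 / 2)) => s2.
      have [||||||||t [tN tT tF]] :=
        @span_point (upset sN) (2 * s) 0 (1 - 2 * s);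
        try (by []); try lra.
      by exists t; rewrite /height tN tT; lra.
    have [||||||||t [tN tT tF]] :=
      @span_point (upset sN) (2 - 2 * s) (2 * s - 1) 0;
      try (by []); try lra.
    by exists t; rewrite /height tN tT; lra.
  exists sN, (x, t); split=> //; apply: realization_eq; apply/funext => -[q|b].
    by rewrite G1 xw sumw /= tE.
  by rewrite G2 inr_be /= tE.
Qed.


End cofiber_realization.

(** * The link and the cofiber *)

Section collage_summand.
Variables (R : realType) (d d' : Order.disp_t).
Variables (A : porderType d) (B : porderType d') (r : lower_rel A B).

(** [a0] is the default value of the retraction on the elements of [B], which lie outside the
    subposet. *)
Lemma collage_inl_equivalent (Q : set A) (a0 : A) :
  homotopy_equivalent R (realization R Q)
    (realization R [set y : collage r | if y is inl a then Q a else False]).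
Proof.
apply: (@poset_equivalence R _ _ A (collage r) _ _ (@cinl _ _ _ _ r)
  (fun y : collage r => if y is inl a then a else a0)).
- by split.
- by split=> [[]|[a|b] [a'|b']].
- by [].
- by case.
Qed.

End collage_summand.

(** * The two-element poset [J_1] *)

Section two_points.

Fact point0_proper : [set ord0]%SET \proper [set: 'I_2]%SET.
Proof.
apply/properP; split; first exact: finset.subsetT.
by exists ord_max; rewrite ?finset.inE.
Qed.

Fact point1_proper : [set ord_max]%SET \proper [set: 'I_2]%SET.
Proof.
apply/properP; split; first exact: finset.subsetT.
by exists ord0; rewrite ?finset.inE.
Qed.

Definition point0 : properset 1 := exist _ [set ord0]%SET point0_proper.
Definition point1 : properset 1 := exist _ [set ord_max]%SET point1_proper.

Lemma pointP (T : properset 1) : ~~ is_empty T -> T = point0 \/ T = point1.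
Proof.
case: T => T TP; rewrite /is_empty /= => T0.
have ord2 (i : 'I_2) : i = ord0 \/ i = ord_max.
  by case: i => [[|[|m]] im] //; [left|right]; exact: val_inj.
have [i0T|i0T] := boolP (ord0 \in T); [left|right]; apply: val_inj => /=;
    apply/finset.setP => i; rewrite finset.inE.
  case: (ord2 i) => ->; first by rewrite i0T.
  apply/negP => i1T; move: TP; rewrite finset.properEneq => /andP[/eqP[]].
  by apply/finset.setP => j; rewrite finset.inE; case: (ord2 j) => ->.
case: (ord2 i) => ->; first by rewrite (negbTE i0T).
rewrite eqxx; have /finset.set0Pn[j jT] := T0.
by case: (ord2 j) jT => -> //; rewrite (negbTE i0T).
Qed.

Lemma le_point01 : (point0 <= point1)%O = false.
Proof.
by apply/negP => /fintype.subsetP/(_ ord0); rewrite !finset.inE => /(_ isT).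
Qed.

Lemma le_point10 : (point1 <= point0)%O = false.
Proof.
by apply/negP => /fintype.subsetP/(_ ord_max); rewrite !finset.inE => /(_ isT).
Qed.

Lemma point0_neq0 : ~~ is_empty point0.
Proof. by apply/finset.set0Pn; exists ord0; rewrite finset.inE. Qed.

Lemma point1_neq0 : ~~ is_empty point1.
Proof. by apply/finset.set0Pn; exists ord_max; rewrite finset.inE. Qed.

Lemma point1_neq_point0 : (point1 == point0) = false.
Proof. by apply/negP => /eqP e; have := le_point10; rewrite e lexx. Qed.

End two_points.

Section link.
Variables (R : realType) (V : choiceType) (K : simplicial_complex V).
Variable sigma : simplex K.
Implicit Types s t : simplex K.

Definition star s : bool := ((s `|` sigma)%fset \in faces K).

Definition to_simplex (e : {fset V}) : simplex K := insubd sigma e.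

Lemma to_simplexK e : e \in faces K -> vertices (to_simplex e) = e.
Proof. by move=> eK; rewrite /to_simplex; apply: insubdK. Qed.

Lemma simplex_neq0 s : vertices s != fset0.
Proof. by case: s => e eK /=; apply: (@faces_nonempty _ K); exact: set_mem. Qed.

Lemma faces_sub (e e' : {fset V}) : e \in faces K -> (e' `<=` e)%fset ->
  e' != fset0 -> e' \in faces K.
Proof.
by move=> /set_mem eK e'e e'0; apply/mem_set; exact: faces_down eK e'e e'0.
Qed.

Lemma fsetU_neq0l (e e' : {fset V}) : e != fset0 -> (e `|` e')%fset != fset0.
Proof.
by move=> /fset0Pn[x xe]; apply/fset0Pn; exists x; rewrite inE xe.
Qed.

Lemma simplex_le s t : (s <= t)%O = (vertices s `<=` vertices t)%fset.
Proof. by []. Qed.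

Lemma star_le s t : (s <= t)%O -> star t -> star s.
Proof.
move=> st /faces_sub; apply; first exact: fsetUSS.
exact/fsetU_neq0l/simplex_neq0.
Qed.

Lemma star_upset s : (sigma <= s)%O -> star s.
Proof. by move=> /fsetUidPl; rewrite /star => ->; case: (s). Qed.

(** A simplex lies below one containing [sigma] exactly when its union with [sigma] is a face, so
    this downward closure is the closed star of [sigma]. *)
Lemma down_closureE : down_closure (upset sigma) = [set s | star s].
Proof.
apply/seteqP; split=> s.
  apply; split=> [x y /= xs yx|x]; first exact: star_le xs.
  exact: star_upset.
move=> /= ss C [Cdown Cup]; apply: (Cdown (to_simplex (s `|` sigma)%fset)).
  by apply: Cup; rewrite /upset /= simplex_le to_simplexK ?fsubsetUr.
by rewrite simplex_le to_simplexK // fsubsetUl.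
Qed.

Lemma linkE s : link sigma s <-> star s /\ ~~ (sigma <= s)%O.
Proof.
rewrite /link down_closureE; split=> -[? ns]; split=> //; exact/negP.
Qed.

Section cone.

(** The simplices not above [sigma] and the star together cover [P] and meet in the link. On the
    link both clauses hold, so that its ordinal sum with [J_1] is a subposet. *)
Let cone_rel_fun s (T : properset 1) : bool :=
  ((ord0 \in val T) && ~~ (sigma <= s)%O) || ((ord_max \in val T) && star s).

Fact cone_rel_lower s s' T T' : (s' <= s)%O -> cone_rel_fun s T ->
  (T <= T')%O -> cone_rel_fun s' T'.
Proof.
move=> ss /orP[/andP[T0 ns]|/andP[T1 st]] /fintype.subsetP TT'; apply/orP.
  left; rewrite TT' //=; apply: contraNN ns => /le_trans; exact.
by right; rewrite TT' //=; exact: star_le st.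
Qed.

Definition cone_rel := LowerRel cone_rel_lower.

Lemma cone_rel0 s : cone_rel s point0 = ~~ (sigma <= s)%O.
Proof. by rewrite /lrel /= /cone_rel_fun /= !finset.inE /= orbF. Qed.

Lemma cone_rel1 s : cone_rel s point1 = star s.
Proof. by rewrite /lrel /= /cone_rel_fun /= !finset.inE. Qed.

Let X : set (collage cone_rel) :=
  fun y => if y is inr T then ~~ is_empty T else True.

Let L := join_rel (simplex K) (properset 1).

Let to_cone (y : collage L) : collage cone_rel := y.

(** Simplices off the star move up to [point0], those above [sigma] up to [point1], and the link
    stays. The order is preserved because the complement of the star and the upset of [sigma] are
    both closed upwards. *)
Let of_cone (y : collage cone_rel) : collage L :=
  match y with
  | inl s => if ~~ star s then inr point0
             else if (sigma <= s)%O then inr point1 else inl s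
  | inr T => inr T
  end.

(** In [X] the element [point0] is the apex of the cofiber, and [point1] is an
    added cone point over the star, which is conical through
    [s <= s U sigma >= sigma]. *)
Lemma susp_link_cofiber : homotopy_equivalent R
  (susp R 1 (realization R (link sigma))) (stratified_link R sigma).
Proof.
apply: homotopy_equivalent_trans (susp_realization R 1 (link sigma)) _.
apply: (@homotopy_equivalent_trans R _ (realization R X)).
  apply: (@poset_equivalence R _ _ _ _ _ _ to_cone of_cone).
  - split=> [[s|T] //|[s|T] [t|U] //].
    move=> /= /linkE[st ns] U0 _; rewrite collage_leE /=.
    by case: (pointP U0) => ->; rewrite ?cone_rel0 ?cone_rel1.
  - split=> [[s|T] //= _|].
      case: ifPn => [_|/negPn st]; first exact: point0_neq0.
      case: ifPn => [_|ns]; first exact: point1_neq0.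
      exact/linkE.
    move=> [s|T] [t|U] Xs Xt; rewrite !collage_leE //= => st.
    + case: (boolP (star s)) => /= ss; last first.
        have -> : star t = false; last by rewrite /= lexx.
        by apply/negbTE; apply: contraNN ss; exact: star_le st.
      case: ifPn => sgs; last by do ?[case: ifP => // _].
      have sgt := le_trans sgs st.
      by rewrite (star_upset sgt) sgt /= lexx.
    + case: (pointP Xt) st => ->; rewrite ?cone_rel0 ?cone_rel1 => st.
        by rewrite (negbTE st); case: (star s); rewrite /= ?lexx.
      by rewrite st /=; case: ifP; rewrite /= ?lexx.
  - case=> [s|T] //= /linkE[st ns]; rewrite collage_leE /= st /=.
    by rewrite (negbTE ns) /=.
  - case=> [s|T] // _; rewrite collage_leE /to_cone /=.
    case: ifPn => [ns|/negPn st].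
      by rewrite cone_rel0; apply: contraNN ns; exact: star_upset.
    by case: ifPn => [_|_] /=; [rewrite cone_rel1|].
have X_cone : X `\ inr point1 = cone_set (r := cone_rel) point0.
  apply/seteqP; split=> [[s|T] //= [XT T1]|[s|T] //= ->].
    by case: (pointP XT) T1 => // ->.
  split=> [|T01]; first exact: point0_neq0.
  have /eqP := le_point01; rewrite (_ : point0 = point1) ?lexx //.
  by case: T01 => e; apply: val_inj.
have rA s : cone_rel s point0 <-> ([set: simplex K] `\` upset sigma) s.
  by rewrite cone_rel0; split=> [/negP|[_ /negP]].
apply: homotopy_equivalent_trans _
  (homotopy_equivalent_sym (cofiber_realization R rA)).
rewrite -X_cone.
have below y : X y -> (y < inr point1)%O -> exists2 s, y = inl s & star s.
  case: y => [s|T] XT; rewrite lt_neqAle => /andP[T1]; rewrite collage_leE /=.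
    by rewrite cone_rel1 => st; exists s.
  by move: T1; case: (pointP XT) => ->; rewrite ?eqxx // le_point01.
have cone_lt s : star s -> (inl s < inr point1 :> collage cone_rel)%O.
  by move=> st; rewrite lt_neqAle collage_leE /= cone_rel1.
have joinE s : star s ->
    vertices (to_simplex (s `|` sigma)%fset) = (s `|` sigma)%fset.
  exact: to_simplexK.
apply: (@removal_homotopy R _ _ X (inr point1)
  (fun y => if y is inl s then inl (to_simplex (s `|` sigma)%fset) else y)
  (inl sigma)) => //.
- move=> y Xy /(below _ Xy)[s -> st]; split=> //; apply: cone_lt.
  by apply: star_upset; rewrite simplex_le joinE // fsubsetUr.
- move=> y z Xy Xz /(below _ Xz)[t -> tt].
  case: y Xy => [s|T] // _; rewrite collage_leE /= => st.
  by rewrite collage_leE /= simplex_le !joinE ?(star_le st) // fsetSU.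
- move=> y Xy /(below _ Xy)[s -> st].
  by rewrite collage_leE /= simplex_le joinE // fsubsetUl.
- move=> y Xy /(below _ Xy)[s -> st].
  by rewrite collage_leE /= simplex_le joinE // fsubsetUr.
- by apply: cone_lt; apply: star_upset.
Qed.

End cone.
End link.

(** * The double suspension *)

Section double_suspension.
Variables (R : realType) (n : nat) (d : Order.disp_t) (P : porderType d).
Variable (Q : set P).

Let J := properset n.+1.
Let top : 'I_n.+2 := ord_max.

Fact facet_proper : [set~ top]%SET \proper [set: 'I_n.+2]%SET.
Proof.
apply/properP; split; first exact: finset.subsetT.
by exists top; rewrite ?finset.inE ?eqxx.
Qed.

Definition facet : properset n.+1 := exist _ [set~ top]%SET facet_proper.

Fact apex_proper : [set top]%SET \proper [set: 'I_n.+2]%SET.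
Proof.
apply/properP; split; first exact: finset.subsetT.
by exists ord0; rewrite ?finset.inE.
Qed.

Definition apex : properset n.+1 := exist _ [set top]%SET apex_proper.

Lemma facet_le (B : properset n.+1) :
  (facet <= B)%O -> top \notin val B /\ B = facet.
Proof.
move=> /fintype.subsetP fB.
have fB' i : i != top -> i \in val B.
  by move=> it; apply: fB; rewrite !finset.inE.
have topB : top \notin val B.
  apply/negP => tB; have := valP B; rewrite finset.properT => /eqP[].
  apply/finset.setP => i; rewrite finset.inE.
  by case: (eqVneq i top) => [->|/fB'].
split=> //; apply: val_inj; apply/finset.setP => i; rewrite !finset.inE /=.
by case: (eqVneq i top) => [->|/fB' ->]; rewrite ?(negbTE topB).
Qed.

Lemma le_facet (B : properset n.+1) : (B <= facet)%O = (top \notin val B).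
Proof.
apply/fintype.subsetP/idP => [Bf|tB i iB].
  by apply/negP => /Bf; rewrite !finset.inE eqxx.
by rewrite !finset.inE; apply: contraNneq tB => <-.
Qed.

(** The union is again proper unless [B] contains the facet, that is, for all [B] below the added
    element; [apex] is the default value otherwise. *)
Definition apex_join (B : properset n.+1) : properset n.+1 :=
  insubd apex (top |: val B)%SET.

Lemma apex_joinE (B : properset n.+1) : ~~ (facet <= B)%O ->
  val (apex_join B) = (top |: val B)%SET.
Proof.
move=> nf; rewrite /apex_join insubdK //.
have [i iB] : exists i, i \notin (top |: val B)%SET.
  apply: contrapT => all_in; move/negP: nf; apply; apply/fintype.subsetP => i.
  rewrite !finset.inE => it; apply: contrapT => /negP iB; apply: all_in.
  by exists i; rewrite !finset.inE negb_or it.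
rewrite unfold_in; apply/properP; split; first exact: finset.subsetT.
by exists i.
Qed.

Definition widen_proper (A : properset n) : properset n.+1 :=
  insubd facet (lift top @: val A)%SET.

Lemma widen_properE (A : properset n) :
  val (widen_proper A) = (lift top @: val A)%SET.
Proof.
rewrite /widen_proper insubdK // unfold_in; apply/properP.
split; first exact: finset.subsetT.
exists top; rewrite ?finset.inE //; apply/negP => /finset.imsetP[i _ ti].
by have := neq_lift top i; rewrite -ti eqxx.
Qed.

Definition restrict_proper (B : properset n.+1) : properset n :=
  insubd (empty_set n) (lift top @^-1: val B)%SET.

Lemma restrict_properE (B : properset n.+1) : ~~ (facet <= B)%O ->
  val (restrict_proper B) = (lift top @^-1: val B)%SET.
Proof.
move=> nf; rewrite /restrict_proper insubdK //.
rewrite unfold_in finset.properT; apply: contraNN nf => /eqP Ball.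
apply/fintype.subsetP => i; rewrite !finset.inE => it.
have [j ->] : exists j, i = lift top j.
  by case: (unliftP top i) it => [j ->|->]; [exists j|rewrite eqxx].
have : j \in (lift top @^-1: val B)%SET by rewrite Ball finset.inE.
by rewrite finset.inE.
Qed.

Lemma widen_le (A A' : properset n) : (A <= A')%O ->
  (widen_proper A <= widen_proper A')%O.
Proof.
move=> AA'; rewrite /Order.le /= /properset_le !widen_properE.
exact: finset.imsetS.
Qed.

Lemma widen_restrict (A : properset n) : ~~ (facet <= widen_proper A)%O /\
  restrict_proper (widen_proper A) = A.
Proof.
have nf : ~~ (facet <= widen_proper A)%O.
  have := valP A; rewrite finset.properT => Aall; apply: contraNN Aall => fA.
  apply/eqP/finset.setP => j; rewrite finset.inE.
  have : lift top j \in val (widen_proper A).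
    move/fintype.subsetP: fA; apply; rewrite !finset.inE eq_sym.
    exact: neq_lift.
  by rewrite widen_properE finset.mem_imset //; exact: lift_inj.
split=> //; apply: val_inj; rewrite restrict_properE // widen_properE.
apply/finset.setP => j; rewrite finset.inE finset.mem_imset //.
exact: lift_inj.
Qed.

(** The added element is [true], the one element of [bool] that [X] admits. *)
Let J_rel_fun (y : collage (join_rel P (properset n.+1))) (_ : bool) : bool :=
  if y is inr B then ~~ (facet <= B)%O else true.

Fact apex_rel_lower y y' b b' : (y' <= y)%O -> J_rel_fun y b ->
  (b <= b')%O -> J_rel_fun y' b'.
Proof.
case: y y' => [q|B] [q'|B'] //=; rewrite collage_leE /= => le nf _.
by apply: contraNN nf => fB'; exact: le_trans le.
Qed.

Definition apex_rel := LowerRel apex_rel_lower.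

Lemma apex_rel_inr B b : apex_rel (inr B) b = ~~ (facet <= B)%O.
Proof. by []. Qed.

Let X : set (collage apex_rel) := fun y =>
  match y with inl z => join_boundary Q z | inr b => b end.

Let C := collage (join_rel (collage (join_rel P (properset n))) (properset 1)).

(** The boundary of a simplex is the suspension of the boundary of a facet. The facet itself is one
    cone point; the added element, which absorbs all sets containing [top], is the other. *)
Let to_apex (y : C) : collage apex_rel :=
  match y with
  | inl (inl q) => inl (inl q)
  | inl (inr A) => inl (inr (widen_proper A))
  | inr T => if T == point0 then inl (inr facet) else inr true
  end.

Let of_apex (y : collage apex_rel) : C :=
  match y with
  | inl (inl q) => inl (inl q)
  | inl (inr B) => if top \in val B then inr point1
                   else if (facet <= B)%O then inr point0
                   else inl (inr (restrict_proper B))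
  | inr _ => inr point1
  end.

(** Everything below [true] is conical through [B <= B U {top} >= {top}]. *)
Let apex_removal : homotopy_equivalent R (realization R X)
  (realization R (join_boundary (n := n.+1) Q)).
Proof.
have X_inl : X `\ inr true = [set y : collage apex_rel |
    if y is inl a then join_boundary Q a else False].
  by apply/seteqP; split=> [[z|[]] [Xz //= nz]|[z|b] //= Xz].
apply: homotopy_equivalent_trans _ (homotopy_equivalent_sym
  (collage_inl_equivalent R apex_rel (join_boundary Q) (inr apex))).
rewrite -X_inl.
have below y : X y -> (y < inr true)%O ->
    exists2 z, y = inl z & apex_rel z true.
  case: y => [z _|[]] //.
  by rewrite lt_neqAle => /andP[_]; rewrite collage_leE /= => az; exists z.
have lt_apex z : apex_rel z true -> (inl z < inr true :> collage apex_rel)%O.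
  by move=> az; rewrite lt_neqAle collage_leE /= az.
have nfacet (B : properset n.+1) : top \in val B -> ~~ (facet <= B)%O.
  by move=> tB; apply/negP => /facet_le[]; rewrite tB.
have apex_nf : ~~ (facet <= apex)%O by apply: nfacet; rewrite finset.inE.
have apex0 : ~~ is_empty apex.
  by apply/finset.set0Pn; exists top; rewrite finset.inE.
have join_nf B : ~~ (facet <= B)%O -> ~~ (facet <= apex_join B)%O.
  by move=> nf; apply: nfacet; rewrite apex_joinE // !finset.inE eqxx.
have join0 B : ~~ (facet <= B)%O -> ~~ is_empty (apex_join B).
  move=> nf; apply/finset.set0Pn; exists top.
  by rewrite apex_joinE // !finset.inE eqxx.
have apex_le_join B : ~~ (facet <= B)%O -> (apex <= apex_join B)%O.
  move=> nf; rewrite /Order.le /= /properset_le apex_joinE //.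
  exact: finset.subsetUl.
have le_join B : ~~ (facet <= B)%O -> (B <= apex_join B)%O.
  move=> nf; rewrite /Order.le /= /properset_le apex_joinE //.
  exact: finset.subsetUr.
apply: (@removal_homotopy R _ _ X (inr true)
  (fun y => match y with
    | inl (inl q) => inl (inr apex)
    | inl (inr B) => inl (inr (apex_join B))
    | inr b => inr b end)
  (inl (inr apex))) => //.
- move=> y Xy /(below _ Xy)[[q|B] -> nf].
    by split=> //; exact: lt_apex.
  by split; [exact: join0|apply: lt_apex; exact: join_nf].
- move=> y z Xy Xz /(below _ Xz)[w -> nf].
  case: y Xy => [[q|B]|b] // _; case: w nf => [q'|B'] // nf;
    rewrite !collage_leE.
    by move=> _; exact: apex_le_join.
  rewrite /= collage_leE /= => BB'.
  have nfB : ~~ (facet <= B)%O by apply: contraNN nf => fB; exact: le_trans BB'.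
  rewrite collage_leE /= /Order.le /= /properset_le !apex_joinE //.
  exact: finset.setUS.
- move=> y Xy /(below _ Xy)[[q|B] -> nf]; rewrite collage_leE //=.
  exact: le_join.
- move=> y Xy /(below _ Xy)[[q|B] -> nf]; rewrite collage_leE //=.
  exact: apex_le_join.
- exact: lt_apex.
Qed.

(** Both sides reduce to [Q + J_n + J_1]. On the right the inner suspension must first be replaced
    by its poset model under [S^1], which takes the homotopy invariance of suspension. *)
Lemma double_suspension : homotopy_equivalent R
  (susp R n.+1 (realization R Q)) (susp R 1 (susp R n (realization R Q))).
Proof.
apply: homotopy_equivalent_trans (susp_realization R n.+1 Q) _.
apply: homotopy_equivalent_trans (homotopy_equivalent_sym apex_removal) _.
apply: homotopy_equivalent_sym.
apply: homotopy_equivalent_trans (susp_equivalent 1 (susp_realization R n Q)) _.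
apply: homotopy_equivalent_trans (susp_realization R 1 (join_boundary Q)) _.
apply: (@poset_equivalence R _ _ _ _ _ _ to_apex of_apex).
- split=> [[[q|A]|T] //|].
  + move=> /finset.set0Pn[i iA]; apply/finset.set0Pn; exists (lift top i).
    by rewrite widen_properE finset.imset_f.
  + move=> /pointP[] ->; rewrite /to_apex ?eqxx ?point1_neq_point0 //.
    by apply/finset.set0Pn; exists ord0; rewrite !finset.inE.
  move=> [[q|A]|T] [[q'|A']|T'] // CT CT'; rewrite !collage_leE.
  + by move=> _; rewrite /to_apex; case: ifP.
  + exact: widen_le.
  + case: (pointP CT') => -> _; rewrite /to_apex ?eqxx ?point1_neq_point0 /=.
      rewrite collage_leE /= le_facet widen_properE.
      apply/negP => /finset.imsetP[i _ ti].
      by have := neq_lift top i; rewrite -ti eqxx.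
    by rewrite apex_rel_inr; case: (widen_restrict A).
  + case: (pointP CT) => ->; case: (pointP CT') => ->;
      rewrite [collage_le _ _]/=.
    * by move=> _; exact: collage_le_refl.
    * by rewrite le_point01.
    * by rewrite le_point10.
    * by move=> _; exact: collage_le_refl.
- split=> [[[q|B]|b] //|].
  + move=> B0; rewrite /of_apex; case: ifPn => [_|tB]; first exact: point1_neq0.
    case: ifPn => [_|nf]; first exact: point0_neq0.
    move/finset.set0Pn: B0 => [i iB]; apply/finset.set0Pn.
    case: (unliftP top i) iB => [j ->|->] iB; last by rewrite iB in tB.
    by exists j; rewrite restrict_properE // finset.inE.
  + by move=> _; exact: point1_neq0.
  move=> [[q|B]|b] [[q'|B']|b'] // XB XB'; rewrite !collage_leE.
  + by rewrite /of_apex; do 2?case: ifP.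
  + move=> le; have {le} BB' : (B <= B')%O := le.
    rewrite /of_apex; case: ifPn => [tB|tB].
      have /fintype.subsetP/(_ _ tB) -> := BB'.
      exact: lexx.
    case: ifPn => [fB|nfB].
      have fB' : (facet <= B')%O by exact: le_trans BB'.
      have [/negbTE -> _] := facet_le fB'.
      by rewrite fB' /= lexx.
    case: ifPn => // tB'; case: ifPn => // nfB'.
    rewrite /= collage_leE /= /Order.le /= /properset_le !restrict_properE //.
    exact: finset.preimsetS.
  + rewrite /= apex_rel_inr => nf; case: ifPn => _; first exact: lexx.
    by rewrite (negbTE nf).
- case=> [[q|A]|T] CT; rewrite collage_leE /to_apex /of_apex.
  + exact: lexx.
  + have [nf rA] := widen_restrict A; rewrite (negbTE nf) rA ifF.
      exact: lexx.
    apply/negbTE; rewrite widen_properE; apply/negP => /finset.imsetP[i _ ti].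
    by have := neq_lift top i; rewrite -ti eqxx.
  + case: (pointP CT) => ->; rewrite ?eqxx ?point1_neq_point0 /=.
      by rewrite !finset.inE eqxx /= lexx.
    exact: lexx.
- case=> [[q|B]|b] XB; rewrite collage_leE /to_apex /of_apex.
  + exact: lexx.
  + case: ifPn => [tB|tB].
      rewrite point1_neq_point0 /= apex_rel_inr.
      by apply/negP => /facet_le[]; rewrite tB.
    case: ifPn => [fB|nfB].
      by rewrite eqxx /= collage_leE /= le_facet.
    rewrite /= collage_leE /= /Order.le /= /properset_le widen_properE.
    rewrite restrict_properE //; apply/fintype.subsetP => i iB.
    case: (unliftP top i) iB => [j ->|->] iB; last by rewrite iB in tB.
    by rewrite finset.imset_f // finset.inE.
  + by rewrite point1_neq_point0 /=; case: b XB.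
Qed.

End double_suspension.

(** * The link as a suspension *)

Section link_suspension.
Variables (R : realType) (V : choiceType) (K : simplicial_complex V).
Variables (sigma : simplex K) (n : nat) (v : 'I_n.+1 -> V).
Hypothesis v_inj : injective v.
Hypothesis v_in : forall i, v i \in vertices sigma.
Hypothesis v_onto : forall x, x \in vertices sigma -> exists i, x = v i.
Implicit Types (s t : simplex K) (A : properset n).

Definition trace s : {set 'I_n.+1} := [set i | v i \in vertices s]%SET.

Definition face A : {fset V} := [fset v i | i in val A]%fset.

Lemma mem_face A i : (v i \in face A) = (i \in val A).
Proof.
apply/imfsetP/idP => [[j /= jA /v_inj ->] //|iA].
by exists i.
Qed.

Lemma face_sub A : (face A `<=` vertices sigma)%fset.
Proof. by apply/fsubsetP => _ /imfsetP[i _ ->]; exact: v_in. Qed.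

Lemma trace_le s t : (s <= t)%O -> trace s \subset trace t.
Proof.
move=> /fsubsetP st; apply/fintype.subsetP => i; rewrite !finset.inE.
exact: st.
Qed.

Lemma trace_proper s : trace s \proper [set: 'I_n.+1]%SET = ~~ (sigma <= s)%O.
Proof.
rewrite finset.properT; congr (~~ _); apply/eqP/fsubsetP => [all_s x|sub].
  by move=> /v_onto[i ->]; have := finset.in_setT i; rewrite -all_s finset.inE.
by apply/finset.setP => i; rewrite !finset.inE sub // v_in.
Qed.

Lemma trace0 s :
  (trace s == finset.set0) = [disjoint vertices s & vertices sigma]%fset.
Proof.
apply/eqP/fdisjointP => [t0 x xs|dis].
  apply/negP => /v_onto[i xi]; have := finset.in_set0 i.
  by rewrite -t0 finset.inE -xi xs.
apply/finset.setP => i; rewrite !finset.inE.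
by apply/negP => /dis; rewrite v_in.
Qed.

Lemma face_neq0 A : ~~ is_empty A -> face A != fset0.
Proof.
move=> /finset.set0Pn[i iA]; apply/fset0Pn; exists (v i).
by rewrite mem_face.
Qed.

Let adjoin s A : simplex K := to_simplex sigma (vertices s `|` face A)%fset.

Let adjoinE s A : star sigma s ->
  vertices (adjoin s A) = (vertices s `|` face A)%fset.
Proof.
move=> ss; apply: to_simplexK; apply: faces_sub ss _ _.
  exact: fsetUS (face_sub A).
exact/fsetU_neq0l/simplex_neq0.
Qed.

Let face_simplex A : simplex K := to_simplex sigma (face A).

Let face_simplexE A : ~~ is_empty A -> vertices (face_simplex A) = face A.
Proof.
move=> A0; apply: to_simplexK; apply: (faces_sub _ (face_sub A) (face_neq0 A0)).
exact: verticesP.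
Qed.

Fact trace_rel_lower s s' A A' : (s' <= s)%O -> trace s \subset val A ->
  (A <= A')%O -> trace s' \subset val A'.
Proof.
move=> /trace_le ss sA AA'.
exact: fintype.subset_trans ss (fintype.subset_trans sA AA').
Qed.

Definition trace_rel : lower_rel (simplex K) (properset n) :=
  LowerRel trace_rel_lower.

Let X (S : {set properset n}) : set (collage trace_rel) :=
  fun y => match y with inl s => link sigma s | inr A => A \in S end.

(** If the trace of [s] lies in [A], then that of [s U A] is exactly [A]; being proper, it keeps the
    union from containing [sigma]. *)
Lemma link_adjoin s A : link sigma s -> trace s \subset val A ->
  link sigma (adjoin s A) /\ trace (adjoin s A) \subset val A.
Proof.
move=> /linkE[ss ns] sA; have tE : trace (adjoin s A) = val A.
  apply/finset.setP => i; rewrite finset.inE adjoinE // inE mem_face.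
  case: (boolP (i \in val A)) => [|iA]; first by rewrite orbT.
  rewrite orbF; apply/negP => vis; move/negP: iA; apply.
  by move/fintype.subsetP: sA; apply; rewrite finset.inE.
rewrite tE; split; last exact: fintype.subxx.
apply/linkE; split; last by rewrite -trace_proper tE (valP A).
rewrite /star adjoinE // (_ : (_ `|` _)%fset = (vertices s `|` sigma)%fset) //.
by rewrite -fsetUA (fsetUidPr _ _ (face_sub A)).
Qed.

Lemma link_face A : ~~ is_empty A ->
  link sigma (face_simplex A) /\ trace (face_simplex A) \subset val A.
Proof.
move=> A0; have tE : trace (face_simplex A) = val A.
  by apply/finset.setP => i; rewrite finset.inE face_simplexE // mem_face.
rewrite tE; split; last exact: fintype.subxx.
apply/linkE; split; last by rewrite -trace_proper tE (valP A).
rewrite /star face_simplexE // (fsetUidPr _ _ (face_sub A)).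
exact: verticesP.
Qed.

(** The elements of [S] are removed from the bottom up, so that only simplices
    of the link remain below the removed element. *)
Lemma remove_faces (S : {set properset n}) :
  (forall A, A \in S -> ~~ is_empty A) ->
  (forall A A', A \in S -> (A <= A')%O -> A' \in S) ->
  homotopy_equivalent R (realization R (X S)) (realization R (link sigma)).
Proof.
have [m] := ubnP #|S|; elim: m S => // m IH S Sm S0 Sup.
have [->|/finset.set0Pn[A1 A1S]] := eqVneq S finset.set0.
  have -> : X finset.set0 = [set y : collage trace_rel |
      if y is inl a then link sigma a else False].
    by apply/seteqP; split=> [[s|A]|[s|A]] //=; rewrite finset.inE.
  exact: homotopy_equivalent_sym (collage_inl_equivalent R trace_rel _ sigma).
have [A AS Amin] : exists2 A, A \in S &
    forall A', A' \in S -> (A' <= A)%O -> A' = A.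
  case: (arg_minnP (fun A : properset n => #|val A|) A1S) => A AS Amin.
  exists A => // A' A'S A'A; apply/val_inj/eqP; rewrite finset.eqEcard.
  by apply/andP; split; [exact: A'A|exact: Amin].
have XA : X S `\ inr A = X (S :\ A)%SET.
  apply/seteqP; split=> [[s|A'] [XS nA] //|[s|A'] XS].
  - rewrite /X finset.in_setD1 [_ \in S]XS andbT.
    by apply/eqP => e; apply: nA; rewrite e.
  - by split.
  - move: XS; rewrite /X finset.in_setD1 => /andP[/eqP nA A'S].
    by split=> // -[].
apply: homotopy_equivalent_trans (IH (S :\ A)%SET _ _ _); last 3 first.
- by move: Sm; rewrite (finset.cardsD1 A) AS.
- by move=> A'; rewrite finset.in_setD1 => /andP[_]; exact: S0.
- move=> B B'; rewrite !finset.in_setD1 => /andP[BA BS] BB'.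
  rewrite (Sup B) // andbT; apply: contraNneq BA => B'A.
  by rewrite (Amin B) // -B'A.
rewrite -XA.
have below y : X S y -> (y < inr A)%O -> exists2 s, y = inl s &
    link sigma s /\ trace s \subset val A.
  case: y => [s|B] XS lt; first by exists s => //; split=> //; exact: ltW lt.
  have BA : (B <= A)%O by exact: ltW lt.
  by move: lt; rewrite (Amin B XS BA) ltxx.
have lt_face s : trace s \subset val A ->
    (inl s < inr A :> collage trace_rel)%O.
  by move=> sA; rewrite lt_neqAle collage_leE /=.
have [linkA traceA] := link_face (S0 A AS).
(* With [A] regarded as a face of [sigma], everything below it is conical through
   [s <= s U A >= A]. *)
apply: (@removal_homotopy R _ _ (X S) (inr A)
  (fun y => match y with inl s => inl (adjoin s A) | inr B => inr B end)
  (inl (face_simplex A))) => //.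
- move=> y Xy /(below _ Xy)[s -> [ls sA]]; have [la ta] := link_adjoin ls sA.
  by split=> //; exact: lt_face.
- move=> y z Xy Xz /(below _ Xz)[t -> [lt tA]].
  case: y Xy => [s|B] // ls st; have {}st : (s <= t)%O by exact: st.
  have [[ss _] [ts _]] := ((linkE sigma s).1 ls, (linkE sigma t).1 lt).
  by rewrite collage_leE /= simplex_le !adjoinE // fsetSU.
- move=> y Xy /(below _ Xy)[s -> [/linkE[ss _] sA]].
  by rewrite collage_leE /= simplex_le adjoinE // fsubsetUl.
- move=> y Xy /(below _ Xy)[s -> [/linkE[ss _] sA]].
  rewrite collage_leE /= simplex_le adjoinE // face_simplexE ?S0 //.
  exact: fsubsetUr.
- exact: lt_face.
Qed.

Let S0 : {set properset n} := [set A | ~~ is_empty A]%SET.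

(** Deleting [sigma] from a simplex strictly above it and adding [sigma] to a link simplex disjoint
    from it are inverse to each other; this identifies [P_{> sigma}] with the part of the link on
    which the trace is empty. *)
Let of_join (y : collage (join_rel (simplex K) (properset n))) :
    collage trace_rel :=
  match y with
  | inl b => inl (to_simplex sigma (vertices b `\` vertices sigma)%fset)
  | inr A => inr A
  end.

Let to_join (y : collage trace_rel) :
    collage (join_rel (simplex K) (properset n)) :=
  match y with
  | inl s => if trace s == finset.set0
             then inl (to_simplex sigma (vertices s `|` vertices sigma)%fset)
             else inr (insubd (empty_set n) (trace s))
  | inr A => inr A
  end.

(** Strictness makes the difference nonempty, hence a face. Adding [sigma] gives [b] back, which
    puts the difference into the star, and its empty trace shows that it does not contain
    [sigma]. *)
Let small_diff b : small_link sigma b ->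
  [/\ vertices (to_simplex sigma (vertices b `\` vertices sigma)%fset) =
        (vertices b `\` vertices sigma)%fset,
      link sigma (to_simplex sigma (vertices b `\` vertices sigma)%fset) &
      trace (to_simplex sigma (vertices b `\` vertices sigma)%fset) =
        finset.set0].
Proof.
rewrite /small_link /strict_upset /= lt_neqAle => /andP[sb /fsubsetP sigb].
have bE : vertices (to_simplex sigma (vertices b `\` vertices sigma)%fset) =
    (vertices b `\` vertices sigma)%fset.
  apply: to_simplexK; apply: (faces_sub (verticesP b)); first exact: fsubsetDl.
  apply: contraNneq sb => bD; apply/eqP/val_inj/eqP => /=.
  rewrite eqEfsubset; apply/andP; split; first exact/fsubsetP.
  by rewrite -fsetD_eq0 bD.
have t0 : trace (to_simplex sigma (vertices b `\` vertices sigma)%fset) =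
    finset.set0.
  by apply/finset.setP => i; rewrite !finset.inE bE inE v_in.
split=> //; apply/linkE; split; last first.
  rewrite -trace_proper t0 finset.proper0.
  by apply/finset.set0Pn; exists ord0; rewrite finset.inE.
rewrite /star bE fsetUC fsetUDl fsetDv fsetD0 (fsetUidPr _ _ _) ?verticesP //.
exact/fsubsetP.
Qed.

Let trace_val s : link sigma s ->
  val (insubd (empty_set n) (trace s)) = trace s.
Proof. by move=> /linkE[_]; rewrite -trace_proper => ts; exact: insubdK. Qed.

Lemma link_suspension : homotopy_equivalent R
  (susp R n (realization R (small_link sigma))) (realization R (link sigma)).
Proof.
apply: homotopy_equivalent_trans (susp_realization R n (small_link sigma)) _.
apply: homotopy_equivalent_trans (remove_faces (S := S0) _ _); last 2 first.
- by move=> A; rewrite finset.inE.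
- move=> A A'; rewrite !finset.inE => A0 AA'; apply: contraNN A0.
  by move=> A'0; have := is_empty_le AA'; rewrite A'0.
have joinE s : link sigma s ->
    vertices (to_simplex sigma (vertices s `|` vertices sigma)%fset) =
    (vertices s `|` vertices sigma)%fset.
  by move=> /linkE[ss _]; exact: to_simplexK.
apply: (@poset_equivalence R _ _ _ _ _ _ of_join to_join).
- split=> [[b|A] /=|].
  + by move=> /small_diff[].
  + by rewrite finset.inE.
  move=> [b|A] [b'|A'] // Qb Qb'; rewrite !collage_leE /=.
  + have [bE _ _] := small_diff Qb; have [bE' _ _] := small_diff Qb'.
    by move=> bb'; rewrite simplex_le bE bE' fsetSD.
  + have [_ _ t0] := small_diff Qb.
    by rewrite /lrel /= t0 finset.sub0set.
- split=> [[s|A] /=|].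
  + move=> ls; case: ifPn => [t0|t0].
      rewrite /join_boundary /small_link /strict_upset /= lt_neqAle.
      rewrite simplex_le joinE // fsubsetUr andbT.
      have /fset0Pn[x xs] := simplex_neq0 s.
      apply/eqP => sE; move: t0; rewrite trace0 => /fdisjointP/(_ _ xs).
      by rewrite sE joinE // inE xs.
    by rewrite /join_boundary /is_empty trace_val.
  + by rewrite finset.inE.
  move=> [s|A] [t|B] // Xs Xt; rewrite !collage_leE.
  + move=> st'; have {st'} st : (s <= t)%O := st'.
    rewrite /to_join; case: ifPn => ts; case: ifPn => tt //.
    * by rewrite /= simplex_le !joinE // fsetSU.
    * by move: ts; rewrite -finset.subset0 -(eqP tt) trace_le.
    * by rewrite /= /Order.le /= /properset_le !trace_val // trace_le.
  + move=> sB; rewrite /to_join; case: ifPn => // ts.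
    by rewrite /= /Order.le /= /properset_le trace_val.
- case=> [b|A] Qb; rewrite collage_leE //=.
  have [bE lb t0] := small_diff Qb; rewrite t0 eqxx /= simplex_le joinE // bE.
  by apply/fsubsetP => x xb; rewrite !inE xb andbT orNb.
- case=> [s|A] Xs; rewrite collage_leE //=.
  case: ifPn => ts /=.
    have sE : vertices s = (vertices (to_simplex sigma
        (vertices s `|` vertices sigma)%fset) `\` vertices sigma)%fset.
      rewrite joinE // fsetDUl fsetDv fsetU0; apply/esym/fsetDidPl.
      by move: ts; rewrite trace0.
    rewrite simplex_le -sE to_simplexK //; exact: verticesP.
  by rewrite /lrel /= trace_val.
Qed.

End link_suspension.

(** * Numbering the vertices, and the conclusion *)

Lemma vertex_enumeration (V : choiceType) (K : simplicial_complex V)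
    (sigma : simplex K) (n : nat) : simplex_dim sigma = n ->
  exists v : 'I_n.+1 -> V, [/\ injective v, forall i, v i \in vertices sigma &
    forall x, x \in vertices sigma -> exists i, x = v i].
Proof.
move=> dim; have [x0 x0s] := fset0Pn _ (simplex_neq0 sigma).
(* Simplices are nonempty, so the truncated predecessor in [simplex_dim] loses nothing. *)
have sz : size (enum_fset (vertices sigma)) = n.+1.
  by rewrite -dim /simplex_dim prednK // cardfs_gt0 simplex_neq0.
exists (fun i : 'I_n.+1 => nth x0 (enum_fset (vertices sigma)) i); split.
- move=> i j /eqP; rewrite nth_uniq ?sz ?ltn_ord ?fset_uniq // => /eqP.
  exact: val_inj.
- by move=> i; apply: mem_nth; rewrite sz ltn_ord.
- move=> x xs; have xi : (index x (enum_fset (vertices sigma)) < n.+1)%N.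
    by rewrite -sz index_mem.
  by exists (Ordinal xi); rewrite /= nth_index.
Qed.

Theorem theorem3p19 (R : realType) (V : choiceType) (K : simplicial_complex V)
    (sigma : simplex K) (n : nat) (dim_sigma : simplex_dim sigma = n) :
  exists f : susp R n (realization R (small_link sigma)) ->
             realization R (link sigma),
    [/\ homotopy_equivalence R f,
        homotopy_equivalent R
          (susp R n.+1 (realization R (small_link sigma)))
          (susp R 1 (susp R n (realization R (small_link sigma)))),
        homotopy_equivalence R (susp_map (R := R) (n := 1) f)
      & exists g : susp R 1 (realization R (link sigma)) ->
                   stratified_link R sigma,
          homotopy_equivalence R g].
Proof.
have [v [v_inj v_in v_onto]] := vertex_enumeration dim_sigma.
have [f fE] := link_suspension R v_inj v_in v_onto.
exists f; split=> //.
- exact: double_suspension.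
- exact: susp_map_equivalence.
- exact: susp_link_cofiber.
Qed.
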